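(* Let $N=m+n\to\infty$ with $m/N\to r$, where $r\in(0,1)$ is a constant and $r\neq\frac12$, and let $G=G_N$ be a simple undirected graph on the nodes $\{1,\dots,N\}$ for each $N$. Put $T=|G|+V_G$ and suppose that, as $N\to\infty$, $$\sum_{i=1}^N|G_i|^2=o(T^{1.5}),\qquad \sum_{i=1}^N|\tilde d_i|^3=o(T^{1.5}),\qquad \sum_{i=1}^N\ \sum_{j,k\in \mathrm{node}_{G_i},\, j\neq k}\tilde d_j\tilde d_k=o(T^2).$$ Then, under the permutation null distribution, the original edge-count statistic $Z_o^P$ converges in distribution to $N(0,1)$.
   Context: Graph notation. $G$ denotes both the graph on nodes $\{1,\dots,N\}$ (simple: no duplicate edges, no loops; undirected) and its edge set; $|\cdot|$ is cardinality, so $|G|$ is the number of edges. $G_i$ is the set of edges having node $i$ as an endpoint (so $|G_i|$ is the degree of $i$), and $\mathrm{node}_{G_i}$ is the set of neighbours of $i$ (excluding $i$). $\tilde d_i=|G_i|-2|G|/N$ is the centered degree, $V_G=\sum_{i=1}^N\tilde d_i^{\,2}=\sum_{i=1}^N|G_i|^2-4|G|^2/N$. $a_N=o(b_N)$ means $\lim_{N\to\infty}a_N/b_N=0$. Permutation null distribution. The graph is fixed; the labels $(g_1,\dots,g_N)\in\{1,2\}^N$ are random: each choice of $m$ of the $N$ nodes to receive label $1$ (sample X), the remaining $n=N-m$ nodes receiving label $2$ (sample Y), has probability $1/\binom{N}{m}$. $\mathsf E_P$, $\mathsf{Var}_P$ denote expectation and variance under this distribution. Statistic. For $j=1,2$,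 $R_j$ is the number of edges of $G$ both of whose endpoints have label $j$. Let $$Z_o^P=\frac{R_1+R_2-\mathsf E_P(R_1+R_2)}{\sqrt{\mathsf{Var}_P(R_1+R_2)}}.$$ *)

(* Defs.v *)
From HB Require Import structures.
From mathcomp Require Import all_boot all_order all_algebra.
From mathcomp Require Import all_classical all_reals all_analysis.

Set Implicit Arguments.
Unset Strict Implicit.
Unset Printing Implicit Defensive.

Import Order.TTheory GRing.Theory Num.Theory.
Import numFieldNormedType.Exports.

Local Open Scope classical_set_scope.
Local Open Scope ring_scope.

(* A graph is identified with its edge set, an edge being a set of nodes.     *)
Definition simple_graph (T : finType) (G : {set {set T}}) : Prop :=
  forall E : {set T}, E \in G -> #|E| = 2%N.

Definition edges_at (T : finType) (G : {set {set T}}) (i : T) : {set {set T}} :=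
  [set E in G | i \in E]%SET.

Definition neighbours (T : finType) (G : {set {set T}}) (i : T) : {set T} :=
  [set j | (j != i) && ([set i; j]%SET \in G)]%SET.

Definition centered_degree (R : realType) (N : nat) (G : {set {set 'I_N}})
    (i : 'I_N) : R :=
  #|edges_at G i|%:R - 2 * #|G|%:R / N%:R.

Definition degree_dispersion (R : realType) (N : nat) (G : {set {set 'I_N}}) : R :=
  \sum_(i < N) centered_degree R G i ^+ 2.

Definition scaleT (R : realType) (N : nat) (G : {set {set 'I_N}}) : R :=
  #|G|%:R + degree_dispersion R G.

(* An outcome is the set [A] of the [m] nodes that receive label 1; all such  *)
(* sets are equally likely.                                                   *)
Definition perm_label (N : nat) (A : {set 'I_N}) (i : 'I_N) : nat :=
  if i \in A then 1%N else 2%N.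

Definition perm_expectation (R : realType) (N m : nat)
    (f : {set 'I_N} -> R) : R :=
  \sum_(A : {set 'I_N} | #|A| == m) 'C(N, m)%:R^-1 * f A.

Definition perm_variance (R : realType) (N m : nat)
    (f : {set 'I_N} -> R) : R :=
  perm_expectation m (fun A => (f A - perm_expectation m f) ^+ 2).

Definition perm_prob (R : realType) (N m : nat) (event : pred {set 'I_N}) : R :=
  \sum_(A : {set 'I_N} | (#|A| == m) && event A) 'C(N, m)%:R^-1.

Definition within_count (N : nat) (G : {set {set 'I_N}}) (j : nat)
    (A : {set 'I_N}) : nat :=
  #|[set E in G | [forall i in E, perm_label A i == j]]%SET|.

Definition within_total (R : realType) (N : nat) (G : {set {set 'I_N}})
    (A : {set 'I_N}) : R :=
  (within_count G 1 A)%:R + (within_count G 2 A)%:R.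

Definition edge_count_stat (R : realType) (N m : nat) (G : {set {set 'I_N}})
    (A : {set 'I_N}) : R :=
  (within_total R G A - perm_expectation m (within_total R G)) /
  Num.sqrt (perm_variance m (within_total R G)).

Definition edge_count_cdf (R : realType) (N m : nat) (G : {set {set 'I_N}})
    (x : R) : R :=
  perm_prob R m (fun A => edge_count_stat R m G A <= x).

(* [a_N / b_N --> 0]. Since [x / 0 = 0] here, the quotient being meaningful   *)
(* for large [N] has to be required explicitly.                               *)
Definition is_little_o (R : realType) (a b : nat -> R) : Prop :=
  (\forall N \near \oo, b N != 0) /\ a N / b N @[N --> \oo] --> (0 : R).

(* Convergence of distribution functions to that of [mu] at each point where  *)
(* the latter is continuous.                                                  *)
Definition cvg_in_distribution (R : realType) (F : nat -> R -> R)
    (mu : probability (measurableTypeR R) R) : Prop :=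
  forall x : R,
    {for x, continuous (fun y : R => fine (mu [set t : R | t <= y]))} ->
    F N x @[N --> \oo] --> fine (mu [set t : R | t <= x]).

(* Main.v *)
Require Import Defs.
From HB Require Import structures.
From mathcomp Require Import all_boot all_order all_algebra.
From mathcomp Require Import all_classical all_reals all_analysis.
From mathcomp Require Import perm ring lra.

Set Implicit Arguments.
Unset Strict Implicit.
Unset Printing Implicit Defensive.

Import Order.TTheory GRing.Theory Num.Theory.
Import numFieldNormedType.Exports.

Local Open Scope classical_set_scope.
Local Open Scope ring_scope.

(** Exchanging the labels of two uniformly chosen nodes leaves the permutation
    law invariant, so it produces an exchangeable pair to which Stein's method
    applies without passing through independent labels.

    Let [x_i] be the indicator of label 1 at node [i] minus [p = m / N], let
    [mu = 2 p - 1], let [t_i] be the centred degrees and let [S_i] be the sum of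
    the [x_k] over the neighbours [k] of [i].  Up to an additive constant the
    count [R_1 + R_2] is [W = mu L + P], where [L = sum_i t_i x_i] and
    [P = sum_i x_i S_i].  The generator of the swap chain acts on [L] and [P]
    almost diagonally, with eigenvalues -1 and -2, and the combination
    [F = mu L + P / 2] solves its Poisson equation exactly, whatever [N] is
    ([potential_poisson]).  Summation by parts then turns [E ((W - E W) f (W))]
    into a multiple of the mean of [sum_ij DF * D(f (W))], where [D] is the
    increment along the swap of [i] and [j]; the choice [f = id] says that the
    variance of [W] is the same multiple of the mean of the carre du champ
    [sum_ij DF * DW].  The error in Stein's identity is therefore governed by the
    fluctuation of the carre du champ and by a third moment of the increments
    ([stein_bound]).

    The carre du champ is, up to small terms, a polynomial of degree three in the
    labels.  Its fluctuation is bounded by the Poincare inequality of the swap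
    chain ([poincare_orbit_class], [poincare_le]): the variance of a polynomial
    of degree [k] is at most the second moment of its increments, which are of
    degree [k - 1].  No joint moment of the labels beyond the covariance is ever
    computed.  The outcome is a multiple of the square root of [fluct], a sum of
    five terms: the sum over [k] of [(sum_(i ~ k) t_i) ^ 2], the number of closed
    walks of length four, and the sums of [d_i ^ 2], of [t_i ^ 4] and of
    [t_i ^ 2 d_i].  The first of them is the sum of the third hypothesis plus the
    last one, and the others are controlled by the first two hypotheses.

    For the variance itself a lower bound by a multiple of [T = |G| + V_G] is
    enough ([reduced_var_ge]).  The linear part contributes [mu ^ 2 V_G], which
    is where [r <> 1/2] enters; the quadratic part contributes a multiple of
    [|G|] because the first hypothesis forces [|G| = o (N * sqrt T)]
    ([edge_density_cube]), so that the negative correlation of the labels has no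
    effect in the limit.

    To reach distribution functions, an indicator is enclosed between piecewise
    linear functions.  For such a function the Stein equation has an explicit
    solution in terms of the Gaussian distribution function; all that the
    argument requires is that its derivative be bounded and Lipschitz, with
    constants that may depend on the test function ([stein_solution]). *)

(** * Derivatives of real functions *)

Section Derivatives.
Variable R : realType.
Implicit Types (f g : R -> R) (x a b : R).

Lemma is_derive_addf f g x a b : is_derive x 1 f a -> is_derive x 1 g b ->
  is_derive x 1 (fun y => f y + g y) (a + b).
Proof. by move=> *; exact: is_deriveD. Qed.

Lemma is_derive_subf f g x a b : is_derive x 1 f a -> is_derive x 1 g b ->
  is_derive x 1 (fun y => f y - g y) (a - b).
Proof. by move=> *; exact: is_deriveB. Qed.

Lemma is_derive_mulf f g x a b : is_derive x 1 f a -> is_derive x 1 g b ->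
  is_derive x 1 (fun y => f y * g y) (f x * b + a * g x).
Proof.
move=> fa gb; have := is_deriveM fa gb.
by rewrite /GRing.scale/= (mulrC (g x)).
Qed.

Lemma is_derive_constf (c : R) x : is_derive x 1 (fun _ : R => c) 0.
Proof. exact: is_derive_cst. Qed.

Lemma is_derive_idf x : is_derive x 1 (fun y : R => y) 1.
Proof. exact: is_derive_id. Qed.

Lemma is_derive_invf f x a : f x != 0 -> is_derive x 1 f a ->
  is_derive x 1 (fun y => (f y)^-1) (- a / (f x) ^+ 2).
Proof.
move=> f0 fa; apply: is_derive_eq (is_deriveV f0 fa) _.
by rewrite /GRing.scale/= mulNr mulNr mulrC.
Qed.

Lemma is_derive_congr f x a b : is_derive x 1 f a -> a = b -> is_derive x 1 f b.
Proof. by move=> + <-. Qed.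

Lemma is_derive_cts f x a : is_derive x 1 f a -> {for x, continuous f}.
Proof. by move=> /@ex_derive/derivable1_diffP/differentiable_continuous. Qed.

Lemma MVT_derivable f df (u v : R) : (forall x, is_derive x 1 f (df x)) -> u <= v ->
  exists2 c, c \in `[u, v] & f v - f u = df c * (v - u).
Proof.
move=> dfd uv; apply: MVT_segment => //.
by apply: continuous_subspaceT => x; exact: is_derive_cts (dfd x).
Qed.

(** A function that decreases towards the limit 0 stays nonnegative; this turns
    inequalities between tails into inequalities between derivatives. *)
Lemma ge0_decreasing_cvg0 f df :
  (forall x, 0 < x -> is_derive x 1 f (df x)) ->
  (forall x, 0 < x -> df x <= 0) -> f x @[x --> +oo] --> 0 ->
  forall x, 0 < x -> 0 <= f x.
Proof.
move=> fd df0 fl x x0; rewrite leNgt; apply/negP => fx.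
have mono y : x <= y -> f y <= f x.
  move=> xy.
  have [|c|c cxy E] := @MVT_segment R f df x y xy.
  - move=> z; rewrite in_itv/= => /andP[xz _]; apply: fd; exact: lt_trans xz.
  - apply: continuous_in_subspaceT => z /[!inE]/= /[!in_itv]/= /andP[xz _].
    by apply: is_derive_cts (fd z _); exact: lt_le_trans xz.
  - rewrite -subr_le0 E mulr_le0_ge0 ?subr_ge0// df0//.
    by move: cxy; rewrite in_itv/= => /andP[xc _]; exact: lt_le_trans xc.
have H1 : \forall y \near +oo, f x < f y by exact: (cvgr_gt 0 fl).
have H2 : \forall y \near +oo, x <= y by exact: nbhs_pinfty_ge (num_real _).
have [y [/= H3 H4]] := filter_ex (filterI H1 H2).
by have := mono _ H4; rewrite leNgt H3.
Qed.
End Derivatives.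

(** * The Gaussian density and distribution function *)

Section Gaussian.
Variable R : realType.
Implicit Types x y : R.

Definition gauss_pdf x : R := normal_pdf 0 1 x.
Definition gauss_cdf x : R := fine (normal_prob (0 : R) 1 [set t | t <= x]).
Local Notation phi := gauss_pdf.
Local Notation Phi := gauss_cdf.

Lemma gauss_pdfE x : phi x = normal_peak 1 * expR (- (x * x) / 2).
Proof.
by rewrite /gauss_pdf normal_pdfE ?oner_neq0// /normal_fun subr0 expr1n expr2.
Qed.

Lemma gauss_pdf_gt0 x : 0 < phi x.
Proof. by rewrite gauss_pdfE mulr_gt0 ?expR_gt0 ?normal_peak_gt0 ?oner_neq0. Qed.

Lemma gauss_pdf_le x : phi x <= normal_peak 1.
Proof. by apply: normal_pdf_ub; rewrite oner_neq0. Qed.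

Lemma gauss_pdfN x : phi (- x) = phi x.
Proof. by rewrite !gauss_pdfE mulrNN. Qed.

Lemma is_derive_gauss_pdf x : is_derive x 1 phi (- x * phi x).
Proof.
rewrite (_ : phi = fun y => normal_peak 1 * expR (- (y * y) / 2)); last first.
  by apply/funext => y; exact: gauss_pdfE.
apply: is_derive_congr (is_derive_mulf (is_derive_constf (normal_peak 1) x) _) _.
by rewrite /GRing.scale/=; field.
Qed.

Lemma is_derive_gauss_cdf x : is_derive x 1 Phi (phi x).
Proof.
have ->: Phi = fun y => Rintegral lebesgue_measure [set` `]-oo, y]] phi.
  by apply/funext => y; rewrite /gauss_cdf /Rintegral /normal_prob set_itvNyc.
have [] := @continuous_FTC1 R phi -oo%O x (x + 1).
- by rewrite ltrDl.
- apply: (integrableS _ _ (subsetT _)) => //; exact: integrable_normal_pdf.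
- by rewrite ltNyr.
- by apply: continuous_normal_pdf; rewrite oner_neq0.
- by move=> h1 h2; apply: is_derive_congr (@derivableP _ _ _ _ _ _ h1) _; rewrite -derive1E h2.
Qed.

Let idRV : measurableTypeR R -> R := idfun.
HB.instance Definition _ :=
  @isMeasurableFun.Build _ _ _ _ idRV (@measurable_id _ _ setT).

Let cdfE x : cdf (idRV : {RV (normal_prob (0 : R) 1) >-> R}) x = (Phi x)%:E.
Proof.
rewrite /cdf /distribution /pushforward /= preimage_id /gauss_cdf set_itvNyc.
rewrite fineK//; apply: fin_num_measure; rewrite -set_itvNyc; exact: measurable_itv.
Qed.

Lemma cvg_gauss_cdf_pinfty : Phi x @[x --> +oo] --> (1 : R).
Proof.
have := cvg_cdfy1 (idRV : {RV (normal_prob (0 : R) 1) >-> R}).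
rewrite (_ : cdf _ = EFin \o Phi); last by apply/funext => x; rewrite cdfE.
by move=> /fine_cvgP[_].
Qed.

Lemma cvg_gauss_cdf_ninfty : Phi (- x) @[x --> +oo] --> (0 : R).
Proof.
have := cvg_cdfNy0 (idRV : {RV (normal_prob (0 : R) 1) >-> R}).
rewrite (_ : cdf _ = EFin \o Phi); last by apply/funext => x; rewrite cdfE.
by move=> /fine_cvgP[_]; rewrite cvgNy_compNP.
Qed.
End Gaussian.

(** * Mills ratio and the Stein equation *)

Section Mills.
Variable R : realType.
Local Notation phi := (@gauss_pdf R).
Implicit Types x y z : R.

Lemma cvg_majorant_inv (f : R -> R) (C : R) :
  (forall x, 0 < x -> 0 <= f x <= C * x^-1) -> f x @[x --> +oo] --> (0 : R).
Proof.
move=> h; apply: (@squeeze_cvgr _ _ _ _ (fun _ => 0) (fun x => C * x^-1)).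
- near=> x; apply: h.
  by near: x; exact: nbhs_pinfty_gt.
- exact: cvg_cst.
- rewrite -[X in _ --> X](mulr0 C); apply: cvgM; first exact: cvg_cst.
  apply/gtr0_cvgV0; last exact: cvg_id.
  by near=> x; near: x; exact: nbhs_pinfty_gt.
Unshelve. all: by end_near. Qed.

Section MillsRatio.
Variable Psi : R -> R.
Hypothesis dPsi : forall x : R, is_derive x 1 Psi (- phi x).
Hypothesis Psi0 : Psi x @[x --> +oo] --> (0 : R).

(** The difference of the two sides, divided by [x], has derivative
    [- phi x / x ^ 2] and vanishes at infinity.  In this lemma and the next one
    [Psi] is either tail of the Gaussian law, read from the right. *)
Lemma mills_upper x : 0 < x -> x * Psi x <= phi x.
Proof.
move=> x0; suff : 0 <= phi x * x^-1 - Psi x.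
  by rewrite subr_ge0 ler_pdivlMr// mulrC.
apply: (ge0_decreasing_cvg0 (f := fun x => phi x * x^-1 - Psi x)
   (df := fun x => - (phi x / x ^+ 2))) => // [y y0|y y0|].
- have y00 : y != 0 by rewrite gt_eqF.
  apply: is_derive_congr (is_derive_subf (is_derive_mulf (is_derive_gauss_pdf y) (is_derive_invf y00 (is_derive_idf y))) (dPsi y)) _.
  by field.
- by rewrite oppr_le0 divr_ge0// ?sqr_ge0// ltW// gauss_pdf_gt0.
- rewrite -[X in _ --> X](subr0 (0:R)); apply: cvgB => //.
  apply: (@cvg_majorant_inv _ (normal_peak 1)) => y y0.
  rewrite ler_wpM2r ?gauss_pdf_le ?invr_ge0 ?(ltW y0)// andbT.
  by rewrite divr_ge0// ltW// gauss_pdf_gt0.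
Qed.

(** Here the difference divided by [1 + x ^ 2] has derivative
    [- 2 phi x / (1 + x ^ 2) ^ 2]. *)
Lemma mills_lower x : 0 < x -> x * phi x <= (1 + x * x) * Psi x.
Proof.
move=> x0.
have pos y : 0 < 1 + y * y :> R by rewrite ltr_wpDr// -expr2 sqr_ge0.
suff : 0 <= Psi x - phi x * (x * (1 + x * x)^-1).
  by rewrite subr_ge0 mulrA ler_pdivrMr// mulrC [_ * Psi x]mulrC.
apply: (ge0_decreasing_cvg0 (f := fun x => Psi x - phi x * (x * (1 + x * x)^-1))
   (df := fun x => - (2 * phi x / (1 + x * x) ^+ 2))) => // [y y0|y y0|].
- have y00 : 1 + y * y != 0 by rewrite gt_eqF.
  apply: is_derive_congr (is_derive_subf (dPsi y) (is_derive_mulf (is_derive_gauss_pdf y) (is_derive_mulf (is_derive_idf y)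
     (@is_derive_invf R (fun z => 1 + z * z) y _ y00 (is_derive_addf (is_derive_constf _ _) (is_derive_mulf (is_derive_idf y) (is_derive_idf y))))))) _.
  by field.
- rewrite oppr_le0 divr_ge0// ?sqr_ge0//.
  by rewrite mulr_ge0// ltW// gauss_pdf_gt0.
- rewrite -[X in _ --> X](subr0 (0:R)); apply: cvgB => //.
  apply: (@cvg_majorant_inv _ (normal_peak 1)) => y y0.
  apply/andP; split.
    by rewrite !mulr_ge0// ?invr_ge0 ?ltW// gauss_pdf_gt0.
  apply: ler_pM.
  + by rewrite ltW// gauss_pdf_gt0.
  + by rewrite mulr_ge0// ?invr_ge0 ?ltW.
  + exact: gauss_pdf_le.
  + rewrite ler_pdivrMr// mulrDr mulr1 mulKf ?gt_eqF//.
    by rewrite lerDr invr_ge0 ltW.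
Qed.
End MillsRatio.
End Mills.

Section SteinEquation.
Variable R : realType.
Local Notation phi := (@gauss_pdf R).
Implicit Types x y z : R.
Local Notation Phi := (@gauss_cdf R).
Local Notation mu := (@lebesgue_measure R).
Variables (h : R -> R) (a b K : R).
Hypothesis ab : a <= b.
Hypothesis h01 : forall x, 0 <= h x <= 1.
Hypothesis h_left : forall x, x <= a -> h x = 1.
Hypothesis h_right : forall x, b <= x -> h x = 0.
Hypothesis h_lip : forall x y, `|h x - h y| <= K * `|x - y|.

Let H x := Rintegral mu [set` `]-oo, x]] (fun t => h t * phi t).

Let K0 : 0 <= K.
Proof.
by have := h_lip 1 0; rewrite subr0 normr1 mulr1; apply: le_trans.
Qed.

Lemma h_cont : continuous h.
Proof.
move=> x; apply/cvgrPdist_le => e e0.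
have K1 : 0 < K + 1 by rewrite ltr_wpDl.
apply/nbhs_ballP; exists (e / (K + 1)); first exact: divr_gt0.
move=> y; rewrite /ball/= => xy.
apply: le_trans (h_lip _ _) _.
apply: (@le_trans _ _ ((K + 1) * `|x - y|)).
  by rewrite ler_wpM2r// lerDl.
by rewrite -ler_pdivlMl// mulrC ltW.
Qed.

Let hphi_cont : continuous (fun t => h t * phi t).
Proof.
move=> x; apply: cvgM; first exact: h_cont.
by apply: is_derive_cts; exact: is_derive_gauss_pdf.
Qed.

Let hphi_int : mu.-integrable setT (EFin \o (fun t => h t * phi t)).
Proof.
apply: (@le_integrable _ _ R mu setT measurableT _ (EFin \o phi)).
- apply/measurable_realfun.measurable_EFinP; exact: measurable_realfun.continuous_measurable_fun.
- move=> x _ /=; rewrite lee_fin normrM.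
  have /andP[h0 h1] := h01 x; rewrite (ger0_norm h0) ler_piMl//.
- exact: integrable_normal_pdf.
Qed.

Let dH x : is_derive x 1 H (h x * phi x).
Proof.
have [] := @continuous_FTC1 R (fun t => h t * phi t) -oo%O x (x + 1).
- by rewrite ltrDl.
- by apply: (integrableS _ _ (subsetT _)) => //; exact: hphi_int.
- by rewrite ltNyr.
- exact: hphi_cont.
- by move=> h1 h2; apply: is_derive_congr (@derivableP _ _ _ _ _ _ h1) _; rewrite -derive1E h2.
Qed.

Let c := H b.

Let Hleft x : x <= a -> H x = Phi x.
Proof.
move=> xa; rewrite /H /gauss_cdf /Rintegral /normal_prob set_itvNyc.
congr fine; apply: eq_integral => t /[!inE]/= tx.
by rewrite h_left ?mul1r// (le_trans tx).
Qed.

Let Hright x : b <= x -> H x = c.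
Proof.
move=> bx; have [t] := MVT_derivable dH bx; rewrite in_itv/= => /andP[bt _].
by rewrite h_right// !mul0r => /eqP; rewrite subr_eq0 => /eqP.
Qed.

Lemma gauss_cdf01 x : 0 <= Phi x <= 1.
Proof.
rewrite /gauss_cdf; set A := [set _ | _].
have mA : measurable A by rewrite /A -set_itvNyc; exact: measurable_itv.
rewrite fine_ge0//= -lee_fin fineK ?fin_num_measure//.
exact: probability_le1.
Qed.

Let c_bounds : Phi a <= c <= Phi b.
Proof.
apply/andP; split.
  rewrite -(Hleft (lexx a)) -subr_ge0.
  have [t _ ->] := MVT_derivable dH ab; rewrite mulr_ge0 ?subr_ge0//.
  by have /andP[h0 _] := h01 t; rewrite mulr_ge0// ltW// gauss_pdf_gt0.
have [t _] := MVT_derivable (fun x => is_derive_subf (is_derive_gauss_cdf x) (dH x)) ab.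
rewrite (Hleft (lexx a)) subrr subr0 => E; rewrite -subr_ge0 E.
rewrite mulr_ge0 ?subr_ge0//; have /andP[_ h1] := h01 t.
by rewrite ler_piMl// ltW// gauss_pdf_gt0.
Qed.

Let c01 : 0 <= c <= 1.
Proof.
have /andP[h1 h2] := c_bounds; have /andP[h3 _] := gauss_cdf01 a.
have /andP[_ h4] := gauss_cdf01 b.
by rewrite (le_trans h3 h1) (le_trans h2 h4).
Qed.

Let f x := (H x - c * Phi x) * (phi x)^-1.
Let f' x := x * f x + (h x - c).
Let g x := f x + x * f' x.

Let df x : is_derive x 1 f (f' x).
Proof.
have p0 : phi x != 0 by rewrite gt_eqF// gauss_pdf_gt0.
apply: is_derive_congr (is_derive_mulf (is_derive_subf (dH x) (is_derive_mulf (is_derive_constf c x) (is_derive_gauss_cdf x))) (is_derive_invf p0 (is_derive_gauss_pdf x))) _.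
by rewrite /f' /f; field.
Qed.

Let f'_cont : continuous f'.
Proof.
move=> x; apply: cvgD; first by apply: cvgM; [exact: cvg_id|exact: is_derive_cts (df x)].
by apply: cvgB; [exact: h_cont|exact: cvg_cst].
Qed.

Let g_cont : continuous g.
Proof.
move=> x; apply: cvgD; first exact: is_derive_cts (df x).
by apply: cvgM; [exact: cvg_id|exact: f'_cont].
Qed.

(** Beyond the support of the slope of [h] the solution of the Stein equation is
    a multiple [k] of the Mills ratio [r]; both [f'] and the derivative of
    [x * f x] are then bounded by the two Mills inequalities. *)
Let tail_bound (k r x : R) : 0 <= k <= 1 -> 1 <= x ->
  x * r <= 1 -> x <= (1 + x * x) * r ->
  `|k * (x * r - 1)| <= 1 /\ `|k * (r - x + x * x * r)| <= 1.
Proof.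
move=> /andP[k0 k1] x1 xr1 xr2.
have r0 : 0 <= r by have : 0 <= (1 + x * x) * r by [lra|nra]; nra.
have xr0 : 0 <= x * r by nra.
have xxr : x * (x * r) <= x by nra.
split; rewrite normrM (ger0_norm k0).
  have -> : `|x * r - 1| = 1 - x * r by rewrite ler0_norm; lra.
  by nra.
have -> : `|r - x + x * x * r| = r - x + x * x * r by rewrite ger0_norm; nra.
have : r - x + x * x * r <= 1 by nra.
have : 0 <= r - x + x * x * r by nra.
by nra.
Qed.

Let tail_right x : b <= x -> 1 <= x -> `|f' x| <= 1 /\ `|g x| <= 1.
Proof.
move=> bx x1; have x0 : 0 < x by lra.
have p0 : 0 < phi x by exact: gauss_pdf_gt0.
pose Psi x := 1 - Phi x.
have dPsi (y : R) : is_derive y 1 Psi (- phi y).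
  by apply: is_derive_congr (is_derive_subf (is_derive_constf 1 y) (is_derive_gauss_cdf y)) _; rewrite sub0r.
have Psi0 : Psi y @[y --> +oo] --> (0 : R).
  by rewrite -(subrr (1 : R)); apply: cvgB; [exact: cvg_cst|exact: cvg_gauss_cdf_pinfty].
pose r := Psi x / phi x.
have fE : f x = c * r.
  by rewrite /f /r /Psi Hright// mulrA mulrBr mulr1.
have r1 : x * r <= 1 by rewrite mulrA ler_pdivrMr// mul1r (mills_upper dPsi).
have r2 : x <= (1 + x * x) * r.
  by rewrite mulrA ler_pdivlMr// (mills_lower dPsi).
have [H1 H2] := tail_bound c01 x1 r1 r2.
have E1 : f' x = c * (x * r - 1) by rewrite /f' fE h_right//; ring.
split; first by rewrite E1.
by rewrite /g E1 fE (_ : c * r + _ = c * (r - x + x * x * r))//; ring.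
Qed.

Let tail_left x : x <= a -> x <= -1 -> `|f' x| <= 1 /\ `|g x| <= 1.
Proof.
move=> xa x1; pose y := - x; have y1 : 1 <= y by rewrite /y; lra.
have y0 : 0 < y by lra.
have p0 : 0 < phi y by exact: gauss_pdf_gt0.
pose Psi x := Phi (- x).
have dPsi (z : R) : is_derive z 1 Psi (- phi z).
  have hN : is_derive z 1 (fun y : R => - y) (-1).
    exact: is_deriveNid.
  have := @is_derive1_comp R Phi (fun y : R => - y) z _ _ (is_derive_gauss_cdf _) hN.
  by rewrite gauss_pdfN mulrN1.
have Psi0 : Psi y @[y --> +oo] --> (0 : R) by exact: cvg_gauss_cdf_ninfty.
pose r := Psi y / phi y.
have fE : f x = (1 - c) * r.
  rewrite /f /r /Psi Hleft// /y opprK gauss_pdfN; ring.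
have r1 : y * r <= 1 by rewrite mulrA ler_pdivrMr// mul1r (mills_upper dPsi).
have r2 : y <= (1 + y * y) * r.
  by rewrite mulrA ler_pdivlMr// (mills_lower dPsi).
have c01' : 0 <= 1 - c <= 1 by have /andP[h1 h2] := c01; lra.
have [H1 H2] := tail_bound c01' y1 r1 r2.
have E1 : f' x = - ((1 - c) * (y * r - 1)) by rewrite /f' fE h_left// /y; ring.
split; first by rewrite E1 normrN.
have -> : g x = (1 - c) * (r - y + y * y * r).
  have xy : x = - y by rewrite opprK.
  by rewrite /g E1 fE xy; move: (r) (y) (c) => r' y' c'; ring.
by [].
Qed.

Let bounded_of_tails (u : R -> R) : continuous u ->
  (forall x, b <= x -> 1 <= x -> `|u x| <= 1) ->
  (forall x, x <= a -> x <= -1 -> `|u x| <= 1) ->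
  exists B : R, forall x, `|u x| <= B.
Proof.
move=> cu ur ul; pose M := 1 + `|a| + `|b|.
have [Ma Mb] : `|a| <= M /\ `|b| <= M by rewrite /M; have := normr_ge0 a; have := normr_ge0 b; split; lra.
have M1 : 1 <= M by rewrite /M; have := normr_ge0 a; have := normr_ge0 b; lra.
have [||z _ zP] := @EVT_max R (fun x => `|u x|) (- M) M; first by lra.
  by apply: continuous_subspaceT => x; apply: cvg_norm; exact: cu.
exists (Num.max 1 `|u z|) => x.
have [xM|Mx] := leP x (- M).
  rewrite le_max ul//; last by lra.
  by have := ler_norm (- a); rewrite normrN; lra.
have [xM'|Mx'] := leP M x.
  by rewrite le_max ur//; [have := ler_norm b; lra|lra].
by rewrite le_max zP ?orbT// in_itv/= !ltW.
Qed.

(** With [H] the primitive of [h * phi] and [k] the Gaussian mean of [h], the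
    function [(H - k * Phi) / phi] solves the equation.  Its
    derivative and that of [x * F x] are bounded on the two tails by Mills ratio
    and on the remaining compact interval by continuity; since
    [F' x = x * F x + h x - k], the second bound makes [F'] Lipschitz. *)
Lemma stein_solution : exists (k : R) (F F' : R -> R) (B : R),
  [/\ forall x : R, is_derive x 1 F (F' x),
      forall x, F' x - x * F x = h x - k,
      forall x, `|F' x| <= B,
      forall x y, `|F' x - F' y| <= B * `|x - y| &
      Phi a <= k <= Phi b].
Proof.
have [B1 HB1] : exists B : R, forall x, `|f' x| <= B.
  apply: bounded_of_tails => // x h1 h2.
    by have [] := tail_right h1 h2.
  by have [] := tail_left h1 h2.
have [B2 HB2] : exists B : R, forall x, `|g x| <= B.
  apply: bounded_of_tails => // x h1 h2.
    by have [] := tail_right h1 h2.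
  by have [] := tail_left h1 h2.
have dk x : is_derive x 1 (fun y => y * f y) (g x).
  by apply: is_derive_congr (is_derive_mulf (is_derive_idf x) (df x)) _; rewrite mul1r addrC.
have lipk x y : `|x * f x - y * f y| <= B2 * `|x - y|.
  wlog xy : x y / y <= x.
    move=> W; have [yx|xy] := leP y x; first exact: W.
    by rewrite distrC (distrC x) W// ltW.
  have [z _ ->] := MVT_derivable dk xy.
  by rewrite normrM ler_wpM2r.
have B20 : 0 <= B2 by apply: le_trans (HB2 0).
exists c, f, f', (`|B1| + (B2 + K)); split => //.
- by move=> x; rewrite /f'; ring.
- by move=> x; apply: le_trans (HB1 x) (le_trans (ler_norm _) _); rewrite lerDl addr_ge0.
- move=> x y; rewrite /f'.
  rewrite (_ : _ - _ = (x * f x - y * f y) + (h x - h y)); last by ring.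
  apply: le_trans (ler_normD _ _) _.
  rewrite mulrDl; apply: ler_wpDl; first by rewrite mulr_ge0.
  by rewrite mulrDl; apply: lerD.
Qed.
End SteinEquation.

(** * The Poincare inequality for label swaps *)

Section Swap.
Variable T : finType.
Implicit Types (i j k t : T) (A U : {set T}).

Definition swap i j A : {set T} := [set tperm i j k | k in A]%SET.

Lemma mem_swap i j A k : (k \in swap i j A) = (tperm i j k \in A).
Proof. by rewrite -{1}[k](tpermK i j) mem_imset//; exact: perm_inj. Qed.

Lemma swapK i j : involutive (swap i j).
Proof. by move=> A; apply/setP => k; rewrite !mem_swap tpermK. Qed.

Lemma swap_id i A : swap i i A = A.
Proof. by apply/setP => k; rewrite mem_swap tperm1 perm1. Qed.

Lemma card_swap i j A : #|swap i j A| = #|A|.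
Proof. by rewrite card_imset//; exact: perm_inj. Qed.

(** The sets obtained from [A0] by permuting the elements of [U].  Describing
    the class by a representative keeps it nonempty and makes its fibres over a
    coordinate classes of the same kind. *)
Definition orbit_class U A0 A :=
  [forall k, (k \in U) || ((k \in A) == (k \in A0))] && (#|A| == #|A0|).

Lemma orbit_classP U A0 A :
  reflect ((forall k, k \notin U -> (k \in A) = (k \in A0)) /\ #|A| = #|A0|)
          (orbit_class U A0 A).
Proof.
apply: (iffP andP) => [[/forallP h /eqP c]|[h c]]; split => //.
- by move=> k kU; move: (h k); rewrite (negbTE kU) => /eqP.
- by apply/forallP => k; case: (boolP (k \in U)) => //= /h ->.
- exact/eqP.
Qed.

Lemma orbit_class_swap U A0 i j A : i \in U -> j \in U ->
  orbit_class U A0 (swap i j A) = orbit_class U A0 A.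
Proof.
move=> iU jU; rewrite /orbit_class card_swap; congr andb.
apply: eq_forallb => k; case: (boolP (k \in U)) => //= kU.
by rewrite mem_swap tpermD//; apply: contraNneq kU => <-.
Qed.

Lemma orbit_class_setD1 U A0 A1 t : t \in U -> orbit_class U A0 A1 ->
  orbit_class (U :\ t) A1 =1
  (fun A => orbit_class U A0 A && ((t \in A) == (t \in A1))).
Proof.
move=> tU /orbit_classP[h1 c1] A; apply/orbit_classP/andP.
  move=> [h c]; split.
    apply/orbit_classP; split; last by rewrite c.
    by move=> k kU; rewrite -h1// h// !inE negb_and (negbTE kU) orbT.
  by apply/eqP; rewrite h// !inE eqxx.
move=> [/orbit_classP[h c]] /eqP ht; split; last by rewrite c.
move=> k; rewrite !inE negb_and negbK => /orP[/eqP ->//|kU].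
by rewrite h// h1.
Qed.

Lemma orbit_class_cardI U A0 A : orbit_class U A0 A ->
  #|A :&: U| = #|A0 :&: U|.
Proof.
move=> /orbit_classP[h c].
have : (#|A :&: U| + #|A :\: U| = #|A0 :&: U| + #|A0 :\: U|)%N.
  by rewrite !cardsID.
rewrite (_ : A :\: U = A0 :\: U); first by move/addIn.
by apply/setP => k; rewrite !inE; case: (boolP (k \in U)) => //= /h.
Qed.

Section Poincare.
Variable R : realFieldType.
Implicit Types f g : {set T} -> R.

Lemma sum_orbit_class_swap U A0 i j f : i \in U -> j \in U ->
  \sum_(A | orbit_class U A0 A) f (swap i j A) = \sum_(A | orbit_class U A0 A) f A.
Proof.
move=> iU jU; rewrite [RHS](reindex_inj (inv_inj (swapK i j))).
by apply: eq_bigl => A; rewrite orbit_class_swap.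
Qed.

Definition swap_energy U A0 f : R :=
  \sum_(A | orbit_class U A0 A) \sum_(i in U) \sum_(j in U) (f (swap i j A) - f A) ^+ 2.

(** Fixing whether [t] belongs to the set leaves a class for [U :\ t], or
    nothing at all, so a bound for classes is also a bound for fibres. *)
Lemma poincare_fibre U A0 t (b : bool) f : t \in U ->
  let P A := orbit_class U A0 A && ((t \in A) == b) in
  (forall A1, orbit_class (U :\ t) A1 =1 P ->
    \sum_(A | P A) f A = 0 ->
    \sum_(A | P A) f A ^+ 2 <= (4 * #|U :\ t|%:R)^-1 * swap_energy (U :\ t) A1 f) ->
  \sum_(A | P A) f A = 0 ->
  \sum_(A | P A) f A ^+ 2 <= (4 * #|U :\ t|%:R)^-1 *
    \sum_(A | P A) \sum_(i in U :\ t) \sum_(j in U :\ t) (f (swap i j A) - f A) ^+ 2.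
Proof.
move=> tU P IH s0; case: (pickP P) => [A1 PA1|P0]; last first.
  by rewrite !big_pred0 // mulr0.
have E : orbit_class (U :\ t) A1 =1 P.
  move: PA1 => /andP[h1 /eqP h2] A.
  by rewrite (orbit_class_setD1 tU h1) h2.
have := IH A1 E s0; rewrite /swap_energy.
by rewrite (eq_bigl _ _ E).
Qed.


Lemma orbit_class_degenerate U A0 A : orbit_class U A0 A ->
  (#|A0 :&: U| == 0)%N || (#|A0 :&: U| == #|U|)%N -> A = A0.
Proof.
move=> PA; have := orbit_class_cardI PA; move/orbit_classP: PA => [h c] e.
move=> /orP[] /eqP z.
- move: e; rewrite z => /eqP; rewrite cards_eq0 => /eqP e.
  move/eqP: z; rewrite cards_eq0 => /eqP z.
  apply/setP => k; case: (boolP (k \in U)) => [kU|/h//].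
  by move/setP: e => /(_ k); move/setP: z => /(_ k); rewrite !inE kU !andbT => -> ->.
- move: e; rewrite z => e.
  have sub B : #|B :&: U| = #|U| -> U \subset B.
    by move=> E; apply/finset.setIidPr/eqP; rewrite eqEcard finset.subsetIr E leqnn.
  apply/setP => k; case: (boolP (k \in U)) => [kU|/h//].
  by rewrite (fintype.subsetP (sub _ e))// (fintype.subsetP (sub _ z)).
Qed.

Lemma sum_drop_swap U A0 f A :
  \sum_(t in U) \sum_(i in U :\ t) \sum_(j in U :\ t) (f (swap i j A) - f A) ^+ 2
  = (#|U|%:R - 2) * \sum_(i in U) \sum_(j in U) (f (swap i j A) - f A) ^+ 2.
Proof.
pose F i j := (f (swap i j A) - f A) ^+ 2.
have F0 i : F i i = 0 by rewrite /F swap_id subrr expr0n.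
have E1 t : t \in U -> \sum_(i in U :\ t) \sum_(j in U :\ t) F i j =
   \sum_(i in U) \sum_(j in U) F i j - \sum_(j in U) F t j - \sum_(i in U) F i t.
  move=> tU.
  have D1 (G : T -> R) : \sum_(i in U :\ t) G i = \sum_(i in U) G i - G t.
    rewrite (big_setD1 t tU) /= addrAC subrr add0r//.
  rewrite D1 (eq_bigr (fun i => \sum_(j in U) F i j - F i t)) => [|i _]; last by rewrite D1.
  by rewrite sumrB D1 F0 subr0; ring.
rewrite (eq_bigr _ E1) !sumrB sumr_const.
rewrite [X in _ - _ - X]exchange_big /= -mulr_natl; ring.
Qed.

(** The spectral gap of the swap chain, by induction on the number [n] of free
    elements.  For each free [t], the variance of [f] splits into a part
    conditional on the coordinate [x_t], to which the induction hypothesis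
    applies, and the variance of the conditional mean, which is [m t ^ 2 / v]
    with [m t] the covariance of [f] and [x_t] because [x_t] takes two values.
    Averaging over [t], the first parts involve each pair of elements [n - 2]
    times, and the second ones add up to at most [n / (n - 1)] times the
    variance, by Cauchy-Schwarz against [sum_t m t * x_t].  The resulting
    recursion for the constant is solved by [1 / (4 n)].  At [n = 2] the
    recursion is void and the class has only two elements. *)
Lemma poincare_orbit_class U A0 f :
  \sum_(A | orbit_class U A0 A) f A = 0 ->
  \sum_(A | orbit_class U A0 A) f A ^+ 2 <= (4 * #|U|%:R)^-1 * swap_energy U A0 f.
Proof.
have [u Uu] := ubnP #|U|; elim: u U A0 f Uu => // u IHu U A0 f Uu s0.
have en0 g : 0 <= swap_energy U A0 g.
  by rewrite /swap_energy; do 3!(apply: sumr_ge0 => ? _); exact: sqr_ge0.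
case: (boolP ((#|A0 :&: U| == 0)%N || (#|A0 :&: U| == #|U|)%N)) => [deg|].
  have E : orbit_class U A0 =1 pred1 A0.
    move=> A; apply/idP/eqP => [PA|->]; first exact: orbit_class_degenerate PA deg.
    by apply/orbit_classP.
  move: s0; rewrite !(eq_bigl _ _ E) !big_pred1_eq => ->.
  by rewrite expr0n mulr_ge0// invr_ge0 mulr_ge0.
rewrite negb_or => /andP[k0 ku].
set k := #|A0 :&: U| in k0 ku.
have kltu : (k < #|U|)%N by rewrite ltn_neqAle ku subset_leq_card// finset.subsetIr.
have u2 : (1 < #|U|)%N by apply: leq_ltn_trans kltu; rewrite lt0n.
pose n : R := #|U|%:R.
have n2 : 2 <= n by rewrite ler_nat.
pose p : R := k%:R / n.
have n0 : n != 0 by rewrite gt_eqF//; apply: lt_le_trans n2.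
have n00 : 0 < n by apply: lt_le_trans n2.
have pn : p * n = k%:R by exact: (divfK n0).
have p01 : 0 < p < 1.
  apply/andP; split; first by rewrite -(pmulr_lgt0 _ n00) pn ltr0n lt0n.
  by rewrite -(ltr_pM2r n00) pn mul1r ltr_nat.
pose x t A : R := (t \in A)%:R - p.
pose S g := \sum_(A | orbit_class U A0 A) g A.
have SE g : S g = \sum_(A | orbit_class U A0 A) g A by [].
have Sf0 : S f = 0 by [].
have x_swap i j t A : x t (swap i j A) = x (tperm i j t) A by rewrite /x mem_swap.
have sumx A : orbit_class U A0 A -> \sum_(t in U) x t A = 0.
  move=> PA; rewrite /x sumrB sumr_const -/n.
  have -> : \sum_(t in U) (t \in A)%:R = k%:R :> R.
    rewrite -natr_sum; congr (_%:R); rewrite /k -(orbit_class_cardI PA) -sum1_card.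
    rewrite [RHS](eq_bigl (fun t => (t \in U) && (t \in A))).
      by rewrite -big_mkcondr.
    by move=> t; rewrite inE andbC.
  by rewrite -[p *+ _]mulr_natr -/n pn subrr.
have x2 t A : x t A ^+ 2 = p * (1 - p) + (1 - 2 * p) * x t A.
  by rewrite /x; case: (t \in A) => /=; ring.
have Sx t : t \in U -> S (x t) = 0.
  move=> tU.
  have e s : s \in U -> S (x s) = S (x t).
    move=> sU; rewrite /S -(sum_orbit_class_swap A0 (x s) sU tU).
    by apply: eq_bigr => A _; rewrite x_swap tpermL.
  have : \sum_(s in U) S (x s) = 0.
    by rewrite exchange_big /= big1// => A /sumx.
  rewrite (eq_bigr _ e) sumr_const -mulr_natr -/n => /eqP.
  by rewrite mulf_eq0 (negbTE n0) orbF => /eqP.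
pose v := S (fun=> p * (1 - p)).
have v0 : 0 < v.
  rewrite /v /S sumr_const -mulr_natr mulr_gt0//.
    by case/andP: p01 => *; rewrite mulr_gt0// subr_gt0.
  rewrite ltr0n; apply/card_gt0P; exists A0; by apply/orbit_classP.
have SZ c g : S (fun A => c * g A) = c * S g by rewrite /S mulr_sumr.
have SD g h : S (fun A => g A + h A) = S g + S h by rewrite /S big_split.
have Sx2 t : t \in U -> S (fun A => x t A ^+ 2) = v.
  move=> tU; rewrite (_ : (fun A => _) = (fun A => p * (1 - p) + (1 - 2 * p) * x t A)).
    by rewrite SD (SZ _ (x t)) Sx// mulr0 addr0.
  by apply/funext => A; rewrite x2.
pose m t := S (fun A => f A * x t A).
have sumT (F : T -> {set T} -> R) :
  \sum_(t in U) S (F t) = S (fun A => \sum_(t in U) F t A).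
  by rewrite exchange_big.
have summ : \sum_(t in U) m t = 0.
  rewrite /m sumT /S big1// => A PA.
  by rewrite -mulr_sumr sumx// mulr0.
(* removing the multiple la * x_t of the coordinate centres f on both fibres
   without changing its increments along swaps that avoid t *)
have cond t : t \in U -> S (fun A => f A ^+ 2) - m t ^+ 2 / v <=
   (4 * (n - 1))^-1 * S (fun A => \sum_(i in U :\ t) \sum_(j in U :\ t)
        (f (swap i j A) - f A) ^+ 2).
  move=> tU; pose la := m t / v.
  pose g A := f A - la * x t A.
  have Sg2 : S (fun A => g A ^+ 2) = S (fun A => f A ^+ 2) - m t ^+ 2 / v.
    rewrite (_ : (fun A => g A ^+ 2) = (fun A => f A ^+ 2 + ((- 2 * la) * (f A * x t A)
       + la ^+ 2 * x t A ^+ 2))).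
      rewrite !SD !SZ Sx2// -/(m t) /la; field; exact: lt0r_neq0.
    by apply/funext => A; rewrite /g; ring.
  rewrite -Sg2 /S.
  have split_t (F : {set T} -> R) : \sum_(A | orbit_class U A0 A) F A =
    \sum_(A | orbit_class U A0 A && ((t \in A) == true)) F A +
    \sum_(A | orbit_class U A0 A && ((t \in A) == false)) F A.
    rewrite (bigID (fun A => t \in A)) /=; congr (_ + _); apply: eq_bigl => A;
    by case: (t \in A).
  have half (b : bool) : \sum_(A | orbit_class U A0 A && ((t \in A) == b)) g A = 0.
    have e1 : \sum_(A | orbit_class U A0 A && ((t \in A) == true)) g A = 0.
      have -> : \sum_(A | orbit_class U A0 A && ((t \in A) == true)) g A =
           S (fun A => (f A - la * x t A) * (x t A + p)).
        rewrite /S split_t [X in _ = _ + X]big1 ?addr0 => [|A /andP[_ /eqP tA]].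
          by apply: eq_bigr => A /andP[_ /eqP tA]; rewrite /g /x tA/=; ring.
        by rewrite /x tA/=; ring.
      rewrite (_ : (fun A => _) = (fun A => f A * x t A + (p * f A +
         ((- la) * x t A ^+ 2 + (- la * p) * x t A)))).
        rewrite !SD !SZ Sx2// Sx// Sf0 -/(m t) /la.
        by field; exact: lt0r_neq0.
      by apply/funext => A; ring.
    case: b => //.
    have : S g = 0.
      rewrite (_ : g = (fun A => f A + (- la) * x t A)).
        by rewrite SD SZ Sx// Sf0 mulr0 addr0.
      by apply/funext => A; rewrite /g mulNr.
    by rewrite /S split_t e1 add0r.
  have card1 : n - 1 = #|U :\ t|%:R.
    by rewrite /n (cardsD1 t U) tU natrD /=; ring.
  have ener A : \sum_(i in U :\ t) \sum_(j in U :\ t) (f (swap i j A) - f A) ^+ 2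
     = \sum_(i in U :\ t) \sum_(j in U :\ t) (g (swap i j A) - g A) ^+ 2.
    apply: eq_bigr => i; rewrite !inE => /andP[it _].
    apply: eq_bigr => j; rewrite !inE => /andP[jt _].
    by rewrite /g x_swap tpermD//; congr (_ ^+ 2); ring.
  under [X in _ <= _ * X]eq_bigr do rewrite ener.
  rewrite !split_t mulrDr card1; apply: lerD; apply: poincare_fibre => //.
    by move=> A1 E s1; rewrite -!(eq_bigl _ _ E) IHu// ?(eq_bigl _ _ E)//; move: Uu; rewrite (cardsD1 t U) tU.
  by move=> A1 E s1; rewrite -!(eq_bigl _ _ E) IHu// ?(eq_bigl _ _ E)//; move: Uu; rewrite (cardsD1 t U) tU.
set D := swap_energy U A0 f.
set Q := S (fun A => f A ^+ 2) in cond *.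
pose M2 := \sum_(t in U) m t ^+ 2.
have sumD : \sum_(t in U) S (fun A => \sum_(i in U :\ t) \sum_(j in U :\ t)
        (f (swap i j A) - f A) ^+ 2) = (n - 2) * D.
  rewrite sumT SE /D /swap_energy mulr_sumr.
  by apply: eq_bigr => A _; rewrite sum_drop_swap.
have cond_sum : n * Q - M2 / v <= (4 * (n - 1))^-1 * ((n - 2) * D).
  have -> : n * Q - M2 / v = \sum_(t in U) (Q - m t ^+ 2 / v).
    by rewrite sumrB sumr_const -mulr_suml -[Q *+ _]mulr_natl.
  by rewrite -sumD [leRHS]mulr_sumr; exact: ler_sum.
have v00 : v != 0 by rewrite gt_eqF.
have n10 : n - 1 != 0 by rewrite gt_eqF//; lra.
have D0 : 0 <= D by exact: en0.
have [E2|u3] := eqVneq #|U| 2%N.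
  (* the fibres are singletons, and the swap of a and b exchanges them *)
  have nE : n = 2 by rewrite /n E2.
  have [a [b [aU bU ab]]] : exists a b, [/\ a \in U, b \in U & b \in U :\ a].
    have /card_gt0P[a aU] : (0 < #|U|)%N by rewrite E2.
    have /card_gt0P[b bU] : (0 < #|U :\ a|)%N.
      by move: E2; rewrite (cardsD1 a) aU add1n => -[->].
    by exists a, b; split => //; move: bU; rewrite inE => /andP[].
  have U1 : #|U :\ a| = 1%N by move: E2; rewrite (cardsD1 a) aU add1n => -[].
  have Ub : U :\ a = [set b]%SET by apply/eqP; rewrite eq_sym eqEcard finset.sub1set ab cards1 U1.
  have := cond a aU.
  have -> : S (fun A => \sum_(i in U :\ a) \sum_(j in U :\ a) (f (swap i j A) - f A) ^+ 2) = 0.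
    by rewrite SE big1// => A _; rewrite Ub !big_set1 swap_id subrr expr0n.
  rewrite mulr0 subr_le0 => H1; apply: le_trans H1 _.
  have xb A : orbit_class U A0 A -> x b A = - x a A.
    move=> /sumx; rewrite (big_setD1 a)//= Ub big_set1 addrC => /eqP.
    by rewrite addr_eq0 => /eqP.
  have mE : S (fun A => (f (swap a b A) - f A) * x a A) = - 2 * m a.
    have e1 : S (fun A => f (swap a b A) * x a A) = - m a.
      rewrite /m /S -(sum_orbit_class_swap A0 (fun A => f (swap a b A) * x a A) aU bU).
      rewrite -sumrN; apply: eq_bigr => A PA.
      by rewrite swapK x_swap tpermL xb// mulrN.
    rewrite (_ : (fun A => _) = (fun A => f (swap a b A) * x a A + (-1) * (f A * x a A))).
      by rewrite SD SZ e1 -/(m a); ring.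
    by apply/funext => A; ring.
  pose W := S (fun A => (f (swap a b A) - f A) ^+ 2).
  have DW : D = 2 * W.
    rewrite /D /swap_energy /W /S mulr_sumr; apply: eq_bigr => A _.
    rewrite (big_setD1 a)//= Ub big_set1 !(big_setD1 a aU) /= Ub !big_set1 !swap_id.
    rewrite (_ : swap b a A = swap a b A); first by rewrite !subrr; ring.
    by rewrite /swap tpermC.
  have CS c : 0 <= W - 2 * c * (- 2 * m a) + c ^+ 2 * v.
    have -> : W - 2 * c * (- 2 * m a) + c ^+ 2 * v =
        S (fun A => (f (swap a b A) - f A - c * x a A) ^+ 2).
      rewrite (_ : (fun A => (_ - c * _) ^+ 2) = (fun A => (f (swap a b A) - f A) ^+ 2 +
        ((- 2 * c) * ((f (swap a b A) - f A) * x a A) + c ^+ 2 * x a A ^+ 2))).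
        by rewrite !SD !SZ Sx2// mE -/W; ring.
      by apply/funext => A; ring.
    by apply: sumr_ge0 => A _; exact: sqr_ge0.
  have := CS (- 2 * m a / v).
  rewrite (_ : W - _ + _ = W - 4 * (m a ^+ 2 / v)); last by field.
  rewrite -/D DW E2; lra.
have n3 : 3 <= n by rewrite ler_nat ltn_neqAle eq_sym u3.
pose w := - v / (n - 1).
have Sxx s t : s \in U -> t \in U -> s != t -> S (fun A => x s A * x t A) = w.
  move=> sU tU st.
  have e t' : t' \in U :\ s -> S (fun A => x s A * x t' A) = S (fun A => x s A * x t A).
    rewrite !inE => /andP[t's t'U].
    rewrite /S -(sum_orbit_class_swap A0 (fun A => x s A * x t' A) t'U tU).
    by apply: eq_bigr => A _; rewrite !x_swap tpermL tpermD// eq_sym.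
  have : \sum_(t' in U) S (fun A => x s A * x t' A) = 0.
    rewrite sumT SE big1// => A PA; by rewrite -mulr_sumr sumx// mulr0.
  rewrite (big_setD1 s)//= (eq_bigr _ e) sumr_const.
  have -> : S (fun A => x s A * x s A) = v by rewrite -(Sx2 s sU).
  rewrite -[S _ *+ _]mulr_natl.
  have -> : #|U :\ s|%:R = n - 1 :> R by rewrite /n (cardsD1 s U) sU natrD /=; ring.
  move=> H; apply: (mulfI n10); rewrite /w [RHS]mulrC divfK//; lra.
pose l A := \sum_(t in U) m t * x t A.
have Sfl : S (fun A => f A * l A) = M2.
  rewrite -[LHS]/(S (fun A => f A * \sum_(t in U) m t * x t A)).
  under [X in S X]eq_fun do rewrite mulr_sumr.
  rewrite -sumT /M2; apply: eq_bigr => t _.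
  rewrite expr2 -SZ; congr S; apply/funext => A; ring.
have Sll : S (fun A => l A ^+ 2) = (v - w) * M2.
  have -> : (fun A => l A ^+ 2) = (fun A => \sum_(s in U) \sum_(t in U) m s * m t * (x s A * x t A)).
    apply/funext => A; rewrite expr2 /l mulr_suml; apply: eq_bigr => s _.
    rewrite mulr_sumr; apply: eq_bigr => t _; ring.
  rewrite -sumT /M2 mulr_sumr; apply: eq_bigr => s sU.
  rewrite -sumT (big_setD1 s)//= SZ.
  rewrite (_ : S (fun A => x s A * x s A) = v); last by rewrite -(Sx2 s sU).
  rewrite (eq_bigr (fun t => m s * w * m t)) => [|t]; last first.
    rewrite !inE => /andP[ts tU]; rewrite SZ Sxx// 1?eq_sym//; ring.
  rewrite -mulr_sumr; have -> : \sum_(t in U :\ s) m t = - m s.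
    by move: summ; rewrite (big_setD1 s)//= addrC => /eqP; rewrite addr_eq0 => /eqP.
  by ring.
have CS c : 0 <= Q - 2 * c * M2 + c ^+ 2 * ((v - w) * M2).
  have -> : Q - 2 * c * M2 + c ^+ 2 * ((v - w) * M2) = S (fun A => (f A - c * l A) ^+ 2).
    rewrite (_ : (fun A => (_ - c * _) ^+ 2) = (fun A => f A ^+ 2 +
        ((- 2 * c) * (f A * l A) + c ^+ 2 * l A ^+ 2))).
      by rewrite !SD !SZ Sfl Sll -/Q; ring.
    by apply/funext => A; ring.
  by apply: sumr_ge0 => A _; exact: sqr_ge0.
have M2Q : M2 / v <= n / (n - 1) * Q.
  have := CS ((n - 1) / (n * v)).
  have -> : Q - 2 * ((n - 1) / (n * v)) * M2 + ((n - 1) / (n * v)) ^+ 2 * ((v - w) * M2) =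
    Q - (n - 1) / n * (M2 / v).
    by rewrite /w; field; rewrite n10 n0 v00.
  rewrite subr_ge0 => h.
  have -> : M2 / v = n / (n - 1) * ((n - 1) / n * (M2 / v)) by field; rewrite n10 n0 v00.
  rewrite ler_wpM2l// divr_ge0; lra.
change (Q <= (4 * n)^-1 * D).
have h1 : n * Q - n / (n - 1) * Q <= (4 * (n - 1))^-1 * ((n - 2) * D) by lra.
have n20 : n - 2 != 0 by rewrite gt_eqF//; lra.
have -> : Q = (n - 1) / (n * (n - 2)) * (n * Q - n / (n - 1) * Q).
  by field; rewrite n10 n0 n20.
have -> : (4 * n)^-1 * D = (n - 1) / (n * (n - 2)) * ((4 * (n - 1))^-1 * ((n - 2) * D)).
  by field; rewrite n10 n0 n20.
rewrite ler_wpM2l// divr_ge0//; first by lra.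
by rewrite mulr_ge0; lra.
Qed.
End Poincare.
End Swap.

(** * Expectation under the permutation law *)

Section PermutationLaw.
Variables (R : realType) (N m : nat).
Hypothesis mN : (m <= N)%N.
Implicit Types (f g : {set 'I_N} -> R) (A : {set 'I_N}) (i j k : 'I_N).
Local Notation E := (@perm_expectation R N m).

Let bin_gt : 0 < 'C(N, m)%:R :> R.
Proof. by rewrite ltr0n bin_gt0. Qed.

Lemma permE f : E f = 'C(N, m)%:R^-1 * \sum_(A : {set 'I_N} | #|A| == m) f A.
Proof. by rewrite /perm_expectation mulr_sumr. Qed.

Lemma perm_eq_expect f g : (forall A, #|A| = m -> f A = g A) -> E f = E g.
Proof. by move=> h; apply: eq_bigr => A /eqP/h ->. Qed.

Lemma perm_expectD f g : E (fun A => f A + g A) = E f + E g.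
Proof. by rewrite !permE big_split mulrDr. Qed.

Lemma perm_expectZ (c : R) f : E (fun A => c * f A) = c * E f.
Proof. by rewrite !permE -mulr_sumr mulrCA. Qed.

Lemma perm_expectN f : E (fun A => - f A) = - E f.
Proof. by rewrite !permE sumrN mulrN. Qed.

Lemma perm_expectB f g : E (fun A => f A - g A) = E f - E g.
Proof. by rewrite perm_expectD perm_expectN. Qed.

Lemma perm_expect_sum (I : finType) (P : pred I) (F : I -> {set 'I_N} -> R) :
  E (fun A => \sum_(i | P i) F i A) = \sum_(i | P i) E (F i).
Proof. by rewrite permE exchange_big /= mulr_sumr; apply: eq_bigr => i _; rewrite permE. Qed.

Lemma perm_expect_cst (c : R) : E (fun _ => c) = c.
Proof.
rewrite permE sumr_const (_ : #|_| = 'C(N, m)).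
  by rewrite -[c *+ _]mulr_natl mulKf// gt_eqF.
have := card_draws 'I_N m; rewrite card_ord => <-.
by rewrite cardsE.
Qed.

Lemma perm_expect_le f g : (forall A, #|A| = m -> f A <= g A) -> E f <= E g.
Proof.
move=> h; rewrite !permE ler_wpM2l// ?invr_ge0 ?(ltW bin_gt)//.
by apply: ler_sum => A /eqP; exact: h.
Qed.

Lemma perm_expect_ge0 f : (forall A, #|A| = m -> 0 <= f A) -> 0 <= E f.
Proof. by move=> h; rewrite -(perm_expect_cst 0); exact: perm_expect_le. Qed.

Lemma perm_expect_norm f : `|E f| <= E (fun A => `|f A|).
Proof.
rewrite ler_norml -perm_expectN; apply/andP.
by split; apply: perm_expect_le => A _; rewrite ?ler_norm// lerNl -normrN ler_norm.
Qed.

Lemma perm_expect_sq f : E (fun A => (f A - E f) ^+ 2) = E (fun A => f A ^+ 2) - E f ^+ 2.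
Proof.
rewrite (_ : (fun A => (_ - _) ^+ 2) =
    (fun A => f A ^+ 2 + ((- 2 * E f) * f A + E f ^+ 2))).
  by rewrite !perm_expectD perm_expectZ perm_expect_cst; ring.
by apply/funext => A; ring.
Qed.

Lemma perm_expect_abs_le f (v : R) : E (fun A => f A ^+ 2) <= v ->
  E (fun A => `|f A|) <= Num.sqrt v.
Proof.
move=> h; have h0 : 0 <= E (fun A => `|f A|) by apply: perm_expect_ge0.
rewrite -(ger0_norm h0) -sqrtr_sqr ler_wsqrtr//; apply: le_trans h.
have := perm_expect_ge0 (f := fun A => (`|f A| - E (fun A => `|f A|)) ^+ 2) (fun A _ => sqr_ge0 _).
rewrite (perm_expect_sq (fun A => `|f A|)) subr_ge0 => /le_trans; apply.
by apply: perm_expect_le => A _; rewrite real_normK// num_real.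
Qed.

Lemma perm_expect_swap i j f : E (fun A => f (swap i j A)) = E f.
Proof.
rewrite !permE [in RHS](reindex_inj (inv_inj (swapK i j))); congr (_ * _).
by apply: eq_bigl => A; rewrite card_swap.
Qed.

Definition swap_diff i j f A := f (swap i j A) - f A.

(** Reversibility: a swap is an involution preserving the law, so the roles of
    the two endpoints can be exchanged and averaged. *)
Lemma swap_ibp f g :
  E (fun A => g A * \sum_i \sum_j swap_diff i j f A) =
  - (2^-1 * E (fun A => \sum_i \sum_j swap_diff i j f A * swap_diff i j g A)).
Proof.
rewrite (_ : (fun A => g A * _) = (fun A => \sum_i \sum_j g A * swap_diff i j f A)); last first.
  by apply/funext => A; rewrite mulr_sumr; apply: eq_bigr => i _; rewrite mulr_sumr.
rewrite !perm_expect_sum mulr_sumr -sumrN; apply: eq_bigr => i _.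
rewrite !perm_expect_sum mulr_sumr -sumrN; apply: eq_bigr => j _.
have e1 : E (fun A => g A * swap_diff i j f A) = - E (fun A => g (swap i j A) * swap_diff i j f A).
  rewrite -(perm_expect_swap i j) -perm_expectN; apply: perm_eq_expect => A _.
  by rewrite /swap_diff swapK; ring.
rewrite (_ : (fun A => swap_diff i j f A * _) =
  (fun A => g (swap i j A) * swap_diff i j f A - g A * swap_diff i j f A)); last first.
  by apply/funext => A; rewrite {2}/swap_diff; ring.
by rewrite perm_expectB e1; field.
Qed.

Lemma perm_class A0 : #|A0| = m -> orbit_class [set: 'I_N]%SET A0 =1 (fun A => #|A| == m).
Proof.
move=> c A; apply/orbit_classP/eqP; first by rewrite c => -[].
by move=> ->; split => // k; rewrite !inE.
Qed.

Lemma poincare f : E (fun A => (f A - E f) ^+ 2) <=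
  (4 * N%:R)^-1 * E (fun A => \sum_i \sum_j swap_diff i j f A ^+ 2).
Proof.
have [A0 _ cA0] : exists2 A0 : {set 'I_N}, A0 \subset [set: 'I_N]%SET & #|A0| = m.
  have : (0 < #|[set A : {set 'I_N} | #|A| == m]%SET|)%N.
    by rewrite card_draws card_ord bin_gt0.
  by case/card_gt0P => A0; rewrite inE => /eqP; exists A0 => //; rewrite finset.subsetT.
pose g A := f A - E f.
have s0 : \sum_(A | orbit_class [set: 'I_N]%SET A0 A) g A = 0.
  rewrite (eq_bigl _ _ (perm_class cA0)).
  have : E g = 0 by rewrite /g perm_expectB perm_expect_cst subrr.
  by rewrite permE => /eqP; rewrite mulf_eq0 invr_eq0 gt_eqF// => /eqP.
have := poincare_orbit_class s0.
rewrite /swap_energy !(eq_bigl _ _ (perm_class cA0)) cardsT card_ord => h.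
rewrite (permE (fun A => (f A - _) ^+ 2)) (permE (fun A => \sum_i _)) mulrCA.
apply: ler_wpM2l; first by rewrite invr_ge0 ltW.
apply: le_trans h _; apply: ler_wpM2l; first by rewrite invr_ge0 mulr_ge0.
apply: ler_sum => A _.
rewrite (eq_bigl predT) => [|i]; last by rewrite inE.
apply: ler_sum => i _; rewrite (eq_bigl predT) => [|j]; last by rewrite inE.
by apply: ler_sum => j _; rewrite /g /swap_diff opprB addrA subrK.
Qed.

(** The form in which the Poincare inequality is used: when the squared
    increment along the swap of [i] and [j] is dominated by a sum of two
    one-node terms, the double sum collapses. *)
Lemma poincare_le f (u : 'I_N -> {set 'I_N} -> R) :
  (forall A i j, #|A| = m -> swap_diff i j f A ^+ 2 <= u i A + u j A) ->
  E (fun A => (f A - E f) ^+ 2) <= 2^-1 * \sum_i E (u i).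
Proof.
move=> h; apply: le_trans (poincare f) _.
case: (posnP N) => [N0|N0].
  have H : forall (F : 'I_N -> R), \sum_i F i = 0.
    by move=> F; rewrite big1// => i _; have := ltn_ord i; rewrite [X in (_ < X)%N]N0.
  rewrite H mulr0 (@perm_eq_expect _ (fun _ => 0)) ?perm_expect_cst ?mulr0//.
have N00 : 0 < N%:R :> R by rewrite ltr0n.
rewrite mulrC ler_pdivrMr ?mulr_gt0//.
apply: (@le_trans _ _ (E (fun A => \sum_i \sum_j (u i A + u j A)))).
  by apply: perm_expect_le => A cA; do 2!(apply: ler_sum => ? _); exact: h.
rewrite (@perm_eq_expect _ (fun A => (2 * N%:R) * \sum_i u i A)).
  rewrite perm_expectZ perm_expect_sum; rewrite le_eqVlt.
  by apply/orP; left; apply/eqP; field.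
move=> A _; under eq_bigr do rewrite big_split sumr_const card_ord /=.
by rewrite big_split sumr_const card_ord /= sumrMnl -mulrnDl -[_ *+ N]mulr_natl; ring.
Qed.

End PermutationLaw.

(** * Moments of the centred labels *)

Section Moments.
Variables (R : realType) (N m : nat).
Hypothesis mN : (m <= N)%N.
Implicit Types (f g : {set 'I_N} -> R) (A : {set 'I_N}) (i j k l : 'I_N).
Implicit Types (c : 'I_N -> R).
Local Notation E := (@perm_expectation R N m).

Definition mean_label : R := m%:R / N%:R.
Local Notation p := mean_label.
Definition centred_label i A : R := (i \in A)%:R - p.
Local Notation x := centred_label.

Lemma sqr2_le (u v : R) : (u - v) ^+ 2 <= 2 * u ^+ 2 + 2 * v ^+ 2.
Proof. by rewrite -subr_ge0 (_ : _ - _ = (u + v) ^+ 2) ?sqr_ge0//; ring. Qed.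

Lemma sqr2D_le (u v : R) : (u + v) ^+ 2 <= 2 * u ^+ 2 + 2 * v ^+ 2.
Proof. by rewrite -subr_ge0 (_ : _ - _ = (u - v) ^+ 2) ?sqr_ge0//; ring. Qed.

Lemma mean_label01 : 0 <= p <= 1.
Proof.
rewrite /p divr_ge0//=; case: (posnP N) => [->|N0].
  by rewrite invr0 mulr0.
by rewrite ler_pdivrMr ?ltr0n// mul1r ler_nat.
Qed.

Lemma pq01 : 0 <= p * (1 - p) <= 1.
Proof. by have /andP[h1 h2] := mean_label01; nra. Qed.

Lemma sqr_centred_label i A : x i A ^+ 2 = p * (1 - p) + (1 - 2 * p) * x i A.
Proof. by rewrite /x; case: (i \in A) => /=; ring. Qed.

Lemma centred_label_le1 i A : `|x i A| <= 1.
Proof.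
by have /andP[h1 h2] := mean_label01; rewrite /x ler_norml; case: (i \in A) => /=; lra.
Qed.

Lemma sum_centred_label A : #|A| = m -> \sum_i x i A = 0.
Proof.
move=> cA; rewrite sumrB sumr_const card_ord -natr_sum.
have -> : (\sum_(i < N) (i \in A) = m)%N by rewrite -cA -sum1_card -big_mkcond.
case: (posnP N) => [N0|N0].
  have -> : m = 0%N by apply/eqP; rewrite -leqn0 -N0.
  by rewrite N0 subrr.
by rewrite -[p *+ N]mulr_natr /p divfK ?subrr// gt_eqF// ltr0n.
Qed.

Definition label_gap i j A : R := x j A - x i A.
Local Notation e := label_gap.

Lemma gap3 i j A : e i j A ^+ 3 = e i j A.
Proof. by rewrite /e /x; do 2 case: (_ \in A) => /=; ring. Qed.

Lemma gap_sqr_le1 i j A : e i j A ^+ 2 <= 1.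
Proof. by rewrite /e /x; do 2 case: (_ \in A) => /=; rewrite ?subrr; lra. Qed.

Lemma gap_abs_le1 i j A : `|e i j A| <= 1.
Proof. by rewrite /e /x ler_norml; do 2 case: (_ \in A) => /=; lra. Qed.

Lemma gap_sqr i j A :
  e i j A ^+ 2 = 2 * (p * (1 - p)) + (1 - 2 * p) * (x i A + x j A) - 2 * x i A * x j A.
Proof. by rewrite /e /x; do 2 case: (_ \in A) => /=; ring. Qed.

Lemma centred_label_swap i j k A :
  x k (swap i j A) = x k A + e i j A * ((k == i)%:R - (k == j)%:R).
Proof.
rewrite /e /x mem_swap; case: tpermP => [->|->|/eqP/negbTE-> /eqP/negbTE->].
- rewrite eqxx; case: (eqVneq i j) => [->|_] /=; ring.
- rewrite eqxx; case: (eqVneq j i) => [->|_] /=; ring.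
- by rewrite /=; ring.
Qed.

Lemma sum_delta (F : 'I_N -> R) i : \sum_k F k * (k == i)%:R = F i.
Proof.
rewrite (bigD1 i)//= eqxx mulr1 big1 ?addr0// => k /negbTE ->.
by rewrite mulr0.
Qed.

Lemma sum_delta2 (F : 'I_N -> R) i j : \sum_k F k * ((k == i)%:R - (k == j)%:R) = F i - F j.
Proof. by rewrite -!(sum_delta F) -sumrB; apply: eq_bigr => k _; rewrite mulrBr. Qed.

Definition linear_form c A : R := \sum_k c k * x k A.

Lemma linear_form_swap c i j A : linear_form c (swap i j A) = linear_form c A + e i j A * (c i - c j).
Proof.
rewrite -sum_delta2 mulr_sumr /linear_form -big_split /=; apply: eq_bigr => k _.
by rewrite centred_label_swap; ring.
Qed.

Hypothesis N2 : (1 < N)%N.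

Let N0 : 0 < N%:R :> R. Proof. by rewrite ltr0n ltnW. Qed.
Let N1 : 0 < N%:R - 1 :> R. Proof. by rewrite subr_gt0 ltr1n. Qed.

Lemma expect_centred_label i : E (x i) = 0.
Proof.
have h j : E (x j) = E (x i).
  rewrite -(perm_expect_swap m i j (x j)); congr (perm_expectation m).
  by apply/funext => A; rewrite /x mem_swap tpermR.
have : \sum_j E (x j) = 0.
  rewrite -perm_expect_sum (@perm_eq_expect _ _ _ _ (fun _ => 0)) ?perm_expect_cst//.
  by move=> A /sum_centred_label.
rewrite (eq_bigr _ (fun j _ => h j)) sumr_const card_ord -[_ *+ N]mulr_natl => /eqP.
by rewrite mulf_eq0 gt_eqF//= => /eqP.
Qed.

Lemma expect_linear_form c : E (linear_form c) = 0.
Proof. by rewrite perm_expect_sum big1// => k _; rewrite perm_expectZ expect_centred_label mulr0. Qed.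

Lemma expect_centred_label_sqr i : E (fun A => x i A ^+ 2) = p * (1 - p).
Proof.
under [X in E X]eq_fun do rewrite sqr_centred_label.
by rewrite perm_expectD perm_expect_cst// perm_expectZ expect_centred_label mulr0 addr0.
Qed.

(** All pairs of distinct nodes have the same covariance, and the centred labels
    add up to zero. *)
Lemma expect_centred_label2 i j : i != j ->
  E (fun A => x i A * x j A) = - (p * (1 - p)) / (N%:R - 1).
Proof.
move=> ij.
have h k : k != i -> E (fun A => x i A * x k A) = E (fun A => x i A * x j A).
  move=> ki; rewrite -(perm_expect_swap m k j); congr (perm_expectation m).
  by apply/funext => A; rewrite /x !mem_swap tpermL tpermD// eq_sym.
have : \sum_k E (fun A => x i A * x k A) = 0.
  rewrite -perm_expect_sum (@perm_eq_expect _ _ _ _ (fun _ => 0)) ?perm_expect_cst//.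
  by move=> A /sum_centred_label; rewrite -mulr_sumr => ->; rewrite mulr0.
rewrite (bigD1 i)//= (eq_bigr _ h) sumr_const.
rewrite (_ : E (fun A => x i A * x i A) = p * (1 - p)); last first.
  by rewrite -(expect_centred_label_sqr i); congr (perm_expectation m); apply/funext => A; rewrite expr2.
rewrite -[_ *+ #|_|]mulr_natl cardC1 card_ord -subn1 natrB ?(ltnW N2)//.
move=> H; apply: (mulfI (lt0r_neq0 N1)); rewrite [RHS]mulrC divfK ?lt0r_neq0//; lra.
Qed.

Lemma expect_linear_form_sqr c : E (fun A => linear_form c A ^+ 2) <= \sum_k c k ^+ 2.
Proof.
have := poincare_le mN (f := linear_form c) (u := fun i _ => 2 * c i ^+ 2).
rewrite perm_expect_sq// expect_linear_form expr0n subr0 => h; apply: le_trans (h _) _.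
  move=> A i j _; rewrite /swap_diff linear_form_swap addrAC subrr add0r exprMn.
  by have h1 := gap_sqr_le1 i j A; have h2 := sqr2_le (c i) (c j);
   have h3 := sqr_ge0 (c i - c j); nra.
rewrite mulr_sumr ler_sum// => i _; rewrite perm_expect_cst//.
by rewrite mulrA mulVf ?mul1r.
Qed.

End Moments.

(** * Variances of label polynomials on a graph *)

Section GraphMoments.
Variables (R : realType) (N m : nat).
Hypothesis mN : (m <= N)%N.
Hypothesis N2 : (1 < N)%N.
Variable a : 'I_N -> 'I_N -> R.
Hypothesis a_sym : forall i j, a i j = a j i.
Hypothesis a_diag : forall i, a i i = 0.
Hypothesis a01 : forall i j, a i j = 0 \/ a i j = 1.
Implicit Types (f g : {set 'I_N} -> R) (A : {set 'I_N}) (i j k l : 'I_N).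
Implicit Types (c : 'I_N -> R).
Local Notation E := (@perm_expectation R N m).
Local Notation p := (mean_label R N m).
Local Notation x := (@centred_label R N m).
Local Notation e := (@label_gap R N m).
Local Notation linear_form := (@linear_form R N m).

Definition degree i : R := \sum_j a i j.
Local Notation d := degree.
Definition nbsum i A : R := linear_form (a i) A.
Local Notation S := nbsum.

Lemma adj_ge0 i j : 0 <= a i j. Proof. by case: (a01 i j) => ->. Qed.
Lemma adj_le1 i j : a i j <= 1. Proof. by case: (a01 i j) => ->. Qed.
Lemma adj_sqr i j : a i j ^+ 2 = a i j.
Proof. by case: (a01 i j) => ->; rewrite ?expr0n ?expr1n. Qed.

Lemma degree_ge0 i : 0 <= d i. Proof. by apply: sumr_ge0 => j _; exact: adj_ge0. Qed.

Lemma adj_le_degree i j : a i j <= d i.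
Proof.
rewrite /d (bigD1 j)//= lerDl; apply: sumr_ge0 => k _; exact: adj_ge0.
Qed.

Lemma degree_le i : d i <= N%:R - 1.
Proof.
rewrite /d (bigD1 i)//= a_diag add0r.
have -> : N%:R - 1 = \sum_(j < N | j != i) (1 : R).
  by rewrite sumr_const cardC1 card_ord -subn1 natrB// ltnW.
by apply: ler_sum => j _; exact: adj_le1.
Qed.

(** Degrees are natural numbers, so either they vanish or they are at least 1. *)
Lemma degree_sqr i : d i <= d i ^+ 2.
Proof.
case: (pickP (fun j => a i j != 0)) => [j aij|a0].
  have : 1 <= d i.
    by apply: le_trans (adj_le_degree i j); case: (a01 i j) aij => ->; rewrite ?eqxx.
  by move=> h; nra.
by rewrite /d big1 ?expr0n// => j _; apply/eqP; have := a0 j => /negbFE.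
Qed.

Lemma sum_adj_degree (F : 'I_N -> R) : \sum_i \sum_k a i k * F k = \sum_k F k * d k.
Proof.
rewrite exchange_big; apply: eq_bigr => k _ /=.
by rewrite /d mulr_sumr; apply: eq_bigr => i _; rewrite a_sym mulrC.
Qed.

Lemma nbsum_swap i j k A : S k (swap i j A) = S k A + e i j A * (a k i - a k j).
Proof. exact: linear_form_swap. Qed.

Lemma expect_nbsum2 i : E (fun A => S i A ^+ 2) <= d i.
Proof.
apply: le_trans (expect_linear_form_sqr mN N2 _) _; rewrite le_eqVlt; apply/orP; left.
by apply/eqP/eq_bigr => k _; rewrite adj_sqr.
Qed.

(** A swap changes the neighbour sum of one of the swapped nodes only through
    the edge joining them. *)
Lemma nbsum_swapl i j A : S i (swap i j A) ^+ 2 <= 2 * S i A ^+ 2 + 2 * a i j.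
Proof.
rewrite nbsum_swap a_diag sub0r; apply: le_trans (sqr2D_le _ _) _.
rewrite lerD2l ler_pM2l// exprMn sqrrN adj_sqr.
by have := gap_sqr_le1 R m i j A; have := adj_ge0 i j; nra.
Qed.

Lemma nbsum_swapr i j A : S j (swap i j A) ^+ 2 <= 2 * S j A ^+ 2 + 2 * a i j.
Proof.
rewrite nbsum_swap a_diag subr0; apply: le_trans (sqr2D_le _ _) _.
rewrite lerD2l ler_pM2l// exprMn adj_sqr (a_sym j i).
by have := gap_sqr_le1 R m i j A; have := adj_ge0 i j; nra.
Qed.

(** The increment of [S_k ^ 2] along a swap is nonzero only when one of the
    swapped nodes is a neighbour of [k], and it is then linear in [S_k]: the
    Poincare inequality reduces the fourth moment to the second one. *)
Lemma expect_nbsum4 k : E (fun A => S k A ^+ 4) <= 6 * d k ^+ 2.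
Proof.
have h4 : E (fun A => (S k A ^+ 2 - E (fun A => S k A ^+ 2)) ^+ 2) <= 5 * d k ^+ 2.
  have := poincare_le mN (f := fun A => S k A ^+ 2) (u := fun i A => a k i * (8 * S k A ^+ 2 + 2)).
  move=> h; apply: le_trans (h _) _.
    move=> A i j _; rewrite /swap_diff nbsum_swap.
    have h1 := gap_sqr_le1 R m i j A.
    have h2 : (a k i - a k j) ^+ 2 <= a k i + a k j.
      by case: (a01 k i) => ->; case: (a01 k j) => ->; lra.
    have h3 : (a k i - a k j) ^+ 2 <= 1.
      by case: (a01 k i) => ->; case: (a01 k j) => ->; lra.
    set D := e i j A * (a k i - a k j); set s := S k A.
    have D1 : D ^+ 2 <= a k i + a k j.
      by rewrite /D exprMn; have := sqr_ge0 (a k i - a k j); nra.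
    have D2 : D ^+ 2 <= 1.
      by rewrite /D exprMn; have := sqr_ge0 (a k i - a k j); nra.
    rewrite -mulrDl (_ : (s + D) ^+ 2 - s ^+ 2 = D * (2 * s + D)); last by ring.
    rewrite exprMn; apply: ler_pM => //; rewrite ?sqr_ge0//.
    by apply: le_trans (sqr2D_le _ _) _; nra.
  under eq_bigr => i _.
    rewrite perm_expectZ perm_expectD perm_expectZ perm_expect_cst//; over.
  rewrite -mulr_suml -/(d k).
  have h1 := expect_nbsum2 k; have h2 := degree_sqr k; have h3 := degree_ge0 k.
  nra.
have := perm_expect_sq mN (fun A => S k A ^+ 2).
have -> : (fun A => (S k A ^+ 2) ^+ 2) = (fun A => S k A ^+ 4).
  by apply/funext => A; rewrite -exprM.
have h1 := expect_nbsum2 k.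
have h0 : 0 <= E (fun A => S k A ^+ 2) by apply: perm_expect_ge0 => // A _; exact: sqr_ge0.
have := degree_ge0 k; nra.
Qed.

Definition quad_form c A : R := \sum_k c k * x k A * S k A.

Definition weighted_nbsum c i A : R := linear_form (fun k => c k * a k i) A.

Lemma quad_form_swap c i j A : quad_form c (swap i j A) = quad_form c A +
  e i j A * (c i * S i (swap i j A) - c j * S j (swap i j A) + (weighted_nbsum c i A - weighted_nbsum c j A)).
Proof.
rewrite mulrDr -(sum_delta2 (fun k => c k * S k (swap i j A))).
rewrite /weighted_nbsum /linear_form -sumrB !mulr_sumr /quad_form -!big_split /=; apply: eq_bigr => k _.
rewrite centred_label_swap nbsum_swap; ring.
Qed.

(** Used for three weights: [c = 1] gives [P], [c = t] gives a term of the carre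
    du champ, and the indicator of the neighbours of a node gives the local
    quadratic forms that occur in the increments of [cubic]. *)
Lemma var_quad_form c : E (fun A => (quad_form c A - E (quad_form c)) ^+ 2) <= 10 * \sum_k c k ^+ 2 * d k.
Proof.
have := poincare_le mN (f := quad_form c)
  (u := fun i A => (8 * c i ^+ 2) * S i A ^+ 2 + (4 * weighted_nbsum c i A ^+ 2 + 8 * c i ^+ 2 * d i)).
move=> h; apply: le_trans (h _) _.
  move=> A i j _; rewrite /swap_diff quad_form_swap addrAC subrr add0r exprMn.
  have h1 := gap_sqr_le1 R m i j A.
  have h2 := nbsum_swapl i j A; have h3 := nbsum_swapr i j A.
  have h4 := adj_le_degree i j; have h5 := adj_le_degree j i.
  rewrite (a_sym j i) in h5.
  set s := S i _ in h2 *; set t := S j (swap _ _ _) in h3 *.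
  set u := weighted_nbsum c i A; set v := weighted_nbsum c j A.
  have k1 : (c i * s - c j * t + (u - v)) ^+ 2 <=
     4 * c i ^+ 2 * s ^+ 2 + 4 * c j ^+ 2 * t ^+ 2 + 4 * u ^+ 2 + 4 * v ^+ 2.
    apply: le_trans (sqr2D_le _ _) _.
    by have := sqr2_le (c i * s) (c j * t); have := sqr2_le u v; rewrite !exprMn; lra.
  have k2 : c i ^+ 2 * s ^+ 2 <= c i ^+ 2 * (2 * S i A ^+ 2 + 2 * d i).
    by apply: ler_wpM2l; rewrite ?sqr_ge0//; lra.
  have k3 : c j ^+ 2 * t ^+ 2 <= c j ^+ 2 * (2 * S j A ^+ 2 + 2 * d j).
    by apply: ler_wpM2l; rewrite ?sqr_ge0//; lra.
  have k4 := sqr_ge0 (c i * s - c j * t + (u - v)).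
  apply: (@le_trans _ _ ((c i * s - c j * t + (u - v)) ^+ 2)); first by nra.
  by apply: le_trans k1 _; lra.
have w2 : \sum_i E (fun A => weighted_nbsum c i A ^+ 2) <= \sum_k c k ^+ 2 * d k.
  apply: (@le_trans _ _ (\sum_i \sum_k (c k * a k i) ^+ 2)).
    by apply: ler_sum => i _; exact: expect_linear_form_sqr.
  rewrite exchange_big; apply: ler_sum => k _ /=; rewrite /d mulr_sumr.
  by apply: ler_sum => i _; rewrite exprMn adj_sqr.
have s2 : \sum_i c i ^+ 2 * E (fun A => S i A ^+ 2) <= \sum_k c k ^+ 2 * d k.
  by apply: ler_sum => i _; rewrite ler_wpM2l ?sqr_ge0// expect_nbsum2.
rewrite (eq_bigr (fun i => 8 * (c i ^+ 2 * E (fun A => S i A ^+ 2)) +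
    (4 * E (fun A => weighted_nbsum c i A ^+ 2) + 8 * (c i ^+ 2 * d i)))) => [|i _]; last first.
  by rewrite perm_expectD perm_expectZ perm_expectD perm_expectZ perm_expect_cst// !mulrA.
rewrite !big_split /= -!mulr_sumr; lra.
Qed.

Lemma expect_quad_form c : E (quad_form c) = - (p * (1 - p)) / (N%:R - 1) * \sum_k c k * d k.
Proof.
rewrite /quad_form perm_expect_sum mulr_sumr; apply: eq_bigr => k _.
rewrite (_ : (fun A => _) = (fun A => c k * \sum_l a k l * (x k A * x l A))); last first.
  apply/funext => A; rewrite /S /linear_form -mulrA mulr_sumr; congr (_ * _).
  by apply: eq_bigr => l _; ring.
rewrite perm_expectZ mulrCA perm_expect_sum; congr (_ * _).
rewrite /d mulr_sumr; apply: eq_bigr => l _; rewrite perm_expectZ.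
have [->|kl] := eqVneq k l; first by rewrite a_diag !(mul0r, mulr0).
by rewrite expect_centred_label2// mulrC.
Qed.

Definition sumsq A : R := \sum_k S k A ^+ 2.
Definition cubic A : R := \sum_k x k A * S k A ^+ 2.
(** The entries of the square of the adjacency matrix. *)
Definition codegree i l : R := \sum_k a k i * a k l.
Definition deg2 : R := \sum_i d i ^+ 2.

Lemma sum_adj_diff_sqr i j : 0 <= \sum_k (a k i - a k j) ^+ 2 <= d i + d j.
Proof.
rewrite sumr_ge0 => [|k _]; last exact: sqr_ge0.
rewrite /d -big_split /=; apply: ler_sum => k _.
by rewrite (a_sym i k) (a_sym j k); case: (a01 k i) => ->; case: (a01 k j) => ->; lra.
Qed.

Lemma sumsq_swap i j A : sumsq (swap i j A) = sumsq A +
  2 * e i j A * (linear_form (codegree i) A - linear_form (codegree j) A) +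
  e i j A ^+ 2 * \sum_k (a k i - a k j) ^+ 2.
Proof.
have h l : linear_form (codegree l) A = \sum_k a k l * S k A.
  rewrite /linear_form /codegree /S /linear_form; under [RHS]eq_bigr do rewrite mulr_sumr.
  rewrite [RHS]exchange_big; apply: eq_bigr => k _ /=; rewrite mulr_suml.
  by apply: eq_bigr => i' _; rewrite mulrA.
rewrite !h -sumrB !mulr_sumr /sumsq -!big_split /=; apply: eq_bigr => k _.
by rewrite nbsum_swap; ring.
Qed.

Lemma var_sumsq : E (fun A => (sumsq A - E sumsq) ^+ 2) <=
  8 * (\sum_i \sum_l codegree i l ^+ 2) + 2 * deg2.
Proof.
have := poincare_le mN (f := sumsq)
  (u := fun i A => 16 * linear_form (codegree i) A ^+ 2 + 4 * d i ^+ 2).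
move=> h; apply: le_trans (h _) _.
  move=> A i j _; have ac (s u v : R) : s + u + v - s = u + v by ring.
  rewrite /swap_diff sumsq_swap ac.
  have h1 := gap_sqr_le1 R m i j A; have h0 := sqr_ge0 (e i j A).
  have /andP[h2 h3] := sum_adj_diff_sqr i j.
  set q := \sum_k _ in h2 h3 *; set u := linear_form _ A; set v := linear_form (codegree j) A.
  set g := e i j A in h0 h1 *.
  apply: le_trans (sqr2D_le _ _) _; rewrite !exprMn.
  have k1 : g ^+ 2 * (u - v) ^+ 2 <= 2 * u ^+ 2 + 2 * v ^+ 2.
    by have := sqr2_le u v; have := sqr_ge0 (u - v); nra.
  have k2 : (g ^+ 2) ^+ 2 * q ^+ 2 <= q ^+ 2.
    by rewrite ler_piMl ?sqr_ge0// expr_le1.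
  have k3 : q ^+ 2 <= 2 * d i ^+ 2 + 2 * d j ^+ 2.
    by apply: le_trans (sqr2D_le _ _); rewrite lerXn2r// nnegrE// (le_trans h2).
  lra.
have w2 : \sum_i E (fun A => linear_form (codegree i) A ^+ 2) <= \sum_i \sum_l codegree i l ^+ 2.
  by apply: ler_sum => i _; exact: expect_linear_form_sqr.
rewrite (eq_bigr (fun i => 16 * E (fun A => linear_form (codegree i) A ^+ 2) + 4 * d i ^+ 2)) => [|i _]; last first.
  by rewrite perm_expectD perm_expectZ perm_expect_cst.
by rewrite big_split /= -!mulr_sumr -/deg2; lra.
Qed.

Lemma cubic_swap i j A : cubic (swap i j A) = cubic A +
  e i j A * (S i (swap i j A) ^+ 2 - S j (swap i j A) ^+ 2) +
  2 * e i j A * (quad_form (fun k => a k i) A - quad_form (fun k => a k j) A) +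
  e i j A ^+ 2 * \sum_k x k A * (a k i - a k j) ^+ 2.
Proof.
rewrite -(sum_delta2 (fun k => S k (swap i j A) ^+ 2)).
rewrite /quad_form -sumrB !mulr_sumr /cubic -!big_split /=; apply: eq_bigr => k _.
by rewrite centred_label_swap nbsum_swap; ring.
Qed.

Lemma expect_local_quad_sqr i : E (fun A => quad_form (fun k => a k i) A ^+ 2) <=
  10 * (\sum_k a k i * d k) + d i ^+ 2.
Proof.
have h1 := var_quad_form (fun k => a k i).
rewrite perm_expect_sq// expect_quad_form in h1.
have aE : \sum_k a k i ^+ 2 * d k = \sum_k a k i * d k.
  by apply: eq_bigr => k _; rewrite adj_sqr.
rewrite aE in h1.
apply: (@le_trans _ _ (10 * (\sum_k a k i * d k) + (- (p * (1 - p)) / (N%:R - 1) * \sum_k a k i * d k) ^+ 2)); first by lra.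
rewrite lerD2l; have N1 : 0 < N%:R - 1 :> R by rewrite subr_gt0 ltr1n.
have h2 : 0 <= \sum_k a k i * d k <= d i * (N%:R - 1).
  rewrite sumr_ge0 => [|k _]; last by rewrite mulr_ge0 ?adj_ge0 ?degree_ge0.
  rewrite /d mulr_suml; apply: ler_sum => k _; rewrite (a_sym i k).
  by rewrite ler_wpM2l ?adj_ge0// degree_le.
have /andP[h3 h4] := h2; have /andP[h5 h6] := pq01 R mN.
set w := \sum_k _ in h2 h3 h4 *.
have -> : (- (p * (1 - p)) / (N%:R - 1) * w) ^+ 2 = (p * (1 - p)) ^+ 2 * (w / (N%:R - 1)) ^+ 2.
  by field; rewrite lt0r_neq0.
have h7 : 0 <= w / (N%:R - 1) <= d i by rewrite divr_ge0 ?(ltW N1)//= ler_pdivrMr.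
have /andP[h8 h9] := h7.
apply: (@le_trans _ _ ((w / (N%:R - 1)) ^+ 2)).
  by rewrite ler_piMl ?sqr_ge0// expr_le1.
by rewrite lerXn2r// nnegrE degree_ge0.
Qed.

(** The increments of the cubic form are the squares of neighbour sums and the
    local quadratic forms, whose second moments are known. *)
Lemma var_cubic : E (fun A => (cubic A - E cubic) ^+ 2) <= 400 * deg2.
Proof.
have := poincare_le mN (f := cubic)
  (u := fun i A => 48 * S i A ^+ 4 + (24 * quad_form (fun k => a k i) A ^+ 2 + 54 * d i ^+ 2)).
move=> h; apply: le_trans (h _) _.
  move=> A i j _; have ac (s u v w : R) : s + u + v + w - s = u + v + w by ring.
  rewrite /swap_diff cubic_swap ac.
  have h1 := gap_sqr_le1 R m i j A; have h0 := sqr_ge0 (e i j A).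
  have /andP[h2 h3] := sum_adj_diff_sqr i j.
  have q2 : (\sum_k x k A * (a k i - a k j) ^+ 2) ^+ 2 <= 2 * d i ^+ 2 + 2 * d j ^+ 2.
    apply: le_trans (sqr2D_le _ _); rewrite -real_normK ?num_real//.
    rewrite lerXn2r// ?nnegrE ?addr_ge0 ?degree_ge0//; apply: le_trans h3.
    apply: le_trans (ler_norm_sum _ _ _) _; apply: ler_sum => k _.
    rewrite normrM (ger0_norm (sqr_ge0 _)) ler_piMl ?sqr_ge0//.
    exact: centred_label_le1.
  set q := \sum_k _ in q2 *.
  have s1 := nbsum_swapl i j A; have s2 := nbsum_swapr i j A.
  have t1 := adj_le_degree i j; have t2 := adj_le_degree j i.
  rewrite (a_sym j i) in t2.
  have r1 := sqr_ge0 (S i (swap i j A)); have r2 := sqr_ge0 (S j (swap i j A)).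
  set G := S i (swap i j A) ^+ 2 in s1 r1 *; set H := S j (swap i j A) ^+ 2 in s2 r2 *.
  have G2 : G ^+ 2 <= 8 * S i A ^+ 4 + 8 * d i ^+ 2.
    apply: (@le_trans _ _ ((2 * S i A ^+ 2 + 2 * d i) ^+ 2)).
      by rewrite lerXn2r ?nnegrE//; lra.
    by apply: le_trans (sqr2D_le _ _) _; lra.
  have H2 : H ^+ 2 <= 8 * S j A ^+ 4 + 8 * d j ^+ 2.
    apply: (@le_trans _ _ ((2 * S j A ^+ 2 + 2 * d j) ^+ 2)).
      by rewrite lerXn2r ?nnegrE//; lra.
    by apply: le_trans (sqr2D_le _ _) _; lra.
  set u := quad_form _ A; set v := quad_form (fun k => a k j) A; set g := e i j A in h0 h1 *.
  have sq3 (b1 b2 b3 : R) : (b1 + b2 + b3) ^+ 2 <= 3 * (b1 ^+ 2 + b2 ^+ 2 + b3 ^+ 2).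
    rewrite -subr_ge0 (_ : _ - _ = (b1 - b2) ^+ 2 + (b1 - b3) ^+ 2 + (b2 - b3) ^+ 2); last by ring.
    by rewrite !addr_ge0 ?sqr_ge0.
  apply: le_trans (sq3 _ _ _) _; rewrite !exprMn.
  have k1 : g ^+ 2 * (u - v) ^+ 2 <= 2 * u ^+ 2 + 2 * v ^+ 2.
    by have := sqr2_le u v; have := sqr_ge0 (u - v); nra.
  have k3 : g ^+ 2 * (G - H) ^+ 2 <= 2 * G ^+ 2 + 2 * H ^+ 2.
    by have := sqr2_le G H; have := sqr_ge0 (G - H); nra.
  have k2 : (g ^+ 2) ^+ 2 * q ^+ 2 <= q ^+ 2.
    by rewrite ler_piMl ?sqr_ge0// expr_le1.
  lra.
rewrite (eq_bigr (fun i => 48 * E (fun A => S i A ^+ 4) +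
   (24 * E (fun A => quad_form (fun k => a k i) A ^+ 2) + 54 * d i ^+ 2))) => [|i _]; last first.
  by rewrite perm_expectD perm_expectZ perm_expectD perm_expectZ perm_expect_cst.
have w1 : \sum_i E (fun A => S i A ^+ 4) <= 6 * deg2.
  by rewrite mulr_sumr; apply: ler_sum => i _; exact: expect_nbsum4.
have w2 : \sum_i E (fun A => quad_form (fun k => a k i) A ^+ 2) <= 11 * deg2.
  apply: (@le_trans _ _ (\sum_i (10 * (\sum_k a k i * d k) + d i ^+ 2))).
    by apply: ler_sum => i _; exact: expect_local_quad_sqr.
  rewrite big_split /= -mulr_sumr -/deg2.
  have -> : \sum_i \sum_k a k i * d k = deg2.
    by rewrite exchange_big; apply: eq_bigr => k _ /=; rewrite -mulr_suml expr2.
  by lra.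
have d0 : 0 <= deg2 by apply: sumr_ge0 => i _; exact: sqr_ge0.
by rewrite !big_split /= -!mulr_sumr -/deg2; lra.
Qed.

Lemma sum_degree_ge0 : 0 <= \sum_i d i.
Proof. by apply: sumr_ge0 => i _; exact: degree_ge0. Qed.

(** The left-hand side counts closed walks of length four.  Fixing the first
    edge [k, i], the opposite edge can be chosen in at most [d i * d k] ways, and
    in at most [sum_j d j] ways; the geometric mean of the two bounds gives the
    estimate. *)
Lemma sum_codegree_sqr :
  \sum_i \sum_l codegree i l ^+ 2 <= Num.sqrt (\sum_i d i) * deg2.
Proof.
pose M k i := \sum_l \sum_j a i l * a k j * a j l.
have M0 k i : 0 <= M k i.
  by do 2!(apply: sumr_ge0 => ? _); rewrite !mulr_ge0 ?adj_ge0.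
have M1 k i : M k i <= d i * d k.
  rewrite /d mulr_suml; apply: ler_sum => l _; rewrite mulr_sumr.
  by apply: ler_sum => j _; rewrite ler_piMr ?adj_le1// mulr_ge0 ?adj_ge0.
have M2 k i : M k i <= \sum_j d j.
  rewrite /M exchange_big; apply: ler_sum => j _ /=; rewrite /d; apply: ler_sum => l _.
  by rewrite ler_piMl ?adj_ge0// mulr_ile1 ?adj_ge0 ?adj_le1.
set s := \sum_j d j in M2 *.
have s0 : 0 <= s by exact: sum_degree_ge0.
have MM k i : M k i <= Num.sqrt s * ((d i + d k) / 2).
  rewrite -(ler_pXn2r (n := 2))// ?nnegrE//; last first.
    by rewrite mulr_ge0 ?sqrtr_ge0// divr_ge0// addr_ge0 ?degree_ge0.
  rewrite exprMn sqr_sqrtr// expr2.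
  have h1 := M0 k i; have h2 := M1 k i; have h3 := M2 k i.
  apply: (@le_trans _ _ (s * (d i * d k))); first exact: ler_pM.
  by apply: ler_wpM2l => //; have := sqr_ge0 (d i - d k); nra.
have -> : \sum_i \sum_l codegree i l ^+ 2 = \sum_k \sum_i a k i * M k i.
  transitivity (\sum_i \sum_l \sum_k \sum_j a k i * (a i j * a k l * a l j)).
    apply: eq_bigr => i _; apply: eq_bigr => l _; rewrite expr2 /codegree mulr_suml.
    apply: eq_bigr => k _; rewrite mulr_sumr; apply: eq_bigr => j _.
    by rewrite (a_sym i j) (a_sym l j); ring.
  rewrite [RHS]exchange_big; apply: eq_bigr => i _ /=; rewrite exchange_big.
  apply: eq_bigr => k _ /=; rewrite exchange_big /M mulr_sumr /=.
  by apply: eq_bigr => j _; rewrite mulr_sumr.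
apply: (@le_trans _ _ (\sum_k \sum_i a k i * (Num.sqrt s * ((d i + d k) / 2)))).
  by do 2!(apply: ler_sum => ? _); rewrite ler_wpM2l ?adj_ge0.
rewrite le_eqVlt; apply/orP; left; apply/eqP.
transitivity (Num.sqrt s / 2 * (\sum_k \sum_i a k i * d i + \sum_k \sum_i a k i * d k)).
  rewrite -big_split mulr_sumr; apply: eq_bigr => k _ /=; rewrite -big_split mulr_sumr.
  by apply: eq_bigr => i _ /=; field.
rewrite sum_adj_degree; have -> : \sum_k d k * d k = deg2 by apply: eq_bigr => k _; rewrite expr2.
have -> : \sum_k \sum_i a k i * d k = deg2.
  by apply: eq_bigr => k _; rewrite -mulr_suml expr2.
by field.
Qed.

Lemma expect_sumsq : p * (1 - p) * (\sum_i d i - deg2 / (N%:R - 1)) <= E sumsq.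
Proof.
have N1 : 0 < N%:R - 1 :> R by rewrite subr_gt0 ltr1n.
have /andP[h5 h6] := pq01 R mN.
rewrite /sumsq perm_expect_sum /deg2 mulr_suml -sumrB mulr_sumr; apply: ler_sum => i _.
have -> : E (fun A => S i A ^+ 2) = \sum_k \sum_l a i k * a i l * E (fun A => x k A * x l A).
  rewrite (_ : (fun A => _) = (fun A => \sum_k \sum_l a i k * a i l * (x k A * x l A))).
    rewrite perm_expect_sum; apply: eq_bigr => k _; rewrite perm_expect_sum.
    by apply: eq_bigr => l _; rewrite perm_expectZ.
  apply/funext => A; rewrite expr2 /S /linear_form mulr_suml; apply: eq_bigr => k _.
  by rewrite mulr_sumr; apply: eq_bigr => l _; ring.
have -> : p * (1 - p) * (d i - d i ^+ 2 / (N%:R - 1)) =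
  \sum_k \sum_l (a i k * (p * (1 - p)) * (l == k)%:R +
     a i k * a i l * (- (p * (1 - p)) / (N%:R - 1))).
  under eq_bigr => k _ do rewrite big_split /= sum_delta -mulr_suml -mulr_sumr -/(d i).
  rewrite big_split /= -!mulr_suml -/(d i); field; exact: lt0r_neq0.
apply: ler_sum => k _; apply: ler_sum => l _.
have [->|lk] := eqVneq l k; last first.
  by rewrite mulr0 add0r expect_centred_label2// eq_sym.
rewrite mulr1 -expr2 adj_sqr.
rewrite (_ : (fun A => x k A * x k A) = (fun A => x k A ^+ 2)); last by apply/funext => A; rewrite expr2.
rewrite expect_centred_label_sqr// gerDl mulr_ge0_le0 ?adj_ge0// mulNr oppr_le0 divr_ge0//.
exact: ltW.
Qed.

End GraphMoments.

(** * The Poisson equation and the carre du champ *)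

Section DoubleSums.
Variables (R : realType) (N : nat).
Implicit Types (u v w : 'I_N -> R).

(** Summing a polynomial expression over one index, with the monomials named:
    applied twice, it evaluates the double sums below. *)
Lemma sum_poly3 u v w (c1 c2 c3 c4 c5 c6 c7 c8 : R) :
  \sum_j (c1 + c2 * u j + c3 * v j + c4 * (u j * v j) + c5 * w j +
          c6 * (w j * u j) + c7 * (w j * v j) + c8 * (w j * (u j * v j))) =
  c1 * N%:R + c2 * (\sum_j u j) + c3 * (\sum_j v j) + c4 * (\sum_j u j * v j) +
  c5 * (\sum_j w j) + c6 * (\sum_j w j * u j) + c7 * (\sum_j w j * v j) +
  c8 * (\sum_j w j * (u j * v j)).
Proof. by rewrite !big_split /= sumr_const card_ord -!mulr_sumr -[c1 *+ N]mulr_natr. Qed.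

Lemma sum_gap u v : \sum_i \sum_j (v j - v i) * (u i - u j) =
  2 * (\sum_i u i) * (\sum_i v i) - 2 * N%:R * \sum_i u i * v i.
Proof.
pose z (j : 'I_N) : R := 0.
transitivity (\sum_i ((- N%:R) * (u i * v i) + (\sum_j v j) * u i + (\sum_j u j) * v i
    - \sum_j u j * v j)).
  apply: eq_bigr => i _.
  transitivity (\sum_j (- (u i * v i) + v i * u j + u i * v j + (-1) * (u j * v j) + 0 * z j +
     0 * (z j * u j) + 0 * (z j * v j) + 0 * (z j * (u j * v j)))).
    by apply: eq_bigr => j _; ring.
  rewrite sum_poly3; ring.
transitivity (\sum_i (- (\sum_j u j * v j) + (\sum_j v j) * u i + (\sum_j u j) * v i
   + (- N%:R) * (u i * v i) + 0 * z i + 0 * (z i * u i) + 0 * (z i * v i) + 0 * (z i * (u i * v i)))).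
  by apply: eq_bigr => i _; ring.
by rewrite sum_poly3; ring.
Qed.

Lemma sum_gap_sqr (k mu : R) u v w : \sum_i w i = 0 ->
  \sum_i \sum_j (2 * k - mu * (w i + w j) - 2 * w i * w j) * ((u i - u j) * (v i - v j)) =
  N%:R * (4 * k * (\sum_i u i * v i) - 2 * mu * \sum_i w i * (u i * v i)) +
  (- 4 * k * (\sum_i u i) * (\sum_i v i) +
   2 * mu * ((\sum_i w i * u i) * (\sum_i v i) + (\sum_i w i * v i) * (\sum_i u i)) +
   4 * (\sum_i w i * u i) * (\sum_i w i * v i)).
Proof.
move=> w0.
set su := \sum_i u i; set sv := \sum_i v i; set suv := \sum_i u i * v i.
set swu := \sum_i w i * u i; set swv := \sum_i w i * v i.
set swuv := \sum_i w i * (u i * v i).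
transitivity (\sum_i ((2 * k * suv - mu * swuv) + (- 2 * k * sv + mu * swv) * u i +
   (- 2 * k * su + mu * swu) * v i + (2 * k * N%:R) * (u i * v i) +
   (- mu * suv - 2 * swuv) * w i + (mu * sv + 2 * swv) * (w i * u i) +
   (mu * su + 2 * swu) * (w i * v i) + (- mu * N%:R) * (w i * (u i * v i)))).
  apply: eq_bigr => i _.
  pose q := 2 * k - mu * w i; pose r := - mu - 2 * w i.
  transitivity (\sum_j (q * (u i * v i) + (- q * v i) * u j + (- q * u i) * v j + q * (u j * v j) +
     r * (u i * v i) * w j + (- r * v i) * (w j * u j) + (- r * u i) * (w j * v j) +
     r * (w j * (u j * v j)))).
    by apply: eq_bigr => j _; rewrite /q /r; ring.
  by rewrite sum_poly3 w0 -/su -/sv -/suv -/swu -/swv -/swuv /q /r; ring.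
by rewrite sum_poly3 w0 -/su -/sv -/suv -/swu -/swv -/swuv; ring.
Qed.

End DoubleSums.

Section SteinStatistic.
Variables (R : realType) (N m : nat).
Hypothesis mN : (m <= N)%N.
Hypothesis N2 : (1 < N)%N.
Variable a : 'I_N -> 'I_N -> R.
Hypothesis a_sym : forall i j, a i j = a j i.
Hypothesis a_diag : forall i, a i i = 0.
Hypothesis a01 : forall i j, a i j = 0 \/ a i j = 1.
Implicit Types (f g : {set 'I_N} -> R) (A : {set 'I_N}) (i j k l : 'I_N).
Implicit Types (c : 'I_N -> R).
Local Notation E := (@perm_expectation R N m).
Local Notation p := (mean_label R N m).
Local Notation x := (@centred_label R N m).
Local Notation e := (@label_gap R N m).
Local Notation linear_form := (@linear_form R N m).
Local Notation d := (degree a).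
Local Notation S := (@nbsum R N m a).
Local Notation quad_form := (@quad_form R N m a).
Local Notation sumsq := (@sumsq R N m a).
Local Notation cubic := (@cubic R N m a).

Definition bias : R := 2 * p - 1.
Local Notation mu := bias.
Definition degsum : R := \sum_i d i.
Local Notation g2 := degsum.
Definition centred_deg i : R := d i - g2 / N%:R.
Local Notation t := centred_deg.
Definition deg_disp : R := \sum_i t i ^+ 2.
Local Notation V := deg_disp.

Definition linpart A : R := linear_form t A.
Local Notation L := linpart.
Definition quadpart A : R := quad_form (fun _ => 1) A.
Local Notation P := quadpart.
Definition reduced_count A : R := mu * L A + P A.
Local Notation W := reduced_count.
(** To leading order the generator of the swap chain multiplies linear forms by
    -1 and quadratic forms by -2, whence the weights. *)
Definition potential A : R := mu * L A + P A / 2.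
Local Notation F := potential.

Let N0 : 0 < N%:R :> R. Proof. by rewrite ltr0n ltnW. Qed.
Let N1 : 0 < N%:R - 1 :> R. Proof. by rewrite subr_gt0 ltr1n. Qed.

Lemma bias_sqr : mu ^+ 2 <= 1.
Proof. by have /andP[h1 h2] := mean_label01 R mN; rewrite /mu; nra. Qed.

Lemma bias_abs : `|mu| <= 1.
Proof. by have /andP[h1 h2] := mean_label01 R mN; rewrite /mu ler_norml; lra. Qed.

Lemma sum_centred_deg : \sum_i t i = 0.
Proof.
by rewrite /t sumrB sumr_const card_ord -/g2 -[_ *+ N]mulr_natr divfK ?subrr// lt0r_neq0.
Qed.

Lemma sum_centred_deg_degree : \sum_i t i * d i = V.
Proof.
rewrite /V (eq_bigr (fun i => t i ^+ 2 + g2 / N%:R * t i)) => [|i _]; last by rewrite /t; ring.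
by rewrite big_split /= -mulr_sumr sum_centred_deg mulr0 addr0.
Qed.

Lemma deg2E : deg2 a = V + g2 ^+ 2 / N%:R.
Proof.
rewrite /deg2 (eq_bigr (fun i => t i ^+ 2 + (2 * (g2 / N%:R) * t i + (g2 / N%:R) ^+ 2))) => [|i _]; last by rewrite /t; ring.
rewrite !big_split /= -mulr_sumr sum_centred_deg sumr_const card_ord -/V -[_ *+ N]mulr_natr.
by field; exact: lt0r_neq0.
Qed.

Lemma linear_form_degree A : #|A| = m -> linear_form d A = L A.
Proof.
move=> cA; rewrite /L /linear_form (eq_bigr (fun i => t i * x i A + g2 / N%:R * x i A)) => [|i _].
  by rewrite big_split /= -mulr_sumr sum_centred_label// mulr0 addr0.
by rewrite /t; ring.
Qed.

Lemma sum_nbsum A : #|A| = m -> \sum_i S i A = L A.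
Proof.
move=> cA; rewrite -(linear_form_degree cA) /S /linear_form exchange_big; apply: eq_bigr => k _ /=.
by rewrite -mulr_suml; congr (_ * _); apply: eq_bigr => i _; rewrite a_sym.
Qed.

Lemma linpart_diff i j A : swap_diff i j L A = e i j A * (t i - t j).
Proof. by rewrite /swap_diff /L linear_form_swap addrAC subrr add0r. Qed.

Lemma quadpart_diff i j A :
  swap_diff i j P A = 2 * e i j A * (S i A - S j A) - 2 * a i j * e i j A ^+ 2.
Proof.
rewrite /swap_diff /P quad_form_swap// addrAC subrr add0r !nbsum_swap !a_diag (a_sym j i) !mul1r.
have h k : weighted_nbsum m a (fun _ => 1) k A = S k A.
  by apply: eq_bigr => l _; rewrite mul1r a_sym.
by rewrite !h; ring.
Qed.

Lemma sum_adj_gap A : #|A| = m -> \sum_i \sum_j a i j * e i j A ^+ 2 =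
  2 * (p * (1 - p)) * g2 - 2 * mu * L A - 2 * P A.
Proof.
move=> cA.
have -> : \sum_i \sum_j a i j * e i j A ^+ 2 =
   \sum_i (2 * (p * (1 - p)) * d i + (1 - 2 * p) * (d i * x i A)
     + (1 - 2 * p) * S i A - 2 * (1 * x i A * S i A)).
  apply: eq_bigr => i _; rewrite /d /S /linear_form mulr_suml !mulr_sumr -!big_split -sumrB /=.
  by apply: eq_bigr => j _; rewrite gap_sqr; ring.
rewrite sumrB !big_split /= -!mulr_sumr sum_nbsum// -/g2 -/(quad_form (fun _ => 1) A) -/(P A).
by rewrite -/(linear_form d A) linear_form_degree// /mu; ring.
Qed.

Lemma expect_linpart : E L = 0. Proof. exact: expect_linear_form. Qed.

Lemma expect_quadpart : E P = - (p * (1 - p)) / (N%:R - 1) * g2.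
Proof. by rewrite expect_quad_form//; under eq_bigr do rewrite mul1r. Qed.

Lemma expect_reduced_count : E W = - (p * (1 - p)) / (N%:R - 1) * g2.
Proof. by rewrite perm_expectD perm_expectZ expect_linpart mulr0 add0r expect_quadpart. Qed.

Lemma potential_diff i j A : swap_diff i j F A =
  e i j A * ((mu * t i + S i A) - (mu * t j + S j A)) - a i j * e i j A ^+ 2.
Proof.
have -> : swap_diff i j F A = mu * swap_diff i j L A + swap_diff i j P A / 2 by rewrite /swap_diff /F; ring.
by rewrite linpart_diff quadpart_diff; field.
Qed.

Lemma reduced_count_diff i j A : swap_diff i j W A =
  e i j A * ((mu * t i + 2 * S i A) - (mu * t j + 2 * S j A)) - 2 * a i j * e i j A ^+ 2.
Proof.
have -> : swap_diff i j W A = mu * swap_diff i j L A + swap_diff i j P A by rewrite /swap_diff /W; ring.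
by rewrite linpart_diff quadpart_diff; field.
Qed.

(** The leading part of the double sum is [- 2 N W].  The corrections come from
    swapping the two ends of an edge; by [sum_adj_gap] they add up to [2 W] and a
    constant, and the constant is determined by the mean. *)
Lemma potential_poisson A : #|A| = m ->
  \sum_i \sum_j swap_diff i j F A = - (2 * (N%:R - 1)) * (W A - E W).
Proof.
move=> cA.
have -> : \sum_i \sum_j swap_diff i j F A =
  (\sum_i \sum_j (x j A - x i A) * ((mu * t i + S i A) - (mu * t j + S j A)))
   - \sum_i \sum_j a i j * e i j A ^+ 2.
  rewrite -sumrB; apply: eq_bigr => i _; rewrite -sumrB; apply: eq_bigr => j _.
  exact: potential_diff.
rewrite sum_gap sum_centred_label// mulr0 sub0r sum_adj_gap//.
have -> : \sum_i (mu * t i + S i A) * x i A = mu * L A + P A.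
  rewrite /L /linear_form /P /quad_form mulr_sumr -big_split; apply: eq_bigr => i _ /=; ring.
rewrite expect_reduced_count /W; field; exact: lt0r_neq0.
Qed.

(** The sum is not normalised; its mean is [4 (N - 1)] times the variance. *)
Definition carre_du_champ A : R := \sum_i \sum_j swap_diff i j F A * swap_diff i j W A.

Lemma stein_ibp g : E (fun A => (W A - E W) * g A) =
  (4 * (N%:R - 1))^-1 * E (fun A => \sum_i \sum_j swap_diff i j F A * swap_diff i j g A).
Proof.
have := swap_ibp m F g.
rewrite (@perm_eq_expect _ _ _ _ (fun A => - (2 * (N%:R - 1)) * ((W A - E W) * g A))); last first.
  by move=> A cA; rewrite potential_poisson//; ring.
rewrite perm_expectZ => H; apply: (mulfI (lt0r_neq0 N1)).
set X := E _ in H *; set Y := E _ in H *.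
have -> : (N%:R - 1) * ((4 * (N%:R - 1))^-1 * Y) = Y / 4 by field; exact: lt0r_neq0.
lra.
Qed.

Lemma var_reduced_count : E (fun A => (W A - E W) ^+ 2) = (4 * (N%:R - 1))^-1 * E carre_du_champ.
Proof.
rewrite perm_expect_sq//.
have -> : E (fun A => W A ^+ 2) - E W ^+ 2 = E (fun A => (W A - E W) * W A).
  rewrite (_ : (fun A => (W A - E W) * W A) = (fun A => W A ^+ 2 - E W * W A)).
    by rewrite perm_expectB perm_expectZ expr2.
  by apply/funext => A; ring.
by rewrite stein_ibp.
Qed.

(** The neighbourhood sums of centred degrees: the third hypothesis of the limit
    theorem is about their squares. *)
Definition nb_centred_deg k : R := \sum_i t i * a i k.

(** The carre du champ is [N] times a sum over single nodes, a product of global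
    sums, and a sum over edges.  Only the first part is of leading order. *)
Definition carre_main A : R :=
  4 * (p * (1 - p)) * (mu ^+ 2 * V + 3 * mu * linear_form nb_centred_deg A + 2 * sumsq A) -
  2 * mu * (mu ^+ 2 * linear_form (fun i => t i ^+ 2) A + 3 * mu * quad_form t A + 2 * cubic A).

Definition carre_global A : R :=
  - 8 * (p * (1 - p)) * L A ^+ 2 + 2 * mu * (3 * mu * L A + 4 * P A) * L A +
  4 * (mu * L A + P A) * (mu * L A + 2 * P A).

Definition carre_adjacent A : R := \sum_i \sum_j a i j *
  (2 * e i j A ^+ 2 - e i j A * (3 * mu * (t i - t j) + 4 * (S i A - S j A))).

Lemma carre_du_champE A : #|A| = m -> carre_du_champ A = N%:R * carre_main A + (carre_global A + carre_adjacent A).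
Proof.
move=> cA.
have -> : carre_du_champ A = \sum_i \sum_j (2 * (p * (1 - p)) - mu * (x i A + x j A) - 2 * x i A * x j A) *
   (((mu * t i + S i A) - (mu * t j + S j A)) *
    ((mu * t i + 2 * S i A) - (mu * t j + 2 * S j A))) + carre_adjacent A.
  rewrite /carre_du_champ /carre_adjacent -big_split; apply: eq_bigr => i _; rewrite -big_split /=.
  apply: eq_bigr => j _; rewrite potential_diff reduced_count_diff.
  have <- : e i j A ^+ 2 = 2 * (p * (1 - p)) - mu * (x i A + x j A) - 2 * x i A * x j A.
    by rewrite gap_sqr /mu; ring.
  set u := S i A; set v := S j A; set q := e i j A.
  have q3 : q ^+ 3 = q by exact: gap3.
  have q4 : q ^+ 4 = q ^+ 2 by rewrite exprS q3 expr2.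
  transitivity (q ^+ 2 * ((mu * t i + u - (mu * t j + v)) * (mu * t i + 2 * u - (mu * t j + 2 * v)))
    - a i j * q ^+ 3 * (3 * mu * (t i - t j) + 4 * (u - v)) + 2 * a i j ^+ 2 * q ^+ 4); first by ring.
  by rewrite q3 q4 adj_sqr//; ring.
rewrite sum_gap_sqr ?sum_centred_label// [RHS]addrA; congr (_ + _).
rewrite !big_split /= -!mulr_sumr sum_centred_deg sum_nbsum//.
have h1 : \sum_i (mu * t i + S i A) * (mu * t i + 2 * S i A) =
   mu ^+ 2 * V + 3 * mu * linear_form nb_centred_deg A + 2 * sumsq A.
  have -> : linear_form nb_centred_deg A = \sum_i t i * S i A.
    rewrite /linear_form /nb_centred_deg /S /linear_form; under eq_bigr do rewrite mulr_suml.
    rewrite exchange_big; apply: eq_bigr => i _ /=; rewrite mulr_sumr.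
    by apply: eq_bigr => k _; rewrite mulrA.
  rewrite /V /sumsq !mulr_sumr -!big_split; apply: eq_bigr => i _ /=; ring.
have h2 : \sum_i x i A * ((mu * t i + S i A) * (mu * t i + 2 * S i A)) =
   mu ^+ 2 * linear_form (fun i => t i ^+ 2) A + 3 * mu * quad_form t A + 2 * cubic A.
  rewrite /linear_form /quad_form /cubic !mulr_sumr -!big_split; apply: eq_bigr => i _ /=; ring.
have h3 : \sum_i x i A * (mu * t i + S i A) = mu * L A + P A.
  rewrite /L /linear_form /P /quad_form !mulr_sumr -!big_split; apply: eq_bigr => i _ /=; ring.
have h4 : \sum_i x i A * (mu * t i + 2 * S i A) = mu * L A + 2 * P A.
  rewrite /L /linear_form /P /quad_form !mulr_sumr -!big_split; apply: eq_bigr => i _ /=; ring.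
rewrite h1 h2 h3 h4 /carre_main /carre_global; ring.
Qed.

Definition deg_scale : R := g2 / 2 + V.
Local Notation T := deg_scale.
(** Up to a numerical factor, a bound for the variance of each of the polynomials
    in [carre_main]. *)
Definition fluct : R := \sum_k nb_centred_deg k ^+ 2 + \sum_i \sum_l codegree a i l ^+ 2 +
  deg2 a + \sum_i t i ^+ 4 + \sum_i t i ^+ 2 * d i.
Local Notation B := fluct.

Lemma degsum_ge0 : 0 <= g2. Proof. by apply: sumr_ge0 => i _; exact: degree_ge0. Qed.
Lemma deg_disp_ge0 : 0 <= V. Proof. by apply: sumr_ge0 => i _; exact: sqr_ge0. Qed.
Lemma deg2_ge0 : 0 <= deg2 a. Proof. by apply: sumr_ge0 => i _; exact: sqr_ge0. Qed.

Lemma degsum_le : g2 <= N%:R * (N%:R - 1).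
Proof.
apply: (@le_trans _ _ (\sum_(i < N) (N%:R - 1))).
  by apply: ler_sum => i _; exact: degree_le.
by rewrite sumr_const card_ord -[_ *+ N]mulr_natl.
Qed.

Lemma expect_linpart_sqr : E (fun A => L A ^+ 2) <= V.
Proof. exact: expect_linear_form_sqr. Qed.

Lemma expect_quadpart_sqr : E (fun A => P A ^+ 2) <= 12 * g2.
Proof.
have := var_quad_form mN N2 a_sym a_diag a01 (fun _ => 1).
rewrite -/P perm_expect_sq// expect_quadpart.
under eq_bigr do rewrite expr1n mul1r.
rewrite -/g2.
have -> : (- (p * (1 - p)) / (N%:R - 1) * g2) ^+ 2 = (p * (1 - p)) ^+ 2 * (g2 / (N%:R - 1) * (g2 / (N%:R - 1))).
  by field; exact: lt0r_neq0.
have h0 := degsum_ge0; have h1 := degsum_le; have /andP[h2 h3] := pq01 R mN.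
have h4 : 0 <= g2 / (N%:R - 1) <= N%:R.
  by rewrite divr_ge0 ?(ltW N1)//= ler_pdivrMr.
have h5 : g2 / (N%:R - 1) * (g2 / (N%:R - 1)) <= 2 * g2.
  apply: (@le_trans _ _ (N%:R * (g2 / (N%:R - 1)))).
    by case/andP: h4 => *; rewrite ler_wpM2r.
  rewrite mulrA ler_pdivrMr//; have : 2 <= N%:R :> R by rewrite ler_nat.
  by nra.
have h6 : (p * (1 - p)) ^+ 2 <= 1 by rewrite expr_le1.
have h7 : 0 <= g2 / (N%:R - 1) * (g2 / (N%:R - 1)).
  by case/andP: h4 => *; rewrite mulr_ge0.
have := sqr_ge0 (p * (1 - p)); nra.
Qed.

Lemma expect_carre_global : E (fun A => `|carre_global A|) <= 672 * T.
Proof.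
apply: (@le_trans _ _ (E (fun A => 28 * (L A ^+ 2 + P A ^+ 2)))).
  apply: perm_expect_le => // A _.
  have h1 := bias_abs; have /andP[h2 h3] := pq01 R mN; rewrite /carre_global.
  rewrite ler_norml in h1; case/andP: h1 => h4 h5.
  set l := L A; set q := P A; set k := p * (1 - p) in h2 h3 *.
  have h6 := bias_sqr; have h7 := sqr_ge0 mu.
  have lq : `|mu * (l * q)| <= (l ^+ 2 + q ^+ 2) / 2.
    rewrite normrM; apply: (@le_trans _ _ `|l * q|).
      by rewrite ler_piMl// bias_abs.
    by rewrite ler_norml; have := sqr_ge0 (l - q); have := sqr_ge0 (l + q); lra.
  have l2 := sqr_ge0 l; have q2 := sqr_ge0 q.
  have m2 : 0 <= mu ^+ 2 * l ^+ 2 <= l ^+ 2 by rewrite mulr_ge0//= ler_piMl.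
  have k2 : 0 <= k * l ^+ 2 <= l ^+ 2 by rewrite mulr_ge0//= ler_piMl.
  rewrite ler_norml in lq; case/andP: lq => lq1 lq2; case/andP: m2 => *; case/andP: k2 => *.
  rewrite ler_norml; apply/andP; split; lra.
rewrite perm_expectZ perm_expectD.
have := expect_linpart_sqr; have := expect_quadpart_sqr.
have := degsum_ge0; have := deg_disp_ge0; rewrite /T; lra.
Qed.

(** Each edge contributes a term of the size of [t_i] or [S_i], hence the sum is
    at most that of [d_i |t_i|] and [d_i |S_i|]; as [d_i <= N], the inequality
    between arithmetic and geometric means extracts a factor [sqrt N]. *)
Lemma expect_carre_adjacent :
  E (fun A => `|carre_adjacent A|) <= N%:R * (26 * T / Num.sqrt N%:R).
Proof.
set s := Num.sqrt N%:R.
have s0 : 0 < s by rewrite sqrtr_gt0.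
have ss : s ^+ 2 = N%:R by rewrite sqr_sqrtr// ltW.
have s1 : 1 <= s.
  by have : 1 <= N%:R :> R by [rewrite ler1n ltnW|]; rewrite -ss; nra.
have amgm (u y : R) : 0 <= u -> u <= N%:R -> 0 <= y -> u * y <= N%:R * ((u + y ^+ 2) / (2 * s)).
  move=> u0 uN y0; rewrite -ss in uN *.
  have -> : s ^+ 2 * ((u + y ^+ 2) / (2 * s)) = s * (u + y ^+ 2) / 2.
    by field; exact: lt0r_neq0.
  have : u ^+ 2 <= s ^+ 2 * u by rewrite expr2; nra.
  have := sqr_ge0 (u - s * y); have : 0 <= u * y by nra.
  move=> h1 h2 h3.
  have h4 : 2 * s * (u * y) <= s ^+ 2 * (u + y ^+ 2) by lra.
  have : s * (u * y * 2 - s * (u + y ^+ 2)) <= 0 by lra.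
  by rewrite pmulr_rle0//; lra.
apply: (@le_trans _ _ (E (fun A => N%:R / s * \sum_i (9 * d i + 3 * t i ^+ 2 + 4 * S i A ^+ 2)))).
  apply: perm_expect_le => // A _; rewrite /carre_adjacent.
  apply: (@le_trans _ _ (\sum_i \sum_j a i j *
      (2 + (3 * `|t i| + 4 * `|S i A|) + (3 * `|t j| + 4 * `|S j A|)))).
    apply: le_trans (ler_norm_sum _ _ _) _; apply: ler_sum => i _.
    apply: le_trans (ler_norm_sum _ _ _) _; apply: ler_sum => j _.
    rewrite normrM (ger0_norm (adj_ge0 a01 i j)) ler_wpM2l ?adj_ge0//.
    apply: le_trans (ler_normB _ _) _; rewrite -[2 + _ + _]addrA; apply: lerD.
      rewrite normrM (ger0_norm (ler0n _ 2)) ler_piMr// ger0_norm ?sqr_ge0//.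
      exact: gap_sqr_le1.
    rewrite normrM; apply: (@le_trans _ _ `|3 * mu * (t i - t j) + 4 * (S i A - S j A)|).
      by rewrite ler_piMl// gap_abs_le1.
    apply: le_trans (ler_normD _ _) _; rewrite !normrM !(ger0_norm (ler0n _ _)).
    have := ler_normB (t i) (t j); have := ler_normB (S i A) (S j A).
    have := bias_abs; have := normr_ge0 (t i - t j); have := normr_ge0 mu; nra.
  rewrite (_ : \sum_i \sum_j _ = \sum_i d i * (2 + 6 * `|t i| + 8 * `|S i A|)); last first.
    pose y i := 1 + (3 * `|t i| + 4 * `|S i A|).
    transitivity (\sum_i \sum_j a i j * y i + \sum_i \sum_j a i j * y j).
      rewrite -big_split; apply: eq_bigr => i _ /=; rewrite -big_split.
      by apply: eq_bigr => j _ /=; rewrite /y; ring.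
    rewrite sum_adj_degree// -big_split; apply: eq_bigr => i _ /=.
    by rewrite -mulr_suml -/(d i) /y; ring.
  rewrite mulr_sumr; apply: ler_sum => i _.
  have h1 := amgm (d i) `|t i| (degree_ge0 a01 i).
  have h2 := amgm (d i) `|S i A| (degree_ge0 a01 i).
  have dN : d i <= N%:R by have := degree_le N2 a_diag a01 i; lra.
  rewrite !real_normK ?num_real// in h1 h2.
  have {h1} := h1 dN (normr_ge0 _); have {h2} := h2 dN (normr_ge0 _).
  have h3 : d i <= N%:R / s * d i.
    by rewrite ler_peMl ?degree_ge0// ler_pdivlMr// mul1r -ss expr2 ler_peMl// ltW.
  have e1 (y : R) : N%:R * ((d i + y) / (2 * s)) = N%:R / s * (d i + y) / 2.
    by field; exact: lt0r_neq0.
  rewrite !e1; set k := N%:R / s in h3 *; lra.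
rewrite perm_expectZ perm_expect_sum.
have -> : N%:R * (26 * T / s) = N%:R / s * (26 * T) by ring.
apply: ler_wpM2l; first by rewrite divr_ge0// ltW.
apply: (@le_trans _ _ (\sum_i (9 * d i + 3 * t i ^+ 2 + 4 * d i))).
  apply: ler_sum => i _; rewrite perm_expectD perm_expect_cst// perm_expectZ lerD2l ler_pM2l//.
  exact: expect_nbsum2.
rewrite !big_split /= -!mulr_sumr -/g2 -/V.
have := degsum_ge0; have := deg_disp_ge0; rewrite /T; lra.
Qed.

Lemma deg_scale_ge0 : 0 <= T.
Proof. by have := degsum_ge0; have := deg_disp_ge0; rewrite /T; lra. Qed.

Definition carre_rest A : R := carre_global A + carre_adjacent A.

Lemma expect_carre_rest : E (fun A => `|carre_rest A|) <= N%:R * (698 * T / Num.sqrt N%:R).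
Proof.
apply: (@le_trans _ _ (E (fun A => `|carre_global A| + `|carre_adjacent A|))).
  by apply: perm_expect_le => // A _; exact: ler_normD.
rewrite perm_expectD; apply: (@le_trans _ _ (672 * T + N%:R * (26 * T / Num.sqrt N%:R))).
  by apply: lerD; [exact: expect_carre_global|exact: expect_carre_adjacent].
set s := Num.sqrt N%:R.
have s0 : 0 < s by rewrite sqrtr_gt0.
have ss : s ^+ 2 = N%:R by rewrite sqr_sqrtr// ltW.
have s1 : 1 <= s.
  by have : 1 <= N%:R :> R by [rewrite ler1n ltnW|]; rewrite -ss; nra.
rewrite -ss (_ : s ^+ 2 * (26 * T / s) = s * (26 * T)); last by field; exact: lt0r_neq0.
rewrite (_ : s ^+ 2 * (698 * T / s) = s * (698 * T)); last by field; exact: lt0r_neq0.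
have := deg_scale_ge0; nra.
Qed.

Lemma expect_absdev_le (f : {set 'I_N} -> R) (k : R) : 0 <= k ->
  E (fun A => (f A - E f) ^+ 2) <= k ^+ 2 * B ->
  E (fun A => `|f A - E f|) <= k * Num.sqrt B.
Proof.
move=> k0 h; apply: le_trans (perm_expect_abs_le mN h) _.
by rewrite sqrtrM ?sqr_ge0// sqrtr_sqr ger0_norm.
Qed.

Lemma fluct_terms : [/\ \sum_k nb_centred_deg k ^+ 2 <= B,
  8 * (\sum_i \sum_l codegree a i l ^+ 2) + 2 * deg2 a <= 8 * B,
  deg2 a <= B, \sum_i t i ^+ 4 <= B & \sum_i t i ^+ 2 * d i <= B].
Proof.
have h1 : 0 <= \sum_k nb_centred_deg k ^+ 2 by apply: sumr_ge0 => i _; exact: sqr_ge0.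
have h2 : 0 <= \sum_i \sum_l codegree a i l ^+ 2.
  by do 2!(apply: sumr_ge0 => ? _); exact: sqr_ge0.
have h3 : 0 <= \sum_i t i ^+ 4 by apply: sumr_ge0 => i _; rewrite exprn_even_ge0.
have h4 : 0 <= \sum_i t i ^+ 2 * d i.
  by apply: sumr_ge0 => i _; rewrite mulr_ge0 ?sqr_ge0 ?degree_ge0.
have h5 := deg2_ge0; rewrite /B; split; lra.
Qed.

Lemma fluct_ge0 : 0 <= B.
Proof. by have [_ _ h _ _] := fluct_terms; apply: le_trans h; exact: deg2_ge0. Qed.

Lemma expect_carre_main : E carre_main = 4 * (p * (1 - p)) * (mu ^+ 2 * V + 2 * E sumsq) -
  2 * mu * (3 * mu * E (quad_form t) + 2 * E cubic).
Proof.
rewrite /carre_main perm_expectB !perm_expectZ !perm_expectD !perm_expectZ perm_expect_cst//.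
by rewrite !expect_linear_form//; ring.
Qed.

Lemma expect_carre_du_champ : E carre_du_champ = N%:R * E carre_main + E carre_rest.
Proof.
rewrite -perm_expectZ -perm_expectD; apply: perm_eq_expect => A cA; exact: carre_du_champE.
Qed.

Lemma carre_du_champ_absdev :
  E (fun A => `|carre_du_champ A - E carre_du_champ|) <= N%:R * (142 * Num.sqrt B + 1396 * T / Num.sqrt N%:R).
Proof.
pose f1 := linear_form nb_centred_deg; pose f2 := sumsq; pose f3 := linear_form (fun i => t i ^+ 2).
pose f4 := quad_form t; pose f5 := cubic.
pose D f A := `|f A - E f|.
apply: (@le_trans _ _ (E (fun A => N%:R * (12 * D f1 A + (8 * D f2 A + (2 * D f3 A +
    (6 * D f4 A + 4 * D f5 A)))) + (`|carre_rest A| + E (fun A => `|carre_rest A|))))).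
  apply: perm_expect_le => // A cA; rewrite expect_carre_du_champ carre_du_champE// -/(carre_rest A).
  have -> : N%:R * carre_main A + carre_rest A - (N%:R * E carre_main + E carre_rest) =
     N%:R * (carre_main A - E carre_main) + (carre_rest A - E carre_rest) by ring.
  apply: le_trans (ler_normD _ _) _; apply: lerD; last first.
    apply: le_trans (ler_normB _ _) _; rewrite lerD2l; exact: perm_expect_norm.
  rewrite normrM ger0_norm ?ler_pM2l// expect_carre_main /carre_main.
  have e1 : E f1 = 0 by exact: expect_linear_form.
  have e3 : E f3 = 0 by exact: expect_linear_form.
  rewrite /D e1 e3 !subr0 -/f1 -/f2 -/f3 -/f4 -/f5.
  set y1 := f1 A; set y2 := f2 A; set y3 := f3 A; set y4 := f4 A; set y5 := f5 A.
  have -> : 4 * (p * (1 - p)) * (mu ^+ 2 * V + 3 * mu * y1 + 2 * y2) -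
     2 * mu * (mu ^+ 2 * y3 + 3 * mu * y4 + 2 * y5) -
     (4 * (p * (1 - p)) * (mu ^+ 2 * V + 2 * E f2) - 2 * mu * (3 * mu * E f4 + 2 * E f5)) =
     12 * ((p * (1 - p) * mu) * y1) + (8 * (p * (1 - p) * (y2 - E f2)) +
     (- (2 * (mu ^+ 3 * y3)) + (- (6 * (mu ^+ 2 * (y4 - E f4))) - 4 * (mu * (y5 - E f5))))) by ring.
  have b1 := bias_abs; have b2 : `|mu ^+ 2| <= 1 by rewrite normrX expr_le1.
  have b3 : `|mu ^+ 3| <= 1 by rewrite normrX expr_le1.
  have k1 : `|p * (1 - p)| <= 1 by have /andP[h2 h3] := pq01 R mN; rewrite ger0_norm.
  have k2 : `|p * (1 - p) * mu| <= 1 by rewrite normrM mulr_ile1.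
  have small (c : R) (b z : R) : 0 <= c -> `|b| <= 1 -> `|c * (b * z)| <= c * `|z|.
    by move=> c0 b0; rewrite normrM (ger0_norm c0) ler_wpM2l// normrM ler_piMl.
  by do 4!(apply: le_trans (ler_normD _ _) _; apply: lerD; first by rewrite ?normrN small);
    rewrite normrN small.
rewrite perm_expectD perm_expectZ !perm_expectD !perm_expectZ perm_expect_cst// [leRHS]mulrDr.
have [q1 q2 q3 q4 q5] := fluct_terms.
have B0 := fluct_ge0.
have m1 : E (D f1) <= 1 * Num.sqrt B.
  apply: expect_absdev_le => //; rewrite perm_expect_sq// expect_linear_form// expr0n subr0 expr1n mul1r.
  by apply: le_trans (expect_linear_form_sqr mN N2 _) _.
have m2 : E (D f2) <= 3 * Num.sqrt B.
  apply: expect_absdev_le => //; apply: le_trans (var_sumsq mN N2 a_sym a01) _.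
  by apply: le_trans q2 _; lra.
have m3 : E (D f3) <= 1 * Num.sqrt B.
  apply: expect_absdev_le => //; rewrite perm_expect_sq// expect_linear_form// expr0n subr0 expr1n mul1r.
  apply: le_trans (expect_linear_form_sqr mN N2 _) _.
  by under eq_bigr do rewrite -exprM.
have m4 : E (D f4) <= 4 * Num.sqrt B.
  apply: expect_absdev_le => //; apply: le_trans (var_quad_form mN N2 a_sym a_diag a01 _) _; lra.
have m5 : E (D f5) <= 20 * Num.sqrt B.
  apply: expect_absdev_le => //; apply: le_trans (var_cubic mN N2 a_sym a_diag a01) _; lra.
apply: lerD.
  by rewrite ler_pM2l//; lra.
have := expect_carre_rest; rewrite (_ : 1396 * T / _ = 2 * (698 * T / Num.sqrt N%:R)); last by ring.
set w := 698 * T / _; lra.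
Qed.

(** The combination [2 p (1 - p) sumsq - mu * cubic] is the sum of the
    [S_i ^ 2] with weights [1 - p] or [p], according to the label of [i], and both
    are at least [p (1 - p)]; so the mean of the cubic form need not be known. *)
Lemma reduced_var_lower : p * (1 - p) * mu ^+ 2 * V +
  (p * (1 - p)) ^+ 2 * (g2 - deg2 a / (N%:R - 1)) - 175 * T / Num.sqrt N%:R <=
  E (fun A => (W A - E W) ^+ 2).
Proof.
set k := p * (1 - p).
have /andP[k0 k1] := pq01 R mN; rewrite -/k in k0 k1.
have low : 4 * k * E sumsq <= 8 * k * E sumsq - 4 * mu * E cubic.
  rewrite -!perm_expectZ -perm_expectB; apply: perm_expect_le => // A _.
  rewrite /sumsq /cubic !mulr_sumr -sumrB; apply: ler_sum => i _.
  have s0 := sqr_ge0 (S i A).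
  have -> : 8 * k * S i A ^+ 2 - 4 * mu * (x i A * S i A ^+ 2) =
     (8 * k - 4 * mu * x i A) * S i A ^+ 2 by ring.
  rewrite ler_wpM2r// /k /mu /centred_label.
  have /andP[p0 p1] := mean_label01 R mN.
  by case: (i \in A) => /=; nra.
have Eq : E (quad_form t) <= 0.
  rewrite expect_quad_form// sum_centred_deg_degree -/k mulNr mulNr oppr_le0.
  by rewrite mulr_ge0 ?deg_disp_ge0// divr_ge0// ltW.
have h1 : 4 * k * mu ^+ 2 * V + 4 * k * E sumsq <= E carre_main.
  rewrite expect_carre_main -/k; have := sqr_ge0 mu; nra.
have h2 := expect_sumsq mN N2 a01; rewrite -/k -/g2 in h2.
have h3 : - (N%:R * (698 * T / Num.sqrt N%:R)) <= E carre_rest.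
  rewrite lerNl; apply: le_trans expect_carre_rest.
  by apply: le_trans (perm_expect_norm m _); rewrite -normrN; exact: ler_norm.
set Y := deg2 a / _ in h2 *.
set Z := T / Num.sqrt N%:R.
have e1 : 698 * T / Num.sqrt N%:R = 698 * Z by rewrite /Z mulrA.
have e2 : 175 * T / Num.sqrt N%:R = 175 * Z by rewrite /Z mulrA.
have Z0 : 0 <= Z by rewrite divr_ge0 ?deg_scale_ge0 ?sqrtr_ge0.
rewrite e1 in h3; rewrite e2.
have h4 : N%:R * (4 * (k * mu ^+ 2 * V + k ^+ 2 * (g2 - Y) - 175 * Z)) <= E carre_du_champ.
  rewrite expect_carre_du_champ.
  have : k * (k * (g2 - Y)) <= k * E sumsq by rewrite ler_wpM2l.
  set q := k ^+ 2 * _; have -> : k * (k * (g2 - Y)) = q by rewrite /q; ring.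
  move=> h5; have h6 : 4 * (k * mu ^+ 2 * V + q) <= E carre_main by lra.
  have : N%:R * (4 * (k * mu ^+ 2 * V + q)) <= N%:R * E carre_main by rewrite ler_pM2l.
  have : 0 <= N%:R * Z by rewrite mulr_ge0.
  lra.
have v0 : 0 <= E (fun A => (W A - E W) ^+ 2) by apply: perm_expect_ge0 => // A _; exact: sqr_ge0.
have h7 := var_reduced_count; set v := E _ in v0 h7 *.
have h8 : E carre_du_champ = 4 * (N%:R - 1) * v.
  by rewrite h7; field; exact: lt0r_neq0.
set q := _ - _ in h4 *.
have h9 : 4 * N%:R * q <= 4 * N%:R * v.
  by rewrite h8 in h4; have := N0; lra.
by rewrite ler_pM2l// in h9; rewrite mulr_gt0.
Qed.

Definition centred_deg3 : R := \sum_i `|t i| ^+ 3.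

(** Both increments are bounded by [y i + y j + 2 a i j], where [y] involves the
    centred degree and the neighbour sum of one node; cubes of neighbour sums are
    bounded by the average of second and fourth powers. *)
Lemma third_moment :
  E (fun A => \sum_i \sum_j `|swap_diff i j F A| * swap_diff i j W A ^+ 2) <=
  72 * N%:R * (centred_deg3 + 29 * deg2 a).
Proof.
pose h i A := 4 * `|t i| ^+ 3 + 16 * (S i A ^+ 2 + S i A ^+ 4).
have dsum (y : 'I_N -> R) : \sum_i \sum_j 9 * (y i + y j + 8 * a i j) =
    9 * (2 * N%:R * (\sum_i y i) + 8 * g2).
  transitivity (\sum_i 9 * (N%:R * y i + \sum_j y j + 8 * d i)).
    apply: eq_bigr => i _; rewrite -mulr_sumr !big_split /= sumr_const card_ord.
    by rewrite -mulr_sumr -[_ *+ N]mulr_natl.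
  rewrite -mulr_sumr !big_split /= -!mulr_sumr sumr_const card_ord -/g2 -[_ *+ N]mulr_natl.
  by ring.
apply: (@le_trans _ _ (E (fun A => 9 * ((2 * N%:R) * \sum_i h i A + 8 * g2)))).
  apply: perm_expect_le => // A _.
  apply: (@le_trans _ _ (\sum_i \sum_j 9 * (h i A + h j A + 8 * a i j))).
    apply: ler_sum => i _; apply: ler_sum => j _.
    have cube2 (u v : R) : 0 <= u -> 0 <= v -> (u + v) ^+ 3 <= 4 * (u ^+ 3 + v ^+ 3).
      move=> u0 v0; rewrite -subr_ge0.
      rewrite (_ : _ - _ = 3 * (u + v) * (u - v) ^+ 2); last by ring.
      by repeat first [exact: sqr_ge0 | done | apply: mulr_ge0 | apply: addr_ge0].
    have cube3 (u v w : R) : 0 <= u -> 0 <= v -> 0 <= w ->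
        (u + v + w) ^+ 3 <= 9 * (u ^+ 3 + v ^+ 3 + w ^+ 3).
      move=> u0 v0 w0; rewrite -subr_ge0.
      rewrite (_ : _ - _ = (u + v) * (u - v) ^+ 2 * 3 + (v + w) * (v - w) ^+ 2 * 3 +
         (u + w) * (u - w) ^+ 2 * 3 + (u + v + w) * ((u - v) ^+ 2 + (v - w) ^+ 2 + (u - w) ^+ 2)).
        by repeat first [exact: sqr_ge0 | done | apply: mulr_ge0 | apply: addr_ge0].
      by ring.
    have t0 k : 0 <= `|t k| by [].
    have S0 k : 0 <= `|S k A| by [].
    have a0 := adj_ge0 a01 i j.
    pose y k := `|t k| + 2 * `|S k A|.
    have y0 k : 0 <= y k by rewrite addr_ge0// mulr_ge0.
    have y3 k : y k ^+ 3 <= h k A.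
      apply: le_trans (cube2 _ _ (t0 k) _) _; first by rewrite mulr_ge0.
      rewrite /h exprMn.
      have : `|S k A| ^+ 3 <= (S k A ^+ 2 + S k A ^+ 4) / 2.
        rewrite -(real_normK (num_real (S k A))) (_ : S k A ^+ 4 = `|S k A| ^+ 4); last first.
          by rewrite -normrX ger0_norm// exprn_even_ge0.
        have := sqr_ge0 (`|S k A| * (1 - `|S k A|)); lra.
      by lra.
    have b1 : `|swap_diff i j F A| <= y i + y j + 2 * a i j.
      rewrite potential_diff; apply: le_trans (ler_normB _ _) _; apply: lerD; last first.
        rewrite normrM (ger0_norm a0) ger0_norm ?sqr_ge0//.
        by have := gap_sqr_le1 R m i j A; have := sqr_ge0 (e i j A); nra.
      rewrite normrM; apply: (@le_trans _ _ `|mu * t i + S i A - (mu * t j + S j A)|).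
        by rewrite ler_piMl// gap_abs_le1.
      apply: le_trans (ler_normB _ _) _; apply: lerD; apply: le_trans (ler_normD _ _) _;
      rewrite normrM /y; apply: lerD; first [by rewrite ler_piMl// bias_abs | by rewrite ler_peMl// ler1n].
    have b2 : `|swap_diff i j W A| <= y i + y j + 2 * a i j.
      rewrite reduced_count_diff; apply: le_trans (ler_normB _ _) _; apply: lerD; last first.
        rewrite !normrM (ger0_norm a0) (ger0_norm (ler0n _ 2)).
        rewrite ler_piMr ?mulr_ge0// -normrM -expr2 ger0_norm ?sqr_ge0//.
        exact: gap_sqr_le1.
      rewrite normrM; apply: (@le_trans _ _ `|mu * t i + 2 * S i A - (mu * t j + 2 * S j A)|).
        by rewrite ler_piMl// gap_abs_le1.
      by apply: le_trans (ler_normB _ _) _; apply: lerD; apply: le_trans (ler_normD _ _) _;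
      rewrite !normrM (ger0_norm (ler0n _ 2)) /y lerD2r ler_piMl// bias_abs.
    apply: (@le_trans _ _ ((y i + y j + 2 * a i j) ^+ 3)).
      rewrite -(real_normK (num_real (swap_diff i j W A))) [leRHS]exprS.
      by apply: ler_pM => //; rewrite ?sqr_ge0// lerXn2r// nnegrE// !addr_ge0// mulr_ge0.
    apply: le_trans (cube3 _ _ _ _ _ _) _ => //; first by rewrite mulr_ge0.
    have a3 : (2 * a i j) ^+ 3 = 8 * a i j by case: (a01 i j) => ->; ring.
    by rewrite a3 ler_pM2l// lerD// lerD.
  by rewrite (dsum (h^~ A)).
rewrite perm_expectZ perm_expectD perm_expect_cst// perm_expectZ perm_expect_sum.
have dd : g2 <= deg2 a by apply: ler_sum => i _; exact: degree_sqr.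
have d0 := deg2_ge0.
have : \sum_i E (h i) <= 4 * centred_deg3 + 112 * deg2 a.
  rewrite /centred_deg3 /deg2 !mulr_sumr -big_split; apply: ler_sum => i _ /=.
  rewrite perm_expectD perm_expect_cst// lerD2l perm_expectZ perm_expectD.
  have := expect_nbsum2 mN N2 a01 i; have := expect_nbsum4 mN N2 a01 i.
  have := degree_sqr a01 i; lra.
set X := \sum_i E (h i); move=> hX.
have : N%:R * X <= N%:R * (4 * centred_deg3 + 112 * deg2 a) by rewrite ler_pM2l.
have : deg2 a <= N%:R * deg2 a by rewrite ler_peMl// ler1n ltnW.
lra.
Qed.

Lemma taylor2 (f f' : R -> R) (K : R) : (forall z : R, is_derive z 1 f (f' z)) ->
  (forall z w, `|f' z - f' w| <= K * `|z - w|) ->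
  forall u w, `|f u - f w - f' w * (u - w)| <= K * (u - w) ^+ 2.
Proof.
move=> fd fl u w.
have K0 : 0 <= K by have := fl 1 0; rewrite subr0 normr1 mulr1; apply: le_trans.
have [c hc cb] : exists2 c, f u - f w = f' c * (u - w) & `|c - w| <= `|u - w|.
  have [uw|wu] := leP u w.
    have [c] := MVT_derivable fd uw; rewrite in_itv/= => /andP[h1 h2] E1; exists c.
      by rewrite -[LHS]opprB E1; ring.
    by rewrite !ler0_norm ?subr_le0//; lra.
  have [c] := MVT_derivable fd (ltW wu); rewrite in_itv/= => /andP[h1 h2] E1; exists c => //.
  by rewrite !ger0_norm ?subr_ge0//; lra.
rewrite hc -mulrBl normrM -(real_normK (num_real (u - w))) expr2 mulrA ler_wpM2r//.
by apply: le_trans (fl _ _) _; rewrite ler_wpM2l.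
Qed.

Definition reduced_var : R := E (fun A => (W A - E W) ^+ 2).
Definition zscore A : R := (W A - E W) / Num.sqrt reduced_var.

(** The increment of [f (Z)] is [f' (Z)] times that of [Z] up to a second-order
    error.  The main term is the covariance of [f' (Z)] with the carre du champ,
    whose mean is exactly the normalisation; the error is bounded by the third
    moment. *)
Lemma stein_bound (f f' : R -> R) (K : R) :
  (forall z : R, is_derive z 1 f (f' z)) ->
  (forall z, `|f' z| <= K) ->
  (forall z w, `|f' z - f' w| <= K * `|z - w|) ->
  0 < reduced_var ->
  `|E (fun A => f' (zscore A) - zscore A * f (zscore A))| <=
  K * ((142 * Num.sqrt B + 1396 * T / Num.sqrt N%:R) / (2 * reduced_var) +
       36 * (centred_deg3 + 29 * deg2 a) / Num.sqrt reduced_var ^+ 3).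
Proof.
move=> fd fb fl; pose Z := zscore; rewrite -/Z.
have vE : reduced_var = E (fun A => (W A - E W) ^+ 2) by [].
have ZE A : Z A = (W A - E W) / Num.sqrt reduced_var by [].
move: reduced_var vE ZE => v vE ZE v0; set s := Num.sqrt v in ZE *.
have s0 : 0 < s by rewrite sqrtr_gt0.
have ss : s ^+ 2 = v by rewrite sqr_sqrtr// ltW.
have sn : s != 0 by rewrite lt0r_neq0.
have K0 : 0 <= K by apply: le_trans (fb 0).
have n1 : N%:R - 1 != 0 :> R by rewrite lt0r_neq0.
set M : R := 4 * (N%:R - 1).
have M0 : 0 < M by rewrite mulr_gt0.
have Mn : M != 0 by rewrite lt0r_neq0.
have Mv : E carre_du_champ = M * v.
  by rewrite vE var_reduced_count mulrA divff ?mul1r.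
pose r i j A := swap_diff i j (f \o Z) A - f' (Z A) * (swap_diff i j W A / s).
have rb i j A : `|r i j A| <= K * (swap_diff i j W A ^+ 2 / v).
  have ZZ : Z (swap i j A) - Z A = swap_diff i j W A / s by rewrite !ZE /swap_diff; ring.
  have := taylor2 fd fl (Z (swap i j A)) (Z A).
  by rewrite ZZ exprMn exprVn ss.
have E1 : E (fun A => Z A * f (Z A)) =
   (M * v)^-1 * E (fun A => f' (Z A) * carre_du_champ A) +
   (M * s)^-1 * E (fun A => \sum_i \sum_j swap_diff i j F A * r i j A).
  rewrite (_ : (fun A => Z A * f (Z A)) = (fun A => s^-1 * ((W A - E W) * (f \o Z) A))); last first.
    by apply/funext => A; rewrite [(f \o Z) A]/= {1}ZE; move: (f (Z A)) => y; ring.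
  rewrite perm_expectZ stein_ibp -/M.
  rewrite (_ : (fun A => \sum_i \sum_j swap_diff i j F A * swap_diff i j (f \o Z) A) =
    (fun A => s^-1 * (f' (Z A) * carre_du_champ A) + \sum_i \sum_j swap_diff i j F A * r i j A)).
    by rewrite perm_expectD perm_expectZ -ss; field; rewrite sn Mn.
  apply/funext => A; rewrite /carre_du_champ !mulr_sumr -big_split; apply: eq_bigr => i _ /=.
  rewrite !mulr_sumr -big_split; apply: eq_bigr => j _ /=; rewrite /r; ring.
have E2 : E (fun A => f' (Z A) - Z A * f (Z A)) =
  - ((M * v)^-1 * E (fun A => f' (Z A) * (carre_du_champ A - E carre_du_champ))) -
   (M * s)^-1 * E (fun A => \sum_i \sum_j swap_diff i j F A * r i j A).
  rewrite perm_expectB E1.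
  rewrite (_ : (fun A => f' (Z A) * (carre_du_champ A - E carre_du_champ)) =
    (fun A => f' (Z A) * carre_du_champ A - (M * v) * f' (Z A))); last first.
    by apply/funext => A; rewrite Mv; ring.
  rewrite perm_expectB perm_expectZ; field.
  by rewrite sn Mn lt0r_neq0.
have Mv0 : 0 < M * v by rewrite mulr_gt0.
have Ms0 : 0 < M * s by rewrite mulr_gt0.
have N2' : N%:R <= 2 * (N%:R - 1) :> R by have : 2 <= N%:R :> R by [rewrite ler_nat|]; lra.
rewrite E2 mulrDr; apply: le_trans (ler_normB _ _) _; rewrite normrN; apply: lerD.
  rewrite normrM gtr0_norm ?invr_gt0//.
  have h1 : `|E (fun A => f' (Z A) * (carre_du_champ A - E carre_du_champ))| <= K * (N%:R * (142 * Num.sqrt B + 1396 * T / Num.sqrt N%:R)).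
    apply: le_trans (perm_expect_norm m _) _.
    apply: (@le_trans _ _ (E (fun A => K * `|carre_du_champ A - E carre_du_champ|))).
      by apply: perm_expect_le => // A _; rewrite normrM ler_wpM2r.
    by rewrite perm_expectZ ler_wpM2l// carre_du_champ_absdev.
  rewrite mulrC ler_pdivrMr//; apply: le_trans h1 _; rewrite -[leRHS]mulrA ler_wpM2l//.
  have q0 : 0 <= 142 * Num.sqrt B + 1396 * T / Num.sqrt N%:R.
    have h2 : 0 <= 1396 * T / Num.sqrt N%:R.
      by exact: (divr_ge0 (mulr_ge0 (ler0n R 1396) deg_scale_ge0) (sqrtr_ge0 _)).
    by exact: (addr_ge0 (mulr_ge0 (ler0n R 142) (sqrtr_ge0 _)) h2).
  set q := 142 * _ + _ in q0 *.
  have -> : q / (2 * v) * (M * v) = q * (2 * (N%:R - 1)).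
    by rewrite /M; field; rewrite lt0r_neq0.
  by rewrite mulrC ler_wpM2l.
rewrite normrM gtr0_norm ?invr_gt0//.
have h1 : `|E (fun A => \sum_i \sum_j swap_diff i j F A * r i j A)| <= K / v * (72 * N%:R * (centred_deg3 + 29 * deg2 a)).
  apply: le_trans (perm_expect_norm m _) _.
  apply: (@le_trans _ _ (E (fun A => K / v * \sum_i \sum_j `|swap_diff i j F A| * swap_diff i j W A ^+ 2))).
    apply: perm_expect_le => // A _; rewrite mulr_sumr.
    apply: le_trans (ler_norm_sum _ _ _) _; apply: ler_sum => i _; rewrite mulr_sumr.
    apply: le_trans (ler_norm_sum _ _ _) _; apply: ler_sum => j _.
    rewrite normrM mulrCA ler_wpM2l//; apply: le_trans (rb i j A) _.
    by rewrite -[leRHS]mulrA [_^-1 * _]mulrC.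
  rewrite perm_expectZ ler_wpM2l ?third_moment// divr_ge0// ltW//.
rewrite mulrC ler_pdivrMr//; apply: le_trans h1 _.
have q0 : 0 <= centred_deg3 + 29 * deg2 a.
  by rewrite addr_ge0 ?mulr_ge0 ?deg2_ge0//; apply: sumr_ge0 => i _; rewrite exprn_ge0.
set q := centred_deg3 + _ in q0 *.
have -> : K * (36 * q / s ^+ 3) * (M * s) = K / v * (72 * (2 * (N%:R - 1)) * q).
  by rewrite /M -ss; field.
apply: ler_wpM2l; first by rewrite divr_ge0// ltW.
by apply: ler_wpM2r => //; apply: ler_wpM2l.
Qed.

End SteinStatistic.

(** * The edge-count statistic as a label polynomial *)

Section Adjacency.
Variables (R : realType) (N : nat) (G : {set {set 'I_N}}).
Hypothesis Gsimple : simple_graph G.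
Implicit Types (i j k : 'I_N) (A : {set 'I_N}).

Definition adjacency i j : R := ((i != j) && ([set i; j]%SET \in G))%:R.
Local Notation a := adjacency.

Lemma adjacency_sym i j : a i j = a j i.
Proof. by rewrite /a eq_sym finset.setUC. Qed.

Lemma adjacency_diag i : a i i = 0.
Proof. by rewrite /a eqxx. Qed.

Lemma adjacency01 i j : a i j = 0 \/ a i j = 1.
Proof. by rewrite /a; case: (_ && _); [right|left]. Qed.

Lemma edge_pair (E : {set 'I_N}) i j : E \in G -> i \in E -> j \in E -> i != j ->
  E = [set i; j]%SET.
Proof.
move=> EG iE jE ij; apply/eqP; rewrite eq_sym eqEcard (Gsimple EG) cards2 ij leqnn andbT.
by apply/fintype.subsetP => k; rewrite !inE => /orP[] /eqP->.
Qed.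

(** An edge of two elements is determined by them, so at most one term is
    nonzero.  This is the bridge between sums over edges and sums over ordered
    pairs of nodes. *)
Lemma adjacency_sum i j : a i j = \sum_(E in G) ((i != j) && (i \in E) && (j \in E))%:R.
Proof.
rewrite /a; case: (eqVneq i j) => [->|ij] /=; first by rewrite big1.
case: (boolP ([set i; j]%SET \in G)) => [ijG|ijG].
  rewrite (bigD1 _ ijG) /= !inE !eqxx orbT big1 ?addr0// => E /andP[EG Eij].
  case iE: (i \in E) => //; case jE: (j \in E) => //=.
  by rewrite (edge_pair EG iE jE ij) eqxx in Eij.
rewrite big1// => E EG; case iE: (i \in E) => //; case jE: (j \in E) => //=.
by have := EG; rewrite (edge_pair EG iE jE ij) (negbTE ijG).
Qed.

Lemma degree_adjacency i : degree a i = #|edges_at G i|%:R.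
Proof.
rewrite /degree (eq_bigr _ (fun j _ => adjacency_sum i j)) exchange_big /=.
rewrite /edges_at -sum1_card natr_sum [RHS](eq_bigl (fun E => (E \in G) && (i \in E))); last first.
  by move=> E; rewrite inE.
rewrite big_mkcondr; apply: eq_bigr => E EG.
case iE: (i \in E); last by rewrite big1// => j _; rewrite andbF.
have : (#|E :\ i| = 1)%N by have := Gsimple EG; rewrite (cardsD1 i) iE => -[].
move=> <-; rewrite -sum1_card natr_sum [RHS]big_mkcond; apply: eq_bigr => j _.
by rewrite !inE andbT eq_sym; case: (_ && _).
Qed.

Lemma neighboursE i j : (j \in neighbours G i)%:R = a i j.
Proof. by rewrite inE /a eq_sym. Qed.

Lemma sum_adjacency (F : 'I_N -> 'I_N -> R) : (forall i j, F i j = F j i) ->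
  \sum_i \sum_j a i j * F i j = \sum_(E in G) \sum_(i in E) \sum_(j in E :\ i) F i j.
Proof.
move=> Fs.
transitivity (\sum_i \sum_j \sum_(E in G) ((i != j) && (i \in E) && (j \in E))%:R * F i j).
  by apply: eq_bigr => i _; apply: eq_bigr => j _; rewrite adjacency_sum mulr_suml.
under eq_bigr do rewrite exchange_big /=.
rewrite exchange_big; apply: eq_bigr => E _ /=.
rewrite [RHS]big_mkcond; apply: eq_bigr => i _; case: ifP => iE.
  rewrite [RHS]big_mkcond; apply: eq_bigr => j _; rewrite !inE andbT eq_sym.
  by case: (_ && _); rewrite ?mul1r ?mul0r.
by rewrite big1// => j _; rewrite andbF mul0r.
Qed.

Lemma degsum_adjacency : degsum a = 2 * #|G|%:R.
Proof.
transitivity (\sum_i \sum_j a i j * 1).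
  by apply: eq_bigr => i _; apply: eq_bigr => j _; rewrite mulr1.
rewrite sum_adjacency// -sum1_card natr_sum mulr_sumr; apply: eq_bigr => E EG.
rewrite (eq_bigr (fun=> 1)) => [|i iE].
  by rewrite sumr_const (Gsimple EG) mulr1.
have : (#|E :\ i| = 1)%N by have := Gsimple EG; rewrite (cardsD1 i) iE => -[].
by rewrite sumr_const => ->.
Qed.

Lemma centred_deg_adjacency i : centred_deg a i = centered_degree R G i.
Proof. by rewrite /centred_deg degree_adjacency degsum_adjacency. Qed.

Lemma deg_disp_adjacency : deg_disp a = degree_dispersion R G.
Proof. by apply: eq_bigr => i _; rewrite centred_deg_adjacency. Qed.

Lemma deg_scale_adjacency : deg_scale a = scaleT R G.
Proof. by rewrite /deg_scale /scaleT deg_disp_adjacency degsum_adjacency mulrAC divff ?mul1r. Qed.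

Lemma sum_neighbour_pairs :
  \sum_(i < N) \sum_(j in neighbours G i) \sum_(k in neighbours G i | j != k)
     centered_degree R G j * centered_degree R G k =
  \sum_k nb_centred_deg a k ^+ 2 - \sum_i centred_deg a i ^+ 2 * degree a i.
Proof.
have -> : \sum_i centred_deg a i ^+ 2 * degree a i = \sum_k \sum_i a k i * centred_deg a i ^+ 2.
  by rewrite (sum_adj_degree adjacency_sym).
rewrite -sumrB; apply: eq_bigr => i _.
have -> : nb_centred_deg a i = \sum_j a i j * centred_deg a j.
  by apply: eq_bigr => j _; rewrite adjacency_sym mulrC.
rewrite expr2 mulr_suml -sumrB big_mkcond; apply: eq_bigr => j _.
have -> : forall (b : bool) (y : R), (if b then y else 0) = b%:R * y.
  by case=> y; rewrite ?mul1r ?mul0r.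
rewrite neighboursE.
have -> : a i j * centred_deg a j * (\sum_k a i k * centred_deg a k) - a i j * centred_deg a j ^+ 2 =
    a i j * \sum_(k | k != j) a i k * (centred_deg a j * centred_deg a k).
  rewrite (bigD1 j)//= mulrDr; have -> : a i j * centred_deg a j * (a i j * centred_deg a j) = a i j * centred_deg a j ^+ 2.
    by case: (adjacency01 i j) => ->; ring.
  rewrite addrAC subrr add0r -mulrA; congr (_ * _); rewrite mulr_sumr.
  by apply: eq_bigr => k _; ring.
congr (_ * _); rewrite [LHS]big_mkcond [RHS]big_mkcond; apply: eq_bigr => k _.
rewrite -!centred_deg_adjacency -(neighboursE i k) [j == k]eq_sym andbC; case: (k != j) => //=.
by case: ifP => _; rewrite ?mul1r ?mul0r.
Qed.

Variable m : nat.
Hypothesis mN : (m <= N)%N.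
Hypothesis N2 : (1 < N)%N.
Local Notation Ep := (@perm_expectation R N m).

Lemma within_total_gap A :
  within_total R G A = \sum_(E in G) (if [forall i in E, forall j in E, (i \in A) == (j \in A)] then 1 else 0).
Proof.
have h l : (within_count G l A)%:R = \sum_(E in G) (if [forall i in E, perm_label A i == l] then 1 else 0 : R).
  rewrite /within_count -sum1_card natr_sum (eq_bigl (fun E => (E \in G) && [forall i in E, perm_label A i == l])).
    by rewrite big_mkcondr.
  by move=> E; rewrite inE.
rewrite /within_total !h -big_split; apply: eq_bigr => E EG /=.
have [i iE] : exists i, i \in E by apply/card_gt0P; rewrite (Gsimple EG).
have e1 : [forall i in E, perm_label A i == 1%N] = [forall j in E, j \in A].
  by apply: eq_forallb => k; rewrite /perm_label; case: (k \in A); rewrite ?implybT.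
have e2 : [forall i in E, perm_label A i == 2%N] = [forall j in E, j \notin A].
  by apply: eq_forallb => k; rewrite /perm_label; case: (k \in A); rewrite ?implybT.
rewrite e1 e2; case: ifP => [/forall_inP h1|/negbT h1].
  rewrite ifF; last by apply/negP => /forall_inP/(_ _ iE); rewrite h1.
  rewrite ifT ?addr0//; apply/forall_inP => j jE; apply/forall_inP => k kE.
  by rewrite !h1.
case: ifP => [/forall_inP h2|/negbT h2].
  rewrite ifT ?add0r//; apply/forall_inP => j jE; apply/forall_inP => k kE.
  by rewrite (negbTE (h2 _ jE)) (negbTE (h2 _ kE)).
rewrite ifF ?addr0//; apply/negP => /forall_inP h3.
case iA: (i \in A).
  by move/negP: h1; apply; apply/forall_inP => j jE; have /forall_inP/(_ _ jE) := h3 _ iE; rewrite iA => /eqP <-.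
by move/negP: h2; apply; apply/forall_inP => j jE; have /forall_inP/(_ _ jE) := h3 _ iE; rewrite iA => /eqP <-.
Qed.

(** An edge is counted exactly when the gap of the labels of its ends vanishes,
    and the gap is 0, 1 or -1. *)
Lemma within_total_reduced : exists c : R, forall A, #|A| = m ->
  within_total R G A = reduced_count m a A + c.
Proof.
pose p := mean_label R N m.
exists (degsum a / 2 - p * (1 - p) * degsum a) => A cA.
have key : 2 * within_total R G A = \sum_i \sum_j a i j * (1 - label_gap R m i j A ^+ 2).
  rewrite sum_adjacency => [|i j]; last by rewrite /label_gap -sqrrN opprB.
  rewrite within_total_gap mulr_sumr; apply: eq_bigr => E EG.
  have /cards2P[u [v [uv Euv]]] : #|E| == 2%N by rewrite (Gsimple EG).
  have -> : [forall i in E, forall j in E, (i \in A) == (j \in A)] = ((u \in A) == (v \in A)).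
    rewrite Euv; apply/forall_inP/idP => [h|/eqP h i].
      by have /forall_inP := h u (set21 _ _); apply; rewrite set22.
    rewrite !inE => /orP[] /eqP ->; apply/forall_inP => j; rewrite !inE => /orP[] /eqP ->;
    by rewrite ?h.
  rewrite Euv big_setU1 ?inE//= big_set1.
  have -> : ([set u; v] :\ u)%SET = [set v]%SET.
    by apply/setP => k; rewrite !inE; case: (eqVneq k u) => [->|] //=; rewrite (negbTE uv).
  have -> : ([set u; v] :\ v)%SET = [set u]%SET.
    by apply/setP => k; rewrite !inE; case: (eqVneq k v) => [->|] //=; rewrite ?orbF// eq_sym (negbTE uv).
  rewrite !big_set1 /label_gap /centred_label; do 2 case: (_ \in A) => /=; ring.
have h := sum_adj_gap mN adjacency_sym cA.
have e1 : \sum_i \sum_j a i j * (1 - label_gap R m i j A ^+ 2) =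
   degsum a - \sum_i \sum_j a i j * label_gap R m i j A ^+ 2.
  rewrite /degsum -sumrB; apply: eq_bigr => i _; rewrite /degree -sumrB.
  by apply: eq_bigr => j _; ring.
move: key; rewrite e1 h /reduced_count -/p => key.
by apply: (@mulfI _ 2) => //; rewrite key; field.
Qed.

Lemma edge_count_stat_zscore A : #|A| = m ->
  edge_count_stat R m G A = zscore m a A.
Proof.
have [c h] := within_total_reduced => cA.
have Em : Ep (within_total R G) = Ep (reduced_count m a) + c.
  by rewrite -(perm_expect_cst mN c) -perm_expectD; exact: perm_eq_expect.
have Vm : perm_variance m (within_total R G) = reduced_var m a.
  rewrite /perm_variance /reduced_var Em; apply: perm_eq_expect => B cB.
  by rewrite h//; congr (_ ^+ 2); ring.
rewrite /edge_count_stat /zscore Vm Em h//; congr (_ / _); ring.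
Qed.

End Adjacency.

(** * Rates in terms of the edge count and the degrees *)

Section Rates.
Variables (R : realType) (N m : nat).
Hypothesis mN : (m <= N)%N.
Hypothesis N2 : (1 < N)%N.
Variable a : 'I_N -> 'I_N -> R.
Hypothesis a_sym : forall i j, a i j = a j i.
Hypothesis a_diag : forall i, a i i = 0.
Hypothesis a01 : forall i j, a i j = 0 \/ a i j = 1.
Local Notation g2 := (degsum a).
Local Notation V := (deg_disp a).
Local Notation T := (deg_scale a).
Local Notation t := (centred_deg a).
Local Notation d := (degree a).
Local Notation k := (mean_label R N m * (1 - mean_label R N m)).

Let N0 : 0 < N%:R :> R. Proof. by rewrite ltr0n ltnW. Qed.
Let N1 : 0 < N%:R - 1 :> R. Proof. by rewrite subr_gt0 ltr1n. Qed.
Let g0 : 0 <= g2. Proof. exact: degsum_ge0. Qed.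
Let V0 : 0 <= V. Proof. exact: deg_disp_ge0. Qed.

(** Without edges all centred degrees vanish, and so does [T]. *)
Lemma deg_scale_ge_half : T != 0 -> 1 / 2 <= T.
Proof.
move=> T0; case: (pickP (fun i => d i != 0)) => [i di|d0].
  have d1 : 1 <= d i.
    have := degree_sqr a01 i; have := degree_ge0 a01 i; rewrite le_eqVlt => /orP[/eqP e|h1 h2].
      by rewrite -e eqxx in di.
    by rewrite -(ler_pM2l h1) mulr1 -expr2.
  have : d i <= g2.
    by rewrite /degsum (bigD1 i)//= lerDl; apply: sumr_ge0 => j _; exact: degree_ge0.
  rewrite /deg_scale; have := V0; lra.
have dz i : d i = 0 by have /negbFE/eqP := d0 i.
have gz : g2 = 0 by rewrite /degsum big1.
have Vz : V = 0.
  by rewrite /deg_disp big1// => i _; rewrite /centred_deg dz gz mul0r subrr expr0n.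
by rewrite /deg_scale gz Vz mul0r addr0 eqxx in T0.
Qed.

(** Here [s] is the square root of [T]; the numbers [e1], [e2] and [e3] are the
    quotients that the three hypotheses of the limit theorem send to 0, and [z]
    is, up to a factor 2, the quotient of the number of edges by [N * s]. *)
Variables (s e1 e2 e3 z : R).
Hypothesis s0 : 0 < s.
Hypothesis sT : s ^+ 2 = T.
Hypothesis Tge : 1 / 2 <= T.
Hypothesis De : deg2 a = e1 * s ^+ 3.
Hypothesis Ce : centred_deg3 a = e2 * s ^+ 3.
Hypothesis He : \sum_i nb_centred_deg a i ^+ 2 - \sum_i t i ^+ 2 * d i = e3 * s ^+ 4.
Hypothesis ze : g2 = z * (N%:R * s).

Let e10 : 0 <= e1.
Proof. by rewrite -(pmulr_lge0 _ (exprn_gt0 3 s0)) -De deg2_ge0. Qed.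
Let e20 : 0 <= e2.
Proof.
rewrite -(pmulr_lge0 _ (exprn_gt0 3 s0)) -Ce.
by apply: sumr_ge0 => i _; rewrite exprn_ge0.
Qed.

Lemma edge_density_ge0 : 0 <= z.
Proof. by rewrite -(pmulr_lge0 _ (mulr_gt0 N0 s0)) -ze. Qed.

(** The Cauchy-Schwarz inequality gives [g2 ^ 2 <= N * deg2], and
    [g2 <= N ^ 2] because the graph is simple; their product is the bound. *)
Lemma edge_density_cube : z ^+ 3 <= e1.
Proof.
have h1 : g2 ^+ 2 <= N%:R * (e1 * s ^+ 3).
  rewrite -De (deg2E N2 a) mulrDr; have -> : N%:R * (g2 ^+ 2 / N%:R) = g2 ^+ 2.
    by field; exact: lt0r_neq0.
  by rewrite lerDr (mulr_ge0 (ltW N0) V0).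
have h2 : g2 <= N%:R ^+ 2.
  by apply: le_trans (degsum_le N2 a_diag a01) _; rewrite expr2 ler_pM2l//; lra.
have h3 : g2 ^+ 3 <= N%:R ^+ 2 * (N%:R * (e1 * s ^+ 3)).
  by rewrite exprS; apply: ler_pM => //; rewrite sqr_ge0.
have Ns : 0 < (N%:R * s) ^+ 3 by rewrite exprn_gt0// mulr_gt0.
rewrite -(ler_pM2r Ns) -exprMn -ze; apply: le_trans h3 _.
by rewrite le_eqVlt; apply/orP; left; apply/eqP; ring.
Qed.

(** The powers of [s] in excess come from [|t_i| <= s], from
    [sqrt g2 <= 2 s] and from [d i = t i + z * s], the latter turning
    [t_i ^ 2 d_i] into a third power of [t_i] and a square. *)
Lemma fluct_le : fluct a <= s ^+ 4 * (e3 + 4 * (e2 + z) + 4 * e1 + e2).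
Proof.
have s12 : 1 / 2 <= s.
  rewrite leNgt; apply/negP => h; move: Tge; rewrite -sT leNgt => /negP; apply.
  by have := s0; nra.
have s34 : s ^+ 3 <= 2 * s ^+ 4.
  rewrite [s ^+ 4]exprS mulrA ler_peMl ?(exprn_ge0 _ (ltW s0))//; lra.
have z0 := edge_density_ge0.
have VT : V <= s ^+ 2 by rewrite sT /deg_scale; have := g0; lra.
have He2 := He; set X := \sum_i t i ^+ 2 * d i in He2.
have hX : X <= (e2 + z) * s ^+ 3.
  have -> : (e2 + z) * s ^+ 3 = centred_deg3 a + z * s * s ^+ 2 by rewrite Ce; ring.
  apply: (@le_trans _ _ (centred_deg3 a + z * s * V)); last first.
    by rewrite lerD2l ler_wpM2l// mulr_ge0// ltW.
  rewrite /X /centred_deg3 /deg_disp mulr_sumr -big_split; apply: ler_sum => i _ /=.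
  have di : d i = t i + z * s.
    rewrite {1}/centred_deg ze; field; exact: lt0r_neq0.
  rewrite di mulrDr [z * s * _]mulrC lerD2r.
  rewrite (_ : `|t i| ^+ 3 = t i ^+ 2 * `|t i|); last first.
    by rewrite exprSr real_normK ?num_real.
  by rewrite ler_wpM2l ?sqr_ge0// ler_norm.
have hX2 : X <= 2 * (e2 + z) * s ^+ 4.
  apply: le_trans hX _; have : (e2 + z) * s ^+ 3 <= (e2 + z) * (2 * s ^+ 4).
    by rewrite ler_wpM2l// addr_ge0.
  by lra.
have h4 : \sum_i t i ^+ 4 <= e2 * s ^+ 4.
  have -> : e2 * s ^+ 4 = s * centred_deg3 a by rewrite Ce; ring.
  rewrite /centred_deg3 mulr_sumr; apply: ler_sum => i _.
  have -> : t i ^+ 4 = `|t i| * `|t i| ^+ 3.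
    by rewrite -exprS -normrX ger0_norm// exprn_even_ge0.
  rewrite ler_wpM2r ?exprn_ge0// -(ler_pXn2r (n := 2))// ?nnegrE ?(ltW s0)//.
  rewrite real_normK ?num_real//; apply: le_trans VT.
  by rewrite /deg_disp (bigD1 i)//= lerDl; apply: sumr_ge0 => j _; exact: sqr_ge0.
have htr : \sum_i \sum_l codegree a i l ^+ 2 <= 2 * e1 * s ^+ 4.
  apply: le_trans (sum_codegree_sqr a_sym a01) _; rewrite -/(degsum a).
  have -> : 2 * e1 * s ^+ 4 = 2 * s * deg2 a by rewrite De; ring.
  rewrite ler_wpM2r ?deg2_ge0// -(ler_pXn2r (n := 2))// ?nnegrE ?sqrtr_ge0 ?mulr_ge0 ?(ltW s0)//.
  rewrite sqr_sqrtr// exprMn sT /deg_scale; have := V0; have := g0; lra.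
have hD : deg2 a <= 2 * e1 * s ^+ 4.
  rewrite De; have : e1 * s ^+ 3 <= e1 * (2 * s ^+ 4) by rewrite ler_wpM2l.
  by lra.
rewrite /fluct -/X; have -> : \sum_i nb_centred_deg a i ^+ 2 = e3 * s ^+ 4 + X by rewrite -He2; ring.
lra.
Qed.

(** The two conditions on [c] compare it with the coefficients of [V] and of
    [g2 / 2] in the lower bound for the variance. *)
Lemma reduced_var_ge (c : R) : c <= k * bias R N m ^+ 2 -> c <= 2 * k ^+ 2 ->
  T * (c - (2 / N%:R + 2 * z ^+ 2 + 175 / Num.sqrt N%:R)) <= reduced_var m a.
Proof.
move=> c1 c2; have := reduced_var_lower mN N2 a_sym a_diag a01.
rewrite -/(reduced_var m a); apply: le_trans.
have /andP[k0 k1] := pq01 R mN; set q := k in c1 c2 k0 k1 *.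
have T0 : 0 <= T by apply: le_trans Tge; lra.
have kk : q ^+ 2 <= 1 by rewrite expr_le1.
have h1 : deg2 a / (N%:R - 1) <= T * (2 / N%:R + 2 * z ^+ 2).
  apply: (@le_trans _ _ (2 * deg2 a / N%:R)).
    rewrite ler_pdivrMr// mulrAC ler_pdivlMr//.
    have : 2 <= N%:R :> R by rewrite ler_nat.
    have := deg2_ge0 a; nra.
  rewrite (deg2E N2 a) ze.
  have -> : 2 * (V + (z * (N%:R * s)) ^+ 2 / N%:R) / N%:R = V * (2 / N%:R) + s ^+ 2 * (2 * z ^+ 2).
    by field; exact: lt0r_neq0.
  rewrite sT mulrDr lerD2r ler_wpM2r ?divr_ge0 ?(ltW N0)//.
  rewrite /deg_scale; have := g0; lra.
have d0 : 0 <= deg2 a / (N%:R - 1) by rewrite divr_ge0 ?deg2_ge0 ?(ltW N1).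
set D := deg2 a / _ in h1 d0 *.
have h2 : q ^+ 2 * D <= D by rewrite ler_piMl.
have h3 : c * V <= q * bias R N m ^+ 2 * V by rewrite ler_wpM2r.
have h4 : c * (g2 / 2) <= 2 * q ^+ 2 * (g2 / 2) by rewrite ler_wpM2r ?divr_ge0.
have h5 : c * T = c * V + c * (g2 / 2) by rewrite /deg_scale; ring.
have -> : 175 * T / Num.sqrt N%:R = T * (175 / Num.sqrt N%:R) by ring.
rewrite mulrBr mulrDr; set w := T * (175 / _); set y := T * (2 / _ + _) in h1 *.
lra.
Qed.

Lemma stein_bound_rate (f f' : R -> R) (K c : R) :
  (forall y : R, is_derive y 1 f (f' y)) ->
  (forall y, `|f' y| <= K) ->
  (forall y w, `|f' y - f' w| <= K * `|y - w|) ->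
  0 < c -> c * T <= reduced_var m a ->
  `|perm_expectation m (fun A => f' (zscore m a A) - zscore m a A * f (zscore m a A))| <=
  K * ((142 * Num.sqrt (e3 + 4 * (e2 + z) + 4 * e1 + e2) + 1396 / Num.sqrt N%:R) / (2 * c) +
       36 * (e2 + 29 * e1) / Num.sqrt c ^+ 3).
Proof.
move=> fd fb fl c0 cT.
have T0 : 0 < T by apply: lt_le_trans Tge; lra.
have cT0 : 0 < c * T by rewrite mulr_gt0.
have v0 : 0 < reduced_var m a by apply: lt_le_trans cT.
apply: le_trans (stein_bound mN N2 a_sym a_diag a01 fd fb fl v0) _.
have K0 : 0 <= K by apply: le_trans (fb 0).
apply: ler_wpM2l => //; apply: lerD.
  set b := _ + e2.
  have hB : Num.sqrt (fluct a) <= T * Num.sqrt b.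
    apply: le_trans (ler_wsqrtr fluct_le) _.
    rewrite (_ : s ^+ 4 = T ^+ 2); last by rewrite -sT -exprM.
    by rewrite sqrtrM ?sqr_ge0// sqrtr_sqr ger0_norm// ltW.
  have -> : (142 * Num.sqrt b + 1396 / Num.sqrt N%:R) / (2 * c) =
     T * (142 * Num.sqrt b + 1396 / Num.sqrt N%:R) / (2 * (c * T)).
    by field; rewrite !lt0r_neq0// sqrtr_gt0.
  apply: ler_pM.
  - apply: addr_ge0; first exact: (mulr_ge0 (ler0n R 142) (sqrtr_ge0 _)).
    exact: (divr_ge0 (mulr_ge0 (ler0n R 1396) (ltW T0)) (sqrtr_ge0 _)).
  - by rewrite invr_ge0 mulr_ge0// ltW.
  - have -> : T * (142 * Num.sqrt b + 1396 / Num.sqrt N%:R) =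
        142 * (T * Num.sqrt b) + 1396 * T / Num.sqrt N%:R by ring.
    by apply: lerD => //; exact: (ler_wpM2l (ler0n R 142) hB).
  - by rewrite lef_pV2 ?posrE ?mulr_gt0// ler_pM2l.
have -> : 36 * (e2 + 29 * e1) / Num.sqrt c ^+ 3 = 36 * (centred_deg3 a + 29 * deg2 a) / (Num.sqrt c * s) ^+ 3.
  by rewrite Ce De; field; rewrite !lt0r_neq0// sqrtr_gt0.
have cs0 : 0 < Num.sqrt c * s by rewrite mulr_gt0// sqrtr_gt0.
apply: ler_pM => //.
- apply: mulr_ge0 => //; apply: addr_ge0; first by apply: sumr_ge0 => i _; rewrite exprn_ge0.
  by rewrite mulr_ge0// deg2_ge0.
- rewrite lef_pV2 ?posrE ?exprn_gt0 ?sqrtr_gt0// lerXn2r ?nnegrE ?sqrtr_ge0 ?(ltW cs0)//.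
  have -> : s = Num.sqrt T by rewrite -sT sqrtr_sqr gtr0_norm.
  by rewrite -sqrtrM ?(ltW c0)// ler_wsqrtr.
Qed.

End Rates.

(** * Piecewise linear test functions and limits at zero *)

Section Ramp.
Variable R : realType.
Implicit Types a b x y : R.

Definition ramp a b x : R := Num.max 0 (Num.min 1 ((b - x) / (b - a))).

Lemma clip_cases x (c := Num.max 0 (Num.min 1 x)) :
  [\/ c = 0 /\ x <= 0, c = x /\ 0 <= x <= 1 | c = 1 /\ 1 <= x].
Proof.
rewrite /c; case: (leP 1 x) => x1; first by rewrite (max_idPr ler01); apply: Or33.
case: (leP 0 x) => x0; first by apply: Or32; rewrite (ltW x1).
by apply: Or31; rewrite (ltW x0).
Qed.

Lemma clip_lip x y :
  `|Num.max 0 (Num.min 1 x) - Num.max 0 (Num.min 1 y)| <= `|x - y|.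
Proof.
wlog xy : x y / y <= x.
  by move=> W; have [/W//|/ltW/W] := leP y x; rewrite distrC [`|y - x|]distrC.
have Cx := clip_cases x; have Cy := clip_cases y.
set u := Num.max _ _ in Cx *; set v := Num.max _ _ in Cy *.
rewrite [leRHS]ger0_norm ?subr_ge0// ler_norml; apply/andP.
by case: Cx => -[-> ?]; case: Cy => -[-> ?]; split; lra.
Qed.

Variables a b : R.
Hypothesis ab : a < b.

Let ba : 0 < b - a. Proof. by rewrite subr_gt0. Qed.

Lemma ramp01 x : 0 <= ramp a b x <= 1.
Proof. by rewrite /ramp le_max lexx /= ge_max ler01 ge_min lexx. Qed.

Lemma ramp_left x : x <= a -> ramp a b x = 1.
Proof.
move=> xa; have h : 1 <= (b - x) / (b - a) by rewrite ler_pdivlMr// mul1r lerB.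
by rewrite /ramp (min_idPl h) (max_idPr ler01).
Qed.

Lemma ramp_right x : b <= x -> ramp a b x = 0.
Proof.
move=> bx; have h : (b - x) / (b - a) <= 0 by rewrite ler_pdivrMr// mul0r subr_le0.
by rewrite /ramp; apply/max_idPl; rewrite ge_min h orbT.
Qed.

Lemma ramp_lip x y : `|ramp a b x - ramp a b y| <= (b - a)^-1 * `|x - y|.
Proof.
apply: le_trans (clip_lip _ _) _.
rewrite -mulrBl normrM mulrC gtr0_norm ?invr_gt0// ler_pM2l ?invr_gt0//.
by rewrite (_ : b - x - (b - y) = - (x - y)) ?normrN//; ring.
Qed.
End Ramp.

Section CubeRootLimit.
Variable R : realType.

Lemma cvg0_of_cube (z e : nat -> R) : (\forall N \near \oo, 0 <= z N /\ z N ^+ 3 <= e N) ->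
  e N @[N --> \oo] --> 0 -> z N @[N --> \oo] --> 0.
Proof.
move=> h he; apply/cvgr0Pnorm_lt => eps eps0.
have h2 : \forall N \near \oo, `|e N| < eps ^+ 3.
  by move/cvgr0Pnorm_lt : he; apply; exact: exprn_gt0.
near=> N; have [z0 z3] : 0 <= z N /\ z N ^+ 3 <= e N by near: N.
have he3 : `|e N| < eps ^+ 3 by near: N.
rewrite ger0_norm// -(ltr_pXn2r (n := 3))// ?nnegrE//; last exact: ltW.
by apply: le_lt_trans z3 _; apply: le_lt_trans he3; exact: ler_norm.
Unshelve. all: by end_near. Qed.

Lemma cvg_sqrt0 (u : nat -> R) : u N @[N --> \oo] --> 0 ->
  Num.sqrt (u N) @[N --> \oo] --> 0.
Proof.
move=> h; rewrite -[X in _ --> X](sqrtr0 R).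
by apply: (cvg_comp _ _ h); exact: sqrt_continuous.
Qed.

Lemma cvg_inv_nat : (N%:R^-1 : R) @[N --> \oo] --> 0.
Proof.
apply/gtr0_cvgV0; last exact: cvgr_idn.
by near=> N; rewrite ltr0n; near: N; exists 1%N.
Unshelve. all: by end_near. Qed.

Lemma powR_three_halves (x : R) : 0 <= x -> x `^ (3 / 2) = Num.sqrt x ^+ 3.
Proof.
move=> x0; rewrite mulrC powRrM powR12_sqrt// -[3]/(3%:R) powR_mulrn ?sqrtr_ge0//.
Qed.
End CubeRootLimit.

(** * Passage to the limit *)

Section Limit.
Variables (R : realType) (r : R) (m n : nat -> nat) (G : forall N : nat, {set {set 'I_N}}).
Hypothesis hmn : forall N : nat, (m N + n N)%N = N.
Hypotheses (hr0 : 0 < r) (hr1 : r < 1) (hr2 : r != 1 / 2).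
Hypothesis hm : (m N)%:R / N%:R @[N --> \oo] --> r.
Hypothesis hG : forall N : nat, simple_graph (G N).
Hypothesis h1 : is_little_o
            (fun N => \sum_(i < N) #|edges_at (G N) i|%:R ^+ 2)
            (fun N => scaleT R (G N) `^ (3 / 2)).
Hypothesis h2 : is_little_o
            (fun N => \sum_(i < N) `|centered_degree R (G N) i| ^+ 3)
            (fun N => scaleT R (G N) `^ (3 / 2)).
Hypothesis h3 : is_little_o
            (fun N => \sum_(i < N)
               \sum_(j in neighbours (G N) i)
               \sum_(k in neighbours (G N) i | j != k)
                 centered_degree R (G N) j * centered_degree R (G N) k)
            (fun N => scaleT R (G N) ^+ 2).

Local Notation a N := (@adjacency R N (G N)).
Let a_sym N := @adjacency_sym R N (G N).
Let a_diag N := @adjacency_diag R N (G N).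
Let a01 N := @adjacency01 R N (G N).
Let mN N : (m N <= N)%N. Proof. by rewrite -{2}(hmn N) leq_addr. Qed.

Let T N := deg_scale (a N).
Let s N := Num.sqrt (T N).
Let e1 N : R := deg2 (a N) / s N ^+ 3.
Let e2 N : R := centred_deg3 (a N) / s N ^+ 3.
Let e3 N : R := (\sum_i nb_centred_deg (a N) i ^+ 2 - \sum_i centred_deg (a N) i ^+ 2 * degree (a N) i) / s N ^+ 4.
Let z N : R := degsum (a N) / (N%:R * s N).

Let T_ge0 N : 0 <= T N. Proof. exact: (deg_scale_ge0 (@a01 N)). Qed.

Let sT N : s N ^+ 2 = T N. Proof. exact: sqr_sqrtr. Qed.

Let TE N : scaleT R (G N) = T N. Proof. by rewrite /T deg_scale_adjacency. Qed.

Let powE N : scaleT R (G N) `^ (3 / 2) = s N ^+ 3.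
Proof. by rewrite TE powR_three_halves. Qed.

Let e1_cvg : e1 N @[N --> \oo] --> 0.
Proof.
have [_] := h1; rewrite (_ : (fun N => _ / _) = e1)//; apply/funext => N.
rewrite powE /e1; congr (_ / _); apply: eq_bigr => i _.
by rewrite degree_adjacency.
Qed.

Let e2_cvg : e2 N @[N --> \oo] --> 0.
Proof.
have [_] := h2; rewrite (_ : (fun N => _ / _) = e2)//; apply/funext => N.
rewrite powE /e2; congr (_ / _); apply: eq_bigr => i _.
by rewrite centred_deg_adjacency.
Qed.

Let e3_cvg : e3 N @[N --> \oo] --> 0.
Proof.
have [_] := h3; rewrite (_ : (fun N => _ / _) = e3)//; apply/funext => N.
by rewrite TE sum_neighbour_pairs// -sT -exprM.
Qed.

Let T_near : \forall N \near \oo, 1 / 2 <= T N.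
Proof.
have [+ _] := h3; apply: filterS => N; rewrite TE expf_eq0/= => T0.
exact: (deg_scale_ge_half (@a01 N)).
Qed.

Let N_near : \forall N \near \oo, (1 < N)%N. Proof. by exists 2%N. Qed.

Let z_near : \forall N \near \oo, 0 <= z N /\ z N ^+ 3 <= e1 N.
Proof.
near=> N.
have N2 : (1 < N)%N by near: N.
have TN : 1 / 2 <= T N by near: N.
have s0 : 0 < s N by rewrite sqrtr_gt0; apply: lt_le_trans TN.
have N0 : 0 < N%:R :> R by rewrite ltr0n ltnW.
have De : deg2 (a N) = e1 N * s N ^+ 3 by rewrite /e1 divfK// lt0r_neq0// exprn_gt0.
have ze : degsum (a N) = z N * (N%:R * s N).
  by rewrite /z divfK// lt0r_neq0// mulr_gt0.
split; first exact: (edge_density_ge0 N2 (@a01 N) s0 ze).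
exact: (edge_density_cube N2 (@a_diag N) (@a01 N) s0 De ze).
Unshelve. all: by end_near. Qed.

Let z_cvg : z N @[N --> \oo] --> 0. Proof. exact: cvg0_of_cube z_near e1_cvg. Qed.

Let rsqrtN_cvg : (Num.sqrt N%:R)^-1 @[N --> \oo] --> (0 : R).
Proof.
rewrite (_ : (fun N => _) = (fun N : nat => Num.sqrt (N%:R^-1 : R))).
  exact: (cvg_sqrt0 (@cvg_inv_nat R)).
by apply/funext => N; rewrite sqrtrV.
Qed.

Let cst0 (c : R) (u : nat -> R) : u N @[N --> \oo] --> 0 -> c * u N @[N --> \oo] --> 0.
Proof. by move=> h; rewrite -[X in _ --> X](mulr0 c); apply: cvgM => //; exact: cvg_cst. Qed.

Let add0 (u v : nat -> R) : u N @[N --> \oo] --> 0 -> v N @[N --> \oo] --> 0 ->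
  u N + v N @[N --> \oo] --> 0.
Proof. by move=> hu hv; rewrite -[X in _ --> X](addr0 0); exact: cvgD. Qed.

Let beta N := e3 N + 4 * (e2 N + z N) + 4 * e1 N + e2 N.

Let beta_cvg : beta N @[N --> \oo] --> 0.
Proof.
apply: add0 => //; apply: add0; last exact: cst0.
by apply: add0 => //; apply: cst0; exact: add0.
Qed.

Let var_near : exists2 c : R, 0 < c & \forall N \near \oo, c * T N <= reduced_var (m N) (a N).
Proof.
pose k := r * (1 - r); pose mu2 := (2 * r - 1) ^+ 2.
have k0 : 0 < k by rewrite mulr_gt0// subr_gt0.
have mu0 : 0 < mu2.
  rewrite exprn_even_gt0//= subr_eq0; apply: contra hr2 => /eqP e.
  by apply/eqP; lra.
pose c := Num.min (k * mu2 / 4) (k ^+ 2 / 2).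
have c0 : 0 < c.
  by rewrite lt_min (divr_gt0 (mulr_gt0 k0 mu0))// (divr_gt0 (exprn_gt0 2 k0)).
exists (c / 2); first exact: divr_gt0.
have kcvg : mean_label R N (m N) * (1 - mean_label R N (m N)) @[N --> \oo] --> k.
  by apply: cvgM => //; apply: cvgB => //; exact: cvg_cst.
have mcvg : bias R N (m N) ^+ 2 @[N --> \oo] --> mu2.
  rewrite /mu2 (_ : (fun N => _) = (fun N => bias R N (m N) * bias R N (m N))); last first.
    by apply/funext => N; rewrite expr2.
  have b : bias R N (m N) @[N --> \oo] --> 2 * r - 1.
    by apply: cvgB; [apply: cvgM => //; exact: cvg_cst|exact: cvg_cst].
  by rewrite expr2; exact: cvgM.
have kn : \forall N \near \oo, k / 2 < mean_label R N (m N) * (1 - mean_label R N (m N)).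
  by apply: (cvgr_gt k kcvg); rewrite ltr_pdivrMr// ltr_pMr// ltr1n.
have mn : \forall N \near \oo, mu2 / 2 < bias R N (m N) ^+ 2.
  by apply: (cvgr_gt mu2 mcvg); rewrite ltr_pdivrMr// ltr_pMr// ltr1n.
have small : \forall N \near \oo,
    2 * N%:R^-1 + 2 * (z N * z N) + 175 * (Num.sqrt N%:R)^-1 < c / 2.
  apply: (cvgr_lt (0 : R)); last by rewrite divr_gt0.
  apply: add0; last by apply: cst0.
  apply: add0; first by apply: cst0; exact: cvg_inv_nat.
  by apply: cst0; rewrite -[X in _ --> X](mulr0 0); exact: cvgM.
near=> N.
have N2 : (1 < N)%N by near: N.
have TN : 1 / 2 <= T N by near: N.
have s0 : 0 < s N by rewrite sqrtr_gt0; apply: lt_le_trans TN.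
have N0 : 0 < N%:R :> R by rewrite ltr0n ltnW.
have ze : degsum (a N) = z N * (N%:R * s N).
  by rewrite /z divfK// lt0r_neq0// mulr_gt0.
have kN : k / 2 < mean_label R N (m N) * (1 - mean_label R N (m N)) by near: N.
have muN : mu2 / 2 < bias R N (m N) ^+ 2 by near: N.
have sm : 2 * N%:R^-1 + 2 * (z N * z N) + 175 * (Num.sqrt N%:R)^-1 < c / 2 by near: N.
have c1 : c <= mean_label R N (m N) * (1 - mean_label R N (m N)) * bias R N (m N) ^+ 2.
  rewrite ge_min; apply/orP; left.
  rewrite (_ : k * mu2 / 4 = (k / 2) * (mu2 / 2)); last by field.
  by apply: ler_pM; rewrite ?divr_ge0// ltW.
have c2 : c <= 2 * (mean_label R N (m N) * (1 - mean_label R N (m N))) ^+ 2.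
  rewrite ge_min; apply/orP; right.
  rewrite (_ : k ^+ 2 / 2 = 2 * (k / 2) ^+ 2); last by field.
  by rewrite ler_pM2l// lerXn2r ?nnegrE ?divr_ge0// ltW// (lt_trans _ kN)// divr_gt0.
have := reduced_var_ge (mN N) N2 (@a_sym N) (@a_diag N) (@a01 N) (sT N) TN ze c1 c2.
apply: le_trans; rewrite mulrC; apply: ler_wpM2l => //.
have : 2 / N%:R + 2 * z N ^+ 2 + 175 / Num.sqrt N%:R < c / 2 by rewrite expr2.
set w := _ + _ + _; lra.
Unshelve. all: by end_near. Qed.

Lemma stein_cvg (f f' : R -> R) (K : R) :
  (forall y : R, is_derive y 1 f (f' y)) ->
  (forall y, `|f' y| <= K) ->
  (forall y w, `|f' y - f' w| <= K * `|y - w|) ->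
  perm_expectation (m N) (fun A => f' (zscore (m N) (a N) A) -
     zscore (m N) (a N) A * f (zscore (m N) (a N) A)) @[N --> \oo] --> 0.
Proof.
move=> fd fb fl; have [c c0 hc] := var_near.
pose rho N := K * ((2 * c)^-1 * (142 * Num.sqrt (beta N) + 1396 * (Num.sqrt N%:R)^-1) +
   (36 / Num.sqrt c ^+ 3) * (e2 N + 29 * e1 N)).
have rho0 : rho N @[N --> \oo] --> 0.
  apply: cst0; apply: add0; apply: cst0.
    by apply: add0; apply: cst0 => //; exact: cvg_sqrt0.
  by apply: add0 => //; exact: cst0.
apply/norm_cvg0P; apply: (squeeze_cvgr _ (cvg_cst (0 : R)) rho0).
near=> N; apply/andP; split => //.
have N2 : (1 < N)%N by near: N.
have TN : 1 / 2 <= T N by near: N.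
have cN : c * T N <= reduced_var (m N) (a N) by near: N.
have s0 : 0 < s N by rewrite sqrtr_gt0; apply: lt_le_trans TN.
have N0 : 0 < N%:R :> R by rewrite ltr0n ltnW.
have De : deg2 (a N) = e1 N * s N ^+ 3 by rewrite /e1 divfK// lt0r_neq0// exprn_gt0.
have Ce : centred_deg3 (a N) = e2 N * s N ^+ 3 by rewrite /e2 divfK// lt0r_neq0// exprn_gt0.
have He : \sum_i nb_centred_deg (a N) i ^+ 2 - \sum_i centred_deg (a N) i ^+ 2 * degree (a N) i = e3 N * s N ^+ 4.
  by rewrite /e3 divfK// lt0r_neq0// exprn_gt0.
have ze : degsum (a N) = z N * (N%:R * s N).
  by rewrite /z divfK// lt0r_neq0// mulr_gt0.
have := stein_bound_rate (mN N) N2 (@a_sym N) (@a_diag N) (@a01 N) s0 (sT N) TN De Ce He ze fd fb fl c0 cN.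
move=> /le_trans; apply.
rewrite /rho [(2 * c)^-1 * _]mulrC -/(beta N); apply: ler_wpM2l.
  by apply: le_trans (fb 0).
by rewrite lerD2l mulrAC.
Unshelve. all: by end_near. Qed.

Lemma ramp_cvg (u v : R) : u < v -> exists2 c : R,
  perm_expectation (m N) (fun A => ramp u v (zscore (m N) (a N) A)) @[N --> \oo] --> c &
  gauss_cdf u <= c <= gauss_cdf v.
Proof.
move=> uv.
have [c [f [f' [K [fd fe fb fl cb]]]]] := stein_solution (ltW uv) (ramp01 u v)
  (ramp_left uv) (@ramp_right R u v uv) (ramp_lip uv).
exists c => //; have := stein_cvg fd fb fl.
rewrite (_ : (fun N => _) = (fun N => perm_expectation (m N) (fun A => ramp u v (zscore (m N) (a N) A)) - c)).
  by move=> h; apply/subr_cvg0.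
apply/funext => N; under [X in perm_expectation _ X]eq_fun do rewrite fe.
by rewrite perm_expectB perm_expect_cst.
Qed.

Lemma edge_count_cdfE (x : R) N : (1 < N)%N -> edge_count_cdf (m N) (G N) x =
  perm_expectation (m N) (fun A => if zscore (m N) (a N) A <= x then 1 else 0).
Proof.
move=> N2; rewrite /edge_count_cdf /perm_prob big_mkcondr.
apply: eq_bigr => A /eqP cA; rewrite edge_count_stat_zscore//.
by case: ifP; rewrite ?mulr1 ?mulr0.
Qed.

(** The indicator of the half-line ending at [x] lies between the ramps
    descending on [x - dl, x] and on [x, x + dl]. *)
Lemma edge_count_cdf_cvg (x : R) : edge_count_cdf (m N) (G N) x @[N --> \oo] --> gauss_cdf x.
Proof.
apply/cvgrPdist_lt => eps eps0.
have eps2 : 0 < eps / 2 by exact: divr_gt0.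
have [dl dl0 hdl] : exists2 dl : R, 0 < dl &
    forall y, `|x - y| <= dl -> `|gauss_cdf x - gauss_cdf y| < eps / 2.
  have /cvgrPdist_lt/(_ _ eps2) := is_derive_cts (is_derive_gauss_cdf x).
  move=> /nbhs_ballP[e /= e0 he]; exists (e / 2); first exact: divr_gt0.
  move=> y xy; apply: he; rewrite /ball/=; apply: le_lt_trans xy _.
  by rewrite ltr_pdivrMr// ltr_pMr// ltr1n.
have xl : x - dl < x by rewrite ltrBlDr ltrDl.
have xr : x < x + dl by rewrite ltrDl.
have [cl hl /andP[cl1 _]] := ramp_cvg xl.
have [cr hr /andP[_ cr2]] := ramp_cvg xr.
have hl2 : \forall N \near \oo, cl - eps / 2 <
    perm_expectation (m N) (fun A => ramp (x - dl) x (zscore (m N) (a N) A)).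
  by apply: (cvgr_gt cl hl); rewrite ltrBlDr ltrDl.
have hr2' : \forall N \near \oo,
    perm_expectation (m N) (fun A => ramp x (x + dl) (zscore (m N) (a N) A)) < cr + eps / 2.
  by apply: (cvgr_lt cr hr); rewrite ltrDl.
have dlx : `|x - (x - dl)| <= dl by rewrite opprB addrCA subrr addr0 gtr0_norm.
have drx : `|x - (x + dl)| <= dl by rewrite opprD addrA subrr sub0r normrN gtr0_norm.
have := hdl _ dlx; have := hdl _ drx; rewrite !ltr_norml => /andP[p1 p2] /andP[p3 p4].
near=> N.
have N2 : (1 < N)%N by near: N.
have q1 : cl - eps / 2 <
    perm_expectation (m N) (fun A => ramp (x - dl) x (zscore (m N) (a N) A)) by near: N.
have q2 : perm_expectation (m N) (fun A => ramp x (x + dl) (zscore (m N) (a N) A)) < cr + eps / 2.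
  by near: N.
have q3 : perm_expectation (m N) (fun A => ramp (x - dl) x (zscore (m N) (a N) A)) <=
    edge_count_cdf (m N) (G N) x.
  rewrite edge_count_cdfE//; apply: perm_expect_le => A _; case: ifPn => [_|].
    by have /andP[] := ramp01 (x - dl) x (zscore (m N) (a N) A).
  by rewrite -ltNge => /ltW zx; rewrite ramp_right.
have q4 : edge_count_cdf (m N) (G N) x <=
    perm_expectation (m N) (fun A => ramp x (x + dl) (zscore (m N) (a N) A)).
  rewrite edge_count_cdfE//; apply: perm_expect_le => A _; case: ifPn => [zx|_].
    by rewrite ramp_left.
  by have /andP[] := ramp01 x (x + dl) (zscore (m N) (a N) A).
rewrite ltr_norml; apply/andP; split; lra.
Unshelve. all: by end_near. Qed.

End Limit.

Theorem theorem10 (R : realType) (r : R) (m n : nat -> nat)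
    (G : forall N : nat, {set {set 'I_N}})
    (hmn : forall N : nat, (m N + n N)%N = N)
    (hr0 : 0 < r) (hr1 : r < 1) (hr2 : r != 1 / 2)
    (hm : (m N)%:R / N%:R @[N --> \oo] --> r)
    (hG : forall N : nat, simple_graph (G N))
    (h1 : is_little_o
            (fun N => \sum_(i < N) #|edges_at (G N) i|%:R ^+ 2)
            (fun N => scaleT R (G N) `^ (3 / 2)))
    (h2 : is_little_o
            (fun N => \sum_(i < N) `|centered_degree R (G N) i| ^+ 3)
            (fun N => scaleT R (G N) `^ (3 / 2)))
    (h3 : is_little_o
            (fun N => \sum_(i < N)
               \sum_(j in neighbours (G N) i)
               \sum_(k in neighbours (G N) i | j != k)
                 centered_degree R (G N) j * centered_degree R (G N) k)
            (fun N => scaleT R (G N) ^+ 2)) :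
  cvg_in_distribution
    (fun N => edge_count_cdf (m N) (G N))
    (normal_prob (0 : R) 1).
Proof.
move=> x _.
exact: (edge_count_cdf_cvg hmn hr0 hr1 hr2 hm hG h1 h2 h3).
Qed.
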